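(* Let $p>1$, $T>0$ and $\Omega=(-T,T)$. For every $-\Delta_p^{H_{a,b}}\in\mathcal E(\Omega)$ we have $$\Lambda^{\min}(-T,T)\,\max\{a,b\}^p\le\lambda_1(-\Delta_p^{H_{a,b}})\le\Lambda^{\max}(-T,T)\,\max\{a,b\}^p,$$ where the optimal constants are $$\Lambda^{\max}(-T,T)=\lambda_{1,p}(-T,T),\qquad \Lambda^{\min}(-T,T)=\frac1{2^p}\lambda_{1,p}(-T,T).$$ Moreover, the extremal operators for the right inequality are exactly the (positive) multiples of $-\Delta_p$, and the extremal operators for the left inequality are exactly $-\Delta_p^{H_{a,0}}$ and $-\Delta_p^{H_{0,b}}$ with $a,b>0$, which do not belong to $\mathcal E(\Omega)$.
   Context: $t^\pm=\max\{\pm t,0\}$ and, for $a,b\ge0$, $H_{a,b}(t)=at^++bt^-$; then $\|H_{a,b}\|:=\max_{|x|=1}H_{a,b}(x)=\max\{a,b\}$. Set $$\lambda_p^{H_{a,b}}(\Omega):=\inf\Big\{\int_\Omega H_{a,b}(u')^p\,dt:\ u\in W_0^{1,p}(\Omega),\ \|u\|_p=1\Big\},$$ and let $\lambda_{1,p}(\Omega)=\lambda_p^{H_{1,1}}(\Omega)$ be the first Dirichlet eigenvalue of the $p$-Laplacian $-\Delta_pu=-(|u'|^{p-2}u')'$. The operator is $-\Delta_p^{H_{a,b}}u=-\big(a^p[(u')^+]^{p-1}-b^p[(u')^-]^{p-1}\big)'$. $\mathcal E(\Omega)$ is the set of operators $-\Delta_p^{H_{a,b}}$, $a,b\ge 0$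 not both zero, such that $\lambda_p^{H_{a,b}}(\Omega)$ is a fundamental frequency, i.e. there is a non-zero $u\in W_0^{1,p}(\Omega)$ with $\int_\Omega (a^p[(u')^+]^{p-1}-b^p[(u')^-]^{p-1})\varphi'\,dt=\lambda_p^{H_{a,b}}(\Omega)\int_\Omega|u|^{p-2}u\varphi\,dt$ for all $\varphi\in W_0^{1,p}(\Omega)$. For operators in $\mathcal E(\Omega)$ write $\lambda_1(-\Delta_p^{H})=\lambda_p^{H}(\Omega)$. The optimal constants $\Lambda^{\max}(\Omega)$ and $\Lambda^{\min}(\Omega)$ are the supremum and infimum of $\lambda_1(-\Delta_p^H)$ over $-\Delta_p^H\in\mathcal E(\Omega)$ with $\|H\|=1$. An operator $-\Delta_p^{H_{a,b}}$ with $(a,b)\ne(0,0)$ (not necessarily in $\mathcal E(\Omega)$) is extremal for one of the inequalities if that inequality is an equality when $\lambda_1(-\Delta_p^{H_{a,b}})$ is read as $\lambda_p^{H_{a,b}}(\Omega)$. *)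

(* Defs.v *)
From HB Require Import structures.
From mathcomp Require Import all_boot all_order all_algebra.
From mathcomp Require Import all_classical all_reals all_analysis.

Set Implicit Arguments.
Unset Strict Implicit.
Unset Printing Implicit Defensive.

Import Order.TTheory GRing.Theory Num.Theory.
Import numFieldNormedType.Exports.

Local Open Scope classical_set_scope.
Local Open Scope ring_scope.

Section sobolev.
Context {R : realType}.
Implicit Types (Omega : set R) (p : R) (u du phi : R -> R).

Local Notation mu := (@lebesgue_measure R).

Definition norm_p Omega p u : \bar R := 'N[mu]_(p%:E)[EFin \o (u \_ Omega)]%E.

Definition in_Lp Omega p u : Prop :=
  measurable_fun Omega u /\ (norm_p Omega p u < +oo)%E.

(** [C_c^oo(Omega)], as functions on the whole line. *)
Definition test_function Omega phi : Prop :=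
  [/\ forall (n : nat) (x : R), derivable (derive1n n phi) x 1,
      compact (closure [set x | phi x != 0]) &
      closure [set x | phi x != 0] `<=` Omega].

Definition weak_derivative Omega u du : Prop :=
  forall phi, test_function Omega phi ->
    (\int[mu]_(x in Omega) (u x * derive1 phi x)%:E =
     - \int[mu]_(x in Omega) (du x * phi x)%:E)%E.

(** [u] belongs to [W^{1,p}(Omega)] and [du] represents [u'].  Elements of
    Lebesgue and Sobolev spaces are represented by functions; [du] is unique
    up to a.e. equality on [Omega], so it is carried along with [u]. *)
Definition W1p Omega p u du : Prop :=
  [/\ in_Lp Omega p u, in_Lp Omega p du & weak_derivative Omega u du].

(** [W_0^{1,p}(Omega)]: closure of [C_c^oo(Omega)] in [W^{1,p}(Omega)]. *)
Definition W01p Omega p u du : Prop :=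
  W1p Omega p u du /\
  forall e : R, 0 < e -> exists phi, test_function Omega phi /\
    (norm_p Omega p (u \- phi)%R + norm_p Omega p (du \- derive1 phi)%R < e%:E)%E.

End sobolev.

Section asymmetric_p_laplacian.
Context {R : realType}.
Implicit Types (Omega : set R) (p a b c t : R) (u du phi dphi : R -> R).

Local Notation mu := (@lebesgue_measure R).

Definition ppart t : R := Num.max t 0.
Definition npart t : R := Num.max (- t) 0.

Definition finslerH a b t : R := a * ppart t + b * npart t.

Definition normH a b : R := sup [set finslerH a b x | x in [set x : R | `|x| = 1]].

Definition lambdaH p a b Omega : \bar R :=
  ereal_inf [set l : \bar R | exists u du,
    [/\ W01p Omega p u du, norm_p Omega p u = 1%:E &
        l = (\int[mu]_(t in Omega) (finslerH a b (du t) `^ p)%:E)%E]].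

Definition lambda1 p Omega : \bar R := lambdaH p 1 1 Omega.

(** The duality pairings [< - Delta_p^H u, phi >] and [< - Delta_p u, phi >],
    in terms of the derivatives of [u] and [phi]. *)
Definition plaplH p a b Omega du dphi : \bar R :=
  (\int[mu]_(t in Omega)
    ((a `^ p * ppart (du t) `^ (p - 1) - b `^ p * npart (du t) `^ (p - 1))
     * dphi t)%:E)%E.

Definition plapl p Omega du dphi : \bar R :=
  (\int[mu]_(t in Omega) (`|du t| `^ (p - 2) * du t * dphi t)%:E)%E.

(** [- Delta_p^{H_{a,b}} = c (- Delta_p)] as operators from
    [W_0^{1,p}(Omega)] to its dual. *)
Definition plaplH_eq_scale p a b Omega c : Prop :=
  forall u du phi dphi, W01p Omega p u du -> W01p Omega p phi dphi ->
    (plaplH p a b Omega du dphi = c%:E * plapl p Omega du dphi)%E.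

Definition fundamental_frequency p a b Omega : Prop :=
  exists u du,
    [/\ W01p Omega p u du, ~ {ae mu, forall t, Omega t -> u t = 0} &
        forall phi dphi, W01p Omega p phi dphi ->
          (plaplH p a b Omega du dphi =
           lambdaH p a b Omega *
           \int[mu]_(t in Omega) (`|u t| `^ (p - 2) * u t * phi t)%:E)%E].

Definition admissible a b : Prop := [/\ 0 <= a, 0 <= b & (a, b) != (0, 0)].

(** The operator [- Delta_p^{H_{a,b}}] is represented by the pair [(a, b)]. *)
Definition calE p Omega : set (R * R) :=
  [set ab | admissible ab.1 ab.2 /\ fundamental_frequency p ab.1 ab.2 Omega].

Definition Lambda_max p Omega : \bar R :=
  ereal_sup [set lambdaH p ab.1 ab.2 Omega |
             ab in calE p Omega `&` [set ab | normH ab.1 ab.2 = 1]].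

Definition Lambda_min p Omega : \bar R :=
  ereal_inf [set lambdaH p ab.1 ab.2 Omega |
             ab in calE p Omega `&` [set ab | normH ab.1 ab.2 = 1]].

Definition extremal_max p a b Omega : Prop :=
  admissible a b /\
  lambdaH p a b Omega = (Lambda_max p Omega * (Num.max a b `^ p)%:E)%E.

Definition extremal_min p a b Omega : Prop :=
  admissible a b /\
  (Lambda_min p Omega * (Num.max a b `^ p)%:E)%E = lambdaH p a b Omega.

End asymmetric_p_laplacian.

(* Main.v *)
(** The heart of the matter is the formula [lambda_p^{H_{a,b}} = ((a + b) / 2)^p L]
    with [L] the first eigenvalue for [a = b = 1]; everything else is read off from it.

    For [a, b > 0] let [D s = (s^+ / a)^q + (s^- / b)^q], [q] the conjugate exponent, and
    let [rho] solve the Riccati equation [rho' = - m (1 + D rho)], with the speed [m]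
    chosen so that [rho] runs from [+oo] to [-oo] on [(-T, T)].  Then
    [w = (1 + D rho)^(-1/p)] is a positive Lipschitz eigenfunction, which gives existence
    and the upper bound.  Membership of [w] in [W_0^{1,p}] comes from cut-off Bernstein
    polynomials, which converge boundedly together with their derivatives.  For the lower
    bound (Picone), a test function [phi] satisfies [int (rho (phi^+)^p)' = 0], and Young's
    inequality bounds the integrand by [H(phi')^p - lambda phi^p] where [phi > 0]; where
    [phi < 0] exchange [a] and [b].  Density, and perturbing [(a, b)] to
    [(a + d, b + d)], extend this to all [u] and all [a, b >= 0].

    With [A], [B], [I] the integrals of [(u'^+)^p], [(u'^-)^p], [|u|^p], we thus have
    [a^p A + b^p B >= ((a + b) / 2)^p L I] for all [a, b >= 0].  An eigenfunction for
    [H_{c,0}] would give equality at [(c, 0)], and letting [b -> 0+] contradicts [p > 1].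
    Finally, almost minimizers for [H_{1,0}] have [A < B] and those for [H_{0,1}] have
    [B < A], so an operator identity [- Delta_p^H = c (- Delta_p)], tested on [u] itself,
    forces [a^p = c = b^p]. *)

Require Import Defs.
From mathcomp Require Import all_boot all_order all_algebra.
From mathcomp Require Import all_classical all_reals all_analysis.
From mathcomp Require Import measurable_realfun ring lra.
Import Order.TTheory GRing.Theory Num.Theory.
Import numFieldNormedType.Exports.
Local Open Scope classical_set_scope.
Local Open Scope ring_scope.

Set Implicit Arguments.
Unset Strict Implicit.
Unset Printing Implicit Defensive.

(** * Derivatives on the line and flat functions *)

(** The exact formula comes from a crossing time. The Riccati flow crosses the line in a time equal
    to the integral of 1/(m (1 + D)); the substitutions s = a t on the right half and s = - b t on
    the left half turn it into (a + b)/m times a constant that depends on p alone. So [rate] is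
    linear in a + b, and the eigenvalue is a constant times its p-th power. The equation for rho is
    autonomous and of first order, hence solved by inverting a monotone primitive; this is why rho,
    and not w, is the primary unknown.

    Two obstacles shape the rest. W_0^{1,p} is a closure of smooth compactly supported functions, so
    w must be approximated by such functions: polynomials give smoothness, cut-offs give the
    support, and the two fit together because a Lipschitz function vanishing at the ends is of the
    order of the distance to them, which compensates the steep cut-off. And rho is infinite at both
    ends, so Picone's argument runs on test functions, whose support stays away from the ends, and
    passes to the closure as an inequality between norms. *)

Section is_derive1.
Context {R : realType}.
Implicit Types (f g : R -> R) (x df dg : R).

Lemma is_derive1D f g x df dg : is_derive x 1 f df -> is_derive x 1 g dg ->
  is_derive x 1 (fun y => f y + g y) (df + dg).
Proof. by move=> hf hg; exact: is_deriveD. Qed.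

Lemma is_derive1M f g x df dg : is_derive x 1 f df -> is_derive x 1 g dg ->
  is_derive x 1 (fun y => f y * g y) (df * g x + f x * dg).
Proof.
move=> hf hg; apply: (is_derive_eq (is_deriveM hf hg)).
by rewrite addrC [df * _]mulrC.
Qed.

Lemma is_derive1N f x df :
  is_derive x 1 f df -> is_derive x 1 (fun y => - f y) (- df).
Proof. by move=> hf; exact: is_deriveN. Qed.

Lemma is_derive1Z (c : R) f x df :
  is_derive x 1 f df -> is_derive x 1 (fun y => c * f y) (c * df).
Proof. by move=> hf; exact: is_deriveZ. Qed.

Lemma is_derive1_chain f g x df dg : is_derive (g x) 1 f df ->
  is_derive x 1 g dg -> is_derive x 1 (fun y => f (g y)) (df * dg).
Proof. by move=> hf hg; exact: (is_derive1_comp hf hg). Qed.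

Lemma is_derive1_affine (c d x : R) : is_derive x 1 (fun y => c * y + d) c.
Proof.
have -> : (fun x => c * x + d) = horner (c%:P * 'X + d%:P).
  by apply/funext => z; rewrite !hornerE.
apply: (is_derive_eq (is_derive_poly _ _)).
by rewrite !derivCE !hornerE; ring.
Qed.

Lemma is_derive1_affine_comp f (c d x df : R) : is_derive (c * x + d) 1 f df ->
  is_derive x 1 (fun y => f (c * y + d)) (df * c).
Proof.
move=> hf; apply: (@is_derive1_chain f (fun y => c * y + d)) => //.
exact: is_derive1_affine.
Qed.

Lemma is_derive1X f n x df : is_derive x 1 f df ->
  is_derive x 1 (fun y => f y ^+ n) (n%:R * f x ^+ n.-1 * df).
Proof.
move=> hf.
have -> : (fun y => f y ^+ n) = f ^+ n.
  by apply/funext => y; elim: n => // n ih; rewrite !exprS ih.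
exact: is_deriveX.
Qed.

Lemma is_derive1V x : x != 0 -> is_derive x 1 (fun y : R => y^-1) (- x^-1 ^+ 2).
Proof.
move=> x0; apply: DeriveDef; first exact: derivableV.
by rewrite deriveV// derive_id scaler1 exprVn.
Qed.

Lemma is_derive1_lim f x df :
  h^-1 * (f (h + x) - f x) @[h --> (0:R)^'] --> df -> is_derive x 1 f df.
Proof.
move=> H.
have H' : h^-1 *: ((f \o shift x) (h *: 1) - f x) @[h --> (0:R)^'] --> df.
  suff -> : (fun h : R => h^-1 *: ((f \o shift x) (h *: 1) - f x)) =
    (fun h => h^-1 * (f (h + x) - f x)) by [].
  by apply/funext => h /=; rewrite [h *: _]mulr1.
apply: DeriveDef; first by apply/cvg_ex; exists df.
exact/cvg_lim.
Qed.

Lemma is_derive1P f x df :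
  is_derive x 1 f df -> h^-1 * (f (h + x) - f x) @[h --> (0:R)^'] --> df.
Proof.
move=> hf; have /cvg_ex[l hl] := @ex_derive _ _ _ _ _ _ _ hf.
have <- : l = df by rewrite -(@derive_val _ _ _ _ _ _ _ hf); apply/esym/cvg_lim.
suff <- : (fun h : R => h^-1 *: ((f \o shift x) (h *: 1) - f x)) =
    (fun h => h^-1 * (f (h + x) - f x)) by [].
by apply/funext => h /=; rewrite [h *: _]mulr1.
Qed.

Lemma is_derive1_continuous f x df : is_derive x 1 f df -> {for x, continuous f}.
Proof.
move=> hf; apply: differentiable_continuous; apply/derivable1_diffP.
exact: (@ex_derive _ _ _ _ _ _ _ hf).
Qed.

(** Each difference quotient at [x] involves only one branch, and both families converge to [df].
    This pastes the two halves of the Riccati primitive at 0. *)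
Lemma is_derive1_glue f g x df : f x = g x ->
  is_derive x 1 f df -> is_derive x 1 g df ->
  is_derive x 1 (fun y => if y <= x then f y else g y) df.
Proof.
move=> fg /is_derive1P/cvgrPdist_le hf /is_derive1P/cvgrPdist_le hg.
apply: is_derive1_lim; apply/cvgrPdist_le => e e0.
have := hf _ e0; have := hg _ e0; apply: filterS2 => h.
rewrite lexx; case: ifPn => // _ + _.
by rewrite fg.
Qed.

End is_derive1.

Section flat.
Context {R : realType}.
Implicit Types (k n : nat) (x y z : R).

(* [flat 0] is the usual flat function; the powers of [y^-1] make the family stable
   under differentiation. *)
Definition flat k y : R := if 0 < y then y^-1 ^+ k * expR (- y^-1) else 0.

(** Raise [z / k <= expR (z / k)] to the power [k]. *)
Lemma exprn_mul_expRN_le k z : 0 < z -> z ^+ k * expR (- z) <= k%:R ^+ k.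
Proof.
move=> z0; case: k => [|k].
  by rewrite !expr0 mul1r -expR0 ler_expR oppr_le0 ltW.
have k0 : 0 < k.+1%:R :> R by rewrite ltr0n.
have h : z / k.+1%:R <= expR (z / k.+1%:R).
  by apply: le_trans (expR_ge1Dx _); rewrite lerDr.
rewrite expRN ler_pdivrMr ?expR_gt0//.
have -> : expR z = expR (z / k.+1%:R) ^+ k.+1.
  by rewrite -expRM_natl mulrC divfK// gt_eqF.
rewrite -exprMn; apply: lerXn2r; rewrite ?nnegrE ?mulr_ge0 ?expR_ge0 ?(ltW z0)//.
by rewrite mulrC -ler_pdivrMr.
Qed.

Lemma flat_ge0 k y : 0 <= flat k y.
Proof.
rewrite /flat; case: ifPn => // y0.
by rewrite mulr_ge0 ?expR_ge0// exprn_ge0// invr_ge0 ltW.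
Qed.

Lemma flat_le k y : flat k y <= k%:R ^+ k.
Proof.
rewrite /flat; case: ifPn => [y0|_]; last by rewrite exprn_ge0.
by apply: exprn_mul_expRN_le; rewrite invr_gt0.
Qed.

Lemma flat_le_expr k y : 0 < y -> flat k y <= y^-1 ^+ k.
Proof.
move=> y0; rewrite /flat y0 -[leRHS]mulr1 ler_wpM2l ?exprn_ge0 ?invr_ge0 ?(ltW y0)//.
by rewrite -expR0 ler_expR oppr_le0 invr_ge0 ltW.
Qed.

(** Every [flat k] is bounded, so a factor [y] can be traded for one more power of [y^-1] at no
    cost. This absorbs denominators at the origin and, later, the large factor produced by
    differentiating a cut-off. *)
Lemma flatS k y : flat k y = y * flat k.+1 y.
Proof.
rewrite /flat; case: ifPn => y0; last by rewrite mulr0.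
by rewrite exprS !mulrA divff ?mul1r// gt_eqF.
Qed.

Lemma is_derive_flat k y :
  is_derive y 1 (flat k) (flat k.+2 y - k%:R * flat k.+1 y).
Proof.
have [y0|y0|<-] := ltgtP 0 y.
- have ny0 : y != 0 by rewrite gt_eqF.
  have dV := is_derive1V ny0.
  have de : is_derive y 1 (fun x : R => expR (- x^-1)) (expR (- y^-1) * - (- y^-1 ^+ 2)).
    by apply: (@is_derive1_chain _ expR (fun x => - x^-1)); exact: is_derive1N.
  have dg := is_derive1M (is_derive1X k dV) de.
  apply: (@near_eq_is_derive _ _ _ (fun x : R => x^-1 ^+ k * expR (- x^-1))).
    near=> x; have x0 : 0 < x by near: x; exact: lt_nbhsr.
    by rewrite /flat x0.
  apply: (is_derive_eq dg); rewrite /flat y0.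
  by case: k dg => [|k] _ /=; rewrite ?mul0r ?add0r !exprS; ring.
- apply: (@near_eq_is_derive _ _ _ (cst 0)).
    near=> x; have x0 : x < 0 by near: x; exact: lt_nbhsl.
    by rewrite /flat ltNge (ltW x0).
  by apply: is_derive_eq; rewrite /flat ltNge (ltW y0)/= mulr0 subr0.
- have f0 m : flat m 0 = 0 by rewrite /flat ltxx.
  rewrite !f0 mulr0 subr0.
  apply: is_derive1_lim.
  apply/cvgr0Pnorm_le => e e0.
  pose C : R := k.+2%:R ^+ k.+2.
  have C0 : 0 < C by rewrite exprn_gt0// ltr0n.
  near=> h.
  have hn0 : h != 0 by near: h; exact: nbhs_dnbhs_neq.
  (* Two uses of [flatS] turn the quotient [h^-1 * flat k h] into [h * flat k.+2 h], whose second
     factor is at most [C]. *)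
  rewrite f0 subr0 addr0 (flatS k) (flatS k.+1) mulKf// normrM.
  rewrite (ger0_norm (flat_ge0 _ _)).
  apply: (@le_trans _ _ (`|h| * C)); first by rewrite ler_wpM2l// flat_le.
  rewrite -ler_pdivlMr//.
  near: h; apply: dnbhs0_le; exact: divr_gt0.
Unshelve. all: by end_near. Qed.

(** Closed under differentiation, so all iterated derivatives exist by induction without a formula
    for them. It is large enough to contain the approximants used below, products of two cut-offs
    and a polynomial. *)
Inductive smooth_class : (R -> R) -> Prop :=
| smooth_poly (q : {poly R}) : smooth_class (horner q)
| smooth_flat k (c d : R) : smooth_class (fun x => flat k (c * x + d))
| smoothD f g : smooth_class f -> smooth_class g ->
    smooth_class (fun x => f x + g x)
| smoothM f g : smooth_class f -> smooth_class g ->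
    smooth_class (fun x => f x * g x).

Lemma smooth_class_derive f : smooth_class f ->
  exists2 g, smooth_class g & forall x, is_derive x 1 f (g x).
Proof.
elim => {f} [q|k c d|f g _ [f' sf df] _ [g' sg dg]|f g hf [f' sf df] hg [g' sg dg]].
- by exists (horner q^`()); [exact: smooth_poly|move=> x; exact: is_derive_poly].
- exists (fun x => (flat k.+2 (c * x + d) + (- k%:R)%:P.[x] * flat k.+1 (c * x + d))
     * c%:P.[x]).
    apply: smoothM; last exact: smooth_poly.
    apply: smoothD; first exact: smooth_flat.
    apply: smoothM; [exact: smooth_poly|exact: smooth_flat].
  move=> x; rewrite !hornerC mulNr.
  exact: is_derive1_affine_comp (is_derive_flat _ _).
- by exists (fun x => f' x + g' x); [exact: smoothD|move=> x; exact: is_deriveD].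
- exists (fun x => f' x * g x + f x * g' x).
    by apply: smoothD; exact: smoothM.
  by move=> x; exact: is_derive1M.
Qed.

Lemma smooth_class_derivable f : smooth_class f ->
  forall n x, derivable (derive1n n f) x 1.
Proof.
move=> sf n x.
suff H : smooth_class (derive1n n f).
  by have [g _ /(_ x)] := smooth_class_derive H; exact: @ex_derive.
elim: n => [//|n ih]; rewrite derive1nS.
have [g sg dg] := smooth_class_derive ih.
by suff -> : derive1 (derive1n n f) = g by []; apply/funext => z; rewrite derive1E derive_val.
Qed.

End flat.

(** * Bernstein polynomials *)

Lemma near_div_natS_le {R : realType} (c e : R) : 0 <= c -> 0 < e ->
  \forall n \near \oo, c / n.+1%:R <= e.
Proof.
rewrite le_eqVlt => /predU1P[<-|c0] e0.
  by apply: nearW => n; rewrite mul0r ltW.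
have P : 0 < c^-1 * e by rewrite mulr_gt0// invr_gt0.
have := near_infty_natSinv_lt (PosNum P); apply: filterS => n /= hn.
by rewrite -ler_pdivlMl// ltW.
Qed.

Section bernstein.
Context {R : realType}.
Implicit Types (n k m : nat) (U : R -> R) (x y : R).

Definition bern n k : {poly R} := 'C(n, k)%:R * ('X^k * (1 - 'X) ^+ (n - k)).

(** Evaluated at a point y of [0, 1], these are the central moments of the binomial law with
    parameters n and y. They are kept as polynomials so that they can be differentiated. *)
Definition bmom n m : {poly R} :=
  \sum_(k < n.+1) (k%:R - n%:R * 'X) ^+ m * bern n k.

Definition bernstein U n : {poly R} := \sum_(k < n.+1) (U (k%:R / n%:R))%:P * bern n k.

Local Notation hE := (hornerM, hornerD, hornerN, hornerC, hornerX, horner_exp).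

Lemma deriv_natr n : (n%:R : {poly R})^`() = 0.
Proof. by rewrite -polyC_natr derivC. Qed.

(** The extra factor [q] restores the exponent lowered by differentiation, so [m.-1] disappears and
    [m = 0] is no exception. *)
Lemma mul_deriv_exp (q : {poly R}) m : q * (q ^+ m)^`() = m%:R * q^`() * q ^+ m.
Proof.
rewrite deriv_exp; case: m => [|m]; first by rewrite mulr0n !mul0r mulr0.
by rewrite -mulr_natr /= exprS; ring.
Qed.

(** The logarithmic derivative of X^k (1 - X)^(n-k) is k/X - (n-k)/(1-X). With denominators cleared,
    differentiating a Bernstein polynomial becomes multiplication by k - n X. *)
Lemma deriv_bern n k : (k <= n)%N ->
  'X * (1 - 'X) * (bern n k)^`() = (k%:R - n%:R * 'X) * bern n k.
Proof.
move=> kn; rewrite /bern -[X in X%:R * 'X](subnK kn) natrD; set m := (n - k)%N.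
rewrite derivM deriv_natr mul0r add0r derivM.
have h1 := mul_deriv_exp 'X k; have h2 := mul_deriv_exp (1 - 'X) m.
have d1 : ((1 - 'X)^`() : {poly R}) = -1.
  by rewrite derivB derivX (deriv_natr 1) sub0r.
rewrite derivX d1 in h1 h2.
transitivity ('C(n, k)%:R * ((1 - 'X : {poly R}) * (1 - 'X) ^+ m * ('X * ('X^k)^`()) +
    'X * 'X^k * ((1 - 'X) * ((1 - 'X) ^+ m)^`()))); first by ring.
by rewrite h1 h2; ring.
Qed.

(** Differentiate the moment and multiply by X (1 - X): by [deriv_bern] the derivative of the weight
    raises the exponent by one, while the derivative of the power lowers it. At [m = 0] the
    coefficient [n * m] cancels the meaningless [m.-1]. *)
Lemma bmomS n m : bmom n m.+1 =
  'X * (1 - 'X) * ((bmom n m)^`() + (n * m)%:R * bmom n m.-1).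
Proof.
rewrite /bmom raddf_sum /= mulr_sumr -big_split /= mulr_sumr.
apply: eq_bigr => k _; rewrite derivM.
have kn : (k <= n)%N by rewrite -ltnS.
rewrite !(mulrDr ('X * (1 - 'X))).
have -> : 'X * (1 - 'X) * ((k%:R - n%:R * 'X) ^+ m * (bern n k)^`()) =
   (k%:R - n%:R * 'X) ^+ m * ('X * (1 - 'X) * (bern n k)^`()) by ring.
rewrite (deriv_bern kn) exprSr.
have -> : ((k%:R - n%:R * 'X : {poly R}) ^+ m)^`() = - (n * m)%:R * (k%:R - n%:R * 'X) ^+ m.-1.
  rewrite deriv_exp derivB !deriv_natr derivM deriv_natr derivX natrM -mulr_natr.
  by ring.
by ring.
Qed.

Lemma bmom0 n : bmom n 0 = 1.
Proof.
rewrite -[RHS](expr1n _ n) -{1}(subrK 'X 1) exprDn; apply: eq_bigr => k _.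
by rewrite expr0 mul1r /bern mulr_natl mulrC.
Qed.

Lemma bmom1 n : bmom n 1 = 0.
Proof. by rewrite bmomS bmom0 muln0 mul0r addr0 (deriv_natr 1) mulr0. Qed.

Lemma bmom2 n : bmom n 2 = n%:R * ('X * (1 - 'X)).
Proof. by rewrite bmomS bmom1 bmom0 raddf0 muln1; ring. Qed.

Lemma bmom3 n : bmom n 3 = n%:R * ('X * (1 - 'X) * (1 - 2 * 'X)).
Proof.
rewrite bmomS bmom2 bmom1 !derivM derivB !deriv_natr (deriv_natr 1) derivX.
by ring.
Qed.

Lemma bmom4 n : bmom n 4 =
  'X * (1 - 'X) * (n%:R * (1 - 6 * 'X + 6 * 'X^2) + 3 * n%:R ^+ 2 * ('X * (1 - 'X))).
Proof.
rewrite bmomS bmom3 bmom2 !(derivM, derivB) !deriv_natr (deriv_natr 1) !derivX natrM.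
by ring.
Qed.

Section weights.
Variables (n : nat) (y : R).
Hypotheses (y01 : 0 <= y <= 1).

Lemma bern_ge0 k : 0 <= (bern n k).[y].
Proof.
have /andP[y0 y1] := y01.
rewrite /bern -polyC_natr !hE; apply: mulr_ge0 => //.
by rewrite mulr_ge0 ?exprn_ge0// subr_ge0.
Qed.

Lemma horner_bmom m : (bmom n m).[y] =
  \sum_(k < n.+1) (k%:R - n%:R * y) ^+ m * (bern n k).[y].
Proof.
rewrite /bmom horner_sum; apply: eq_bigr => k _.
by rewrite hornerM; move: (bern n k) => B; rewrite -!polyC_natr !hE.
Qed.

Lemma bern_sum0 : \sum_(k < n.+1) (bern n k).[y] = 1.
Proof.
have := horner_bmom 0; rewrite bmom0 hornerC => {1}->.
by apply: eq_bigr => k _; rewrite expr0 mul1r.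
Qed.

Lemma bern_sum1 : \sum_(k < n.+1) (k%:R - n%:R * y) * (bern n k).[y] = 0.
Proof.
have := horner_bmom 1; rewrite bmom1 hornerC => {2}->.
by apply: eq_bigr => k _; rewrite expr1.
Qed.

Lemma bern_sum2 :
  \sum_(k < n.+1) (k%:R - n%:R * y) ^+ 2 * (bern n k).[y] = n%:R * (y * (1 - y)).
Proof. by have := horner_bmom 2; rewrite bmom2 -!polyC_natr !hE => ->. Qed.

(** The constant is 1 + 3: the linear term in n is at most n, hence at most n^2, and the quadratic
    one at most 3 n^2. The factor y (1 - y) is kept because the formula for the derivative is
    divided by it. *)
Lemma bern_sum4 :
  \sum_(k < n.+1) (k%:R - n%:R * y) ^+ 4 * (bern n k).[y]
    <= 4 * n%:R ^+ 2 * (y * (1 - y)).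
Proof.
have := horner_bmom 4; rewrite bmom4 -!polyC_natr !hE => <-.
have /andP[y0 y1] := y01.
have h0 : 0 <= y * (1 - y) by rewrite mulr_ge0// subr_ge0.
rewrite [leRHS]mulrC ler_wpM2l//.
have h1 : n%:R <= n%:R ^+ 2 :> R by rewrite -natrX ler_nat; case: (n) => // m; exact: leq_pmulr.
have h2 : 0 <= n%:R :> R by [].
have h3 : n%:R * (1 - 6 * y + 6 * y ^+ 2) <= n%:R.
  by rewrite -[leRHS]mulr1 ler_wpM2l//; nra.
have h4 : 3 * n%:R ^+ 2 * (y * (1 - y)) <= 3 * n%:R ^+ 2.
  by rewrite -[leRHS]mulr1 ler_wpM2l ?mulr_ge0 ?exprn_ge0//; nra.
by lra.
Qed.

End weights.

Lemma horner_bernstein U n y :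
  (bernstein U n).[y] = \sum_(k < n.+1) U (k%:R / n%:R) * (bern n k).[y].
Proof. by rewrite /bernstein horner_sum; apply: eq_bigr => k _; rewrite hornerM hornerC. Qed.

Lemma horner_deriv_bernstein U n y :
  y * (1 - y) * (bernstein U n)^`().[y] =
  \sum_(k < n.+1) U (k%:R / n%:R) * ((k%:R - n%:R * y) * (bern n k).[y]).
Proof.
rewrite /bernstein raddf_sum /= horner_sum mulr_sumr; apply: eq_bigr => k _.
have kn : (k <= n)%N by rewrite -ltnS.
have := congr1 (horner^~ y) (deriv_bern kn).
move: (bern n k) => B; rewrite -!polyC_natr !hE => h.
by rewrite derivM derivC mul0r add0r !hE mulrCA h.
Qed.

Section lipschitz.
Variables (U : R -> R) (K : R).
Hypothesis UK : forall x y, 0 <= x <= 1 -> 0 <= y <= 1 -> `|U x - U y| <= K * `|x - y|.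

Let K0 : 0 <= K.
Proof.
have := UK (x := 1) (y := 0); rewrite !lexx ler01 subr0 normr1 mulr1.
by move=> /(_ isT isT); apply: le_trans.
Qed.

Let frac01 n (k : 'I_n.+1) : 0 <= (k%:R / n%:R : R) <= 1.
Proof.
case: n k => [|n] k; first by rewrite invr0 mulr0 lexx ler01.
by rewrite divr_ge0//= ler_pdivrMr ?ltr0n// mul1r ler_nat -ltnS.
Qed.

Let fracB n (k : 'I_n.+1) y : (0 < n)%N -> k%:R / n%:R - y = (k%:R - n%:R * y) / n%:R.
Proof. move=> n0; have n0' : n%:R != 0 :> R by rewrite pnatr_eq0 -lt0n.
by field. Qed.

(** Here |U (k/n)| is at most K k/n, and k/n has mean y under the Bernstein weights. The linear
    decay at the end is what later compensates the derivative of the cut-off. *)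
Lemma bernstein_bound0 n y : (0 < n)%N -> 0 <= y <= 1 -> U 0 = 0 ->
  `|(bernstein U n).[y]| <= K * y.
Proof.
move=> n0 y01 U0; rewrite horner_bernstein; apply: le_trans (ler_norm_sum _ _ _) _.
have n0' : n%:R != 0 :> R by rewrite pnatr_eq0 -lt0n.
have -> : K * y = \sum_(k < n.+1) K * (k%:R / n%:R) * (bern n k).[y].
  transitivity (\sum_(k < n.+1) (K * y * (bern n k).[y] +
      K / n%:R * ((k%:R - n%:R * y) * (bern n k).[y]))).
    by rewrite big_split/= -[in RHS]mulr_sumr -[X in _ + X]mulr_sumr bern_sum0 bern_sum1 mulr1 mulr0 addr0.
  by apply: eq_bigr => k _; field.
apply: ler_sum => k _; rewrite normrM (ger0_norm (bern_ge0 _ y01 _)).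
apply: ler_wpM2r; first exact: bern_ge0.
have := UK (frac01 k) (_ : 0 <= 0 <= 1); rewrite U0 !subr0 lexx ler01 => /(_ isT).
by have /andP[/ger0_norm-> _] := frac01 k.
Qed.

Lemma bernstein_bound1 n y : (0 < n)%N -> 0 <= y <= 1 -> U 1 = 0 ->
  `|(bernstein U n).[y]| <= K * (1 - y).
Proof.
move=> n0 y01 U0; rewrite horner_bernstein; apply: le_trans (ler_norm_sum _ _ _) _.
have n0' : n%:R != 0 :> R by rewrite pnatr_eq0 -lt0n.
have -> : K * (1 - y) = \sum_(k < n.+1) K * (1 - k%:R / n%:R) * (bern n k).[y].
  transitivity (\sum_(k < n.+1) (K * (1 - y) * (bern n k).[y] -
      K / n%:R * ((k%:R - n%:R * y) * (bern n k).[y]))).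
    by rewrite sumrB/= -[in RHS]mulr_sumr -[X in _ = _ - X]mulr_sumr bern_sum0 bern_sum1 mulr1 mulr0 subr0.
  by apply: eq_bigr => k _; field.
apply: ler_sum => k _; rewrite normrM (ger0_norm (bern_ge0 _ y01 _)).
apply: ler_wpM2r; first exact: bern_ge0.
have := UK (frac01 k) (_ : 0 <= 1 <= 1); rewrite U0 subr0 lexx ler01 => /(_ isT).
have /andP[_ h] := frac01 k.
by rewrite distrC [`|1 - _|]ger0_norm// subr_ge0.
Qed.

(** The first moment vanishes and the second is n y (1 - y), so subtracting the affine function U y
    + d (z - y) from U changes the sum by exactly d y (1 - y). The error of the derivative is thus
    an average of first-order Taylor remainders at y. *)
Lemma bernstein_deriv_sub n y (d : R) : (0 < n)%N -> 0 < y < 1 ->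
  y * (1 - y) * ((bernstein U n)^`().[y] - d) =
  \sum_(k < n.+1) (U (k%:R / n%:R) - U y - d * (k%:R / n%:R - y)) *
     ((k%:R - n%:R * y) * (bern n k).[y]).
Proof.
move=> n0 /andP[y0 y1]; rewrite mulrBr horner_deriv_bernstein.
have n0' : n%:R != 0 :> R by rewrite pnatr_eq0 -lt0n.
have y01 : 0 <= y <= 1 by rewrite !ltW.
transitivity (\sum_(k < n.+1) (U (k%:R / n%:R) * ((k%:R - n%:R * y) * (bern n k).[y])
   - U y * ((k%:R - n%:R * y) * (bern n k).[y])
   - d / n%:R * ((k%:R - n%:R * y) ^+ 2 * (bern n k).[y]))).
  rewrite !sumrB -[X in _ = _ - X - _]mulr_sumr -[X in _ = _ - _ - X]mulr_sumr bern_sum1 bern_sum2 mulr0 subr0.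
  by congr (_ - _); field.
by apply: eq_bigr => k _; field.
Qed.

(** This is [bernstein_deriv_sub] with slope 0: the Lipschitz bound turns the sum into K/n times the
    second moment. *)
Lemma bernstein_deriv_bound n y : (0 < n)%N -> 0 < y < 1 ->
  `|(bernstein U n)^`().[y]| <= K.
Proof.
move=> n0 hy; have /andP[y0 y1] := hy.
have n0' : n%:R != 0 :> R by rewrite pnatr_eq0 -lt0n.
have y01 : 0 <= y <= 1 by rewrite !ltW.
have yy : 0 < y * (1 - y) by rewrite mulr_gt0 ?subr_gt0.
rewrite -(ler_pM2l yy) -{1}(gtr0_norm yy) -normrM -[X in _ * X]subr0.
rewrite (bernstein_deriv_sub _ n0 hy); apply: le_trans (ler_norm_sum _ _ _) _.
have -> : y * (1 - y) * K =
    \sum_(k < n.+1) K / n%:R * ((k%:R - n%:R * y) ^+ 2 * (bern n k).[y]).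
  by rewrite -mulr_sumr bern_sum2; field.
apply: ler_sum => k _; rewrite mul0r subr0 !normrM (ger0_norm (bern_ge0 _ y01 _)) mulrA mulrA.
apply: ler_wpM2r; first exact: bern_ge0.
apply: (@le_trans _ _ (K * `|k%:R / n%:R - y| * `|k%:R - n%:R * y|)).
  by apply: ler_wpM2r => //; exact: UK (frac01 k) y01.
rewrite fracB// normrM -[(k%:R - n%:R * y) ^+ 2]ger0_norm ?sqr_ge0// normrX.
rewrite [`|n%:R^-1|]ger0_norm ?invr_ge0// expr2.
by rewrite le_eqVlt; apply/orP; left; apply/eqP; ring.
Qed.

(** Near y the Taylor remainder is at most (e/2) |z - y| and is summed with the second moment; far
    from y it is dominated by a cubic and summed with the fourth moment, which leaves a term of
    order 1/n. Differentiability at the single point y suffices. *)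
Lemma bernstein_deriv_cvg y (d : R) : 0 < y < 1 ->
  (forall e : R, 0 < e -> exists2 r : R, 0 < r & forall z, `|z - y| < r ->
     `|U z - U y - d * (z - y)| <= e * `|z - y|) ->
  forall e : R, 0 < e -> \forall n \near \oo, `|(bernstein U n.+1)^`().[y] - d| <= e.
Proof.
move=> hy hd e e0; have /andP[y0 y1] := hy.
have y01 : 0 <= y <= 1 by rewrite !ltW.
have yy : 0 < y * (1 - y) by rewrite mulr_gt0 ?subr_gt0.
have e20 : 0 < e / 2 by rewrite divr_gt0.
have [r r0 hr] := hd _ e20.
(* Chosen so that (K + |d|) |z - y| is at most C |z - y|^3 as soon as |z - y| reaches r. *)
pose C : R := (K + `|d|) / r ^+ 2.
have C0 : 0 <= C by rewrite divr_ge0 ?addr_ge0 ?exprn_ge0 ?(ltW r0).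
have key n : `|(bernstein U n.+1)^`().[y] - d| <= e / 2 + 4 * C / n.+1%:R.
  have n0' : n.+1%:R != 0 :> R by rewrite pnatr_eq0.
  rewrite -(ler_pM2l yy) -{1}(gtr0_norm yy) -normrM.
  rewrite (bernstein_deriv_sub _ _ hy)//; apply: le_trans (ler_norm_sum _ _ _) _.
  apply: (@le_trans _ _ (\sum_(k < n.+2)
     (e / 2 / n.+1%:R * ((k%:R - n.+1%:R * y) ^+ 2 * (bern n.+1 k).[y]) +
      C / n.+1%:R ^+ 3 * ((k%:R - n.+1%:R * y) ^+ 4 * (bern n.+1 k).[y])))); last first.
    rewrite big_split /= -[X in X + _ <= _]mulr_sumr -[X in _ + X <= _]mulr_sumr bern_sum2.
    apply: (@le_trans _ _ (e / 2 / n.+1%:R * (n.+1%:R * (y * (1 - y))) +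
        C / n.+1%:R ^+ 3 * (4 * n.+1%:R ^+ 2 * (y * (1 - y))))).
      rewrite lerD2l; apply: ler_wpM2l; last exact: bern_sum4.
      by rewrite divr_ge0// exprn_ge0.
    by rewrite le_eqVlt; apply/orP; left; apply/eqP; field.
  apply: ler_sum => k _; rewrite !normrM (ger0_norm (bern_ge0 _ y01 _)) [leLHS]mulrA.
  rewrite (mulrA (e / 2 / _)) (mulrA (C / _)) -mulrDl.
  apply: ler_wpM2r; first exact: bern_ge0.
  set v := k%:R - n.+1%:R * y; set z := k%:R / n.+1%:R.
  have zv : z - y = v / n.+1%:R by rewrite /z fracB.
  have nz : `|z - y| = `|v| / n.+1%:R.
    by rewrite zv normrM [`|_^-1|]ger0_norm.
  have h : `|U z - U y - d * (z - y)| <= e / 2 * `|z - y| + C * `|z - y| ^+ 3.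
    have [lt|ge] := ltP `|z - y| r.
      by apply: le_trans (hr _ lt) _; rewrite lerDl mulr_ge0// exprn_ge0.
    apply: (@le_trans _ _ (C * `|z - y| ^+ 3)); last first.
      by rewrite lerDr mulr_ge0// ltW.
    apply: (@le_trans _ _ ((K + `|d|) * `|z - y|)).
      apply: le_trans (ler_normB _ _) _; rewrite mulrDl normrM lerD2r.
      exact: UK (frac01 k) y01.
    have -> : C * `|z - y| ^+ 3 = (K + `|d|) * `|z - y| * (`|z - y| / r) ^+ 2.
      by rewrite /C; field; rewrite gt_eqF.
    apply: ler_peMr; first by rewrite mulr_ge0 ?addr_ge0.
    by apply: exprn_ege1; rewrite ler_pdivlMr// mul1r.
  apply: (@le_trans _ _ ((e / 2 * `|z - y| + C * `|z - y| ^+ 3) * `|v|)).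
    exact: ler_wpM2r.
  have v2 : v ^+ 2 = `|v| ^+ 2 by rewrite -normrX ger0_norm ?sqr_ge0.
  have -> : v ^+ 4 = `|v| ^+ 4 by rewrite (exprM _ 2 2) v2 -exprM.
  rewrite v2 nz le_eqVlt; apply/orP; left; apply/eqP; field.
  by [].
have C4 : 0 <= 4 * C by rewrite mulr_ge0.
have := near_div_natS_le C4 e20; apply: filterS => n hn.
by apply: le_trans (key n) _; rewrite [leRHS](splitr e) lerD2l.
Qed.

Lemma bernstein_cvg y : 0 <= y <= 1 ->
  forall e : R, 0 < e -> \forall n \near \oo, `|(bernstein U n.+1).[y] - U y| <= e.
Proof.
move=> y01 e e0.
have yy : 0 <= y * (1 - y) <= 1.
  by move/andP: y01 => [? ?]; apply/andP; split; nra.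
have K1 : 0 < K + 1 by rewrite ltr_wpDl.
have e20 : 0 < e / 2 by rewrite divr_gt0.
(* The first absolute moment is reduced to the second by |x| <= h + x^2 / h; this [h] makes the
   first term contribute at most half of [e]. Dividing by K + 1 covers K = 0. *)
have [h h0 Kh] : exists2 h : R, 0 < h & K * h <= e / 2.
  exists (e / 2 / (K + 1)); first by rewrite divr_gt0.
  rewrite mulrCA -[leRHS]mulr1 ler_wpM2l ?(ltW e20)//.
  by rewrite ler_pdivrMr// mul1r lerDl.
have key n : `|(bernstein U n.+1).[y] - U y| <= K * h + K / h / n.+1%:R.
  have n0' : n.+1%:R != 0 :> R by rewrite pnatr_eq0.
  have hn0 : h != 0 by rewrite gt_eqF.
  have -> : (bernstein U n.+1).[y] - U y =
      \sum_(k < n.+2) (U (k%:R / n.+1%:R) - U y) * (bern n.+1 k).[y].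
    rewrite horner_bernstein -[X in _ - X]mulr1 -(bern_sum0 n.+1 y) mulr_sumr -sumrB.
    by apply: eq_bigr => k _; rewrite mulrBl.
  apply: le_trans (ler_norm_sum _ _ _) _.
  apply: (@le_trans _ _ (\sum_(k < n.+2) (K * h * (bern n.+1 k).[y] +
      K / h / n.+1%:R ^+ 2 * ((k%:R - n.+1%:R * y) ^+ 2 * (bern n.+1 k).[y])))); last first.
    rewrite big_split /= -[X in X + _ <= _]mulr_sumr -[X in _ + X <= _]mulr_sumr bern_sum2 bern_sum0 mulr1 lerD2l.
    have /andP[_ yy1] := yy.
    rewrite [leLHS](_ : _ = K / h / n.+1%:R * (y * (1 - y))); last first.
      by move: (n.+1%:R) n0' => N N0; field; rewrite ?hn0 ?N0.
    by rewrite -[leRHS]mulr1 ler_wpM2l// !divr_ge0// ltW.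
  apply: ler_sum => k _; rewrite !normrM (ger0_norm (bern_ge0 _ y01 _)).
  rewrite (mulrA (K / h / _)) -mulrDl.
  apply: ler_wpM2r; first exact: bern_ge0.
  apply: le_trans (UK (frac01 k) y01) _.
  rewrite fracB//; set v := k%:R - n.+1%:R * y.
  have -> : K * h + K / h / n.+1%:R ^+ 2 * v ^+ 2 = K * (h + (v / n.+1%:R) ^+ 2 / h).
    by move: (n.+1%:R) n0' v => N N0 v; field; rewrite ?hn0 ?N0.
  apply: ler_wpM2l => //.
  set a := v / _; have -> : a ^+ 2 = `|a| ^+ 2 by rewrite -normrX ger0_norm ?sqr_ge0.
  have -> : h + `|a| ^+ 2 / h = (h ^+ 2 + `|a| ^+ 2) / h by field.
  rewrite ler_pdivlMr//.
  by have := sqr_ge0 (h - `|a|); have := normr_ge0 a; nra.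
have C0 : 0 <= K / h by rewrite divr_ge0// ltW.
have := near_div_natS_le C0 e20; apply: filterS => n hn.
by apply: le_trans (key n) _; rewrite [leRHS](splitr e) lerD.
Qed.

End lipschitz.
End bernstein.

(** * Integrals and Sobolev functions on a symmetric interval *)

Section interval_integral.
Context {R : realType} (T : R).
Hypothesis T0 : 0 < T.
Local Notation mu := (@lebesgue_measure R).
Local Notation Om := (`]- T, T[%classic : set R).
Local Notation Ig f := (mu.-integrable Om (EFin \o f)).
Implicit Types (f g h : R -> R) (C p : R).

Let mOm : measurable (Om : set (measurableTypeR R)).
Proof. exact: measurable_itv. Qed.

Lemma mu_symitv : mu Om = (2 * T)%:E.
Proof.
have T2 : - T < T by exact: gtrN.
rewrite lebesgue_measure_itv /= lte_fin T2.
by rewrite -EFinB; congr EFin; ring.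
Qed.

Lemma Rint_cst C : \int[mu]_(x in Om) C = C * (2 * T).
Proof.
rewrite Rintegral_cst//; transitivity (C * fine (mu Om)) => //.
by rewrite mu_symitv.
Qed.

Lemma EFin_Rintegral f : Ig f ->
  (\int[mu]_(x in Om) (f x)%:E)%E = (\int[mu]_(x in Om) f x)%:E.
Proof. by move=> fi; rewrite /Rintegral fineK//; exact: integrable_fin_num. Qed.

Lemma integrable_measurable f : Ig f -> measurable_fun Om f.
Proof. by move=> /integrableP[/measurable_EFinP]. Qed.

Lemma bdd_integrable f C : measurable_fun Om f ->
  (forall x, Om x -> `|f x| <= C) -> Ig f.
Proof.
move=> mf fC; apply: measurable_bounded_integrable => //.
  by suff: (mu Om < +oo)%E by []; rewrite mu_symitv ltry.
exists C; split; first exact: num_real.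
by move=> M CM x Omx; apply: le_trans (fC _ Omx) _; exact: ltW.
Qed.

Lemma le_Ig f g : measurable_fun Om f -> Ig g ->
  (forall x, Om x -> `|f x| <= g x) -> Ig f.
Proof.
move=> mf gi fg; apply: le_integrable gi => //; first exact/measurable_EFinP.
move=> x Omx /=; rewrite lee_fin; apply: le_trans (fg _ Omx) (ler_norm _).
Qed.

Lemma IgD f g : Ig f -> Ig g -> Ig (fun x => f x + g x).
Proof. by move=> fi gi; have := integrableD mOm fi gi; apply: eq_integrable. Qed.

Lemma IgB f g : Ig f -> Ig g -> Ig (fun x => f x - g x).
Proof. by move=> fi gi; have := integrableB mOm fi gi; apply: eq_integrable. Qed.

Lemma IgZ C f : Ig f -> Ig (fun x => C * f x).
Proof. by move=> fi; have := integrableZl mOm C fi; apply: eq_integrable. Qed.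

Lemma Ig_norm f : Ig f -> Ig (fun x => `|f x|).
Proof. by move=> /integrable_norm. Qed.

Lemma IgM_bdd f g C : Ig f -> measurable_fun Om g ->
  (forall x, Om x -> `|g x| <= C) -> Ig (fun x => g x * f x).
Proof.
move=> fi mg gC; apply: (@le_Ig _ (fun x => C * `|f x|)).
- by apply: measurable_funM => //; exact: integrable_measurable.
- exact/IgZ/Ig_norm.
- by move=> x Omx; rewrite normrM ler_wpM2r// gC.
Qed.

Lemma Rint_mul_bdd_le f g C : Ig f -> measurable_fun Om g ->
  (forall x, Om x -> `|g x| <= C) ->
  `|\int[mu]_(x in Om) (g x * f x)| <= C * \int[mu]_(x in Om) `|f x|.
Proof.
move=> fi mg gC; have gfi := IgM_bdd fi mg gC.
apply: le_trans (le_normr_Rintegral mOm gfi) _.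
rewrite -RintegralZl//; last exact: Ig_norm.
apply: le_Rintegral => //.
- exact: Ig_norm.
- exact/IgZ/Ig_norm.
- by move=> x Omx; rewrite normrM ler_wpM2r// gC.
Qed.

Section Lp.
Variable p : R.
Hypothesis p1 : 1 < p.

Let p0 : 0 < p. Proof. exact: lt_trans p1. Qed.
Let pn0 : p != 0. Proof. by rewrite gt_eqF. Qed.

Lemma measurable_normpow f : measurable_fun Om f ->
  measurable_fun Om (fun x => `|f x| `^ p).
Proof.
move=> mf; apply: (@measurableT_comp _ _ _ _ _ _ (@powR R ^~ p)).
  exact: measurable_powR.
exact: measurableT_comp.
Qed.

Lemma norm_pE f :
  norm_p Om p f = ((\int[mu]_(x in Om) (`|f x| `^ p)%:E) `^ p^-1)%E.
Proof.
rewrite /norm_p unlock; congr (_ `^ _)%E; rewrite [RHS]integral_mkcond.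
apply: eq_integral => x _; rewrite /= !patchE; case: ifPn => // _.
by rewrite normr0 powR0.
Qed.

Lemma norm_p_powR f :
  (norm_p Om p f `^ p)%E = (\int[mu]_(x in Om) (`|f x| `^ p)%:E)%E.
Proof.
rewrite norm_pE -poweRrM mulVf// poweRe1//.
by apply: integral_ge0 => x _; rewrite lee_fin powR_ge0.
Qed.

Lemma norm_p_ge0 f : (0 <= norm_p Om p f)%E.
Proof. exact: Lnorm_ge0. Qed.

Lemma in_LpP f : in_Lp Om p f <->
  measurable_fun Om f /\ Ig (fun x => `|f x| `^ p).
Proof.
split => -[mf hf]; split => //.
- apply/integrableP; split.
    by apply/measurable_EFinP; exact: measurable_normpow.
  under eq_integral do rewrite /= (ger0_norm (powR_ge0 _ _)).
  by rewrite -norm_p_powR; apply: poweR_lty.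
- rewrite norm_pE; apply: poweR_lty.
  case/integrableP : hf => _; under eq_integral do rewrite /= (ger0_norm (powR_ge0 _ _)).
  by [].
Qed.

Lemma bdd_in_Lp f C : measurable_fun Om f ->
  (forall x, Om x -> `|f x| <= C) -> in_Lp Om p f.
Proof.
move=> mf fC; apply/in_LpP; split => //.
apply: (@bdd_integrable _ (C `^ p)); first exact: measurable_normpow.
move=> x Omx; rewrite ger0_norm ?powR_ge0//.
apply: ge0_ler_powR; rewrite ?nnegrE ?(ltW p0)//; last exact: fC.
exact: le_trans (fC _ Omx).
Qed.

(* Where [`|x| <= h] use the first term, elsewhere [`|x|^(1-p) <= h^(1-p)]. *)
Lemma norm_le_powR (h x : R) : 0 < h -> `|x| <= h + h `^ (1 - p) * `|x| `^ p.
Proof.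
move=> h0; have [xh|hx] := leP `|x| h.
  by apply: le_trans xh _; rewrite lerDl mulr_ge0 ?powR_ge0.
have x0 : 0 < `|x| by exact: lt_trans hx.
suff : `|x| <= h `^ (1 - p) * `|x| `^ p by move/le_trans; apply; rewrite lerDr ltW.
have {1}-> : `|x| = `|x| `^ (1 - p) * `|x| `^ p.
  by rewrite -powRD ?subrK ?powRr1// (gt_eqF x0) implybT.
apply: ler_wpM2r; first exact: powR_ge0.
rewrite -(opprB p 1) !powRN lef_pV2 ?posrE ?powR_gt0//.
by apply: ge0_ler_powR; rewrite ?nnegrE ?subr_ge0 ?(ltW p1) ?(ltW h0)// ltW.
Qed.

Lemma in_Lp_Ig f : in_Lp Om p f -> Ig f.
Proof.
move=> /in_LpP[mf hf].
apply: (@le_Ig _ (fun x => 1 + `|f x| `^ p)) => //.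
  by apply: IgD => //; apply: (@bdd_integrable _ `|1|).
move=> x _; have := norm_le_powR (f x) (@ltr01 R).
by rewrite powR1 mul1r.
Qed.

(** Brings approximation in the p-norm down to L^1, where identities with bounded coefficients pass
    to the limit. *)
Lemma norm_p_small (e : R) : 0 < e -> exists2 d : R, 0 < d &
  forall f, measurable_fun Om f -> (norm_p Om p f < d%:E)%E ->
    Ig f /\ \int[mu]_(x in Om) `|f x| < e.
Proof.
(* In the bound [norm_le_powR] the constant term then integrates to e/2 over an interval of length 2
   T; [s] below is chosen to do the same for the p-th power. *)
move=> e0; pose h := e / (4 * T).
have h0 : 0 < h by rewrite divr_gt0// mulr_gt0.
pose c := h `^ (1 - p).
have c0 : 0 < c by exact: powR_gt0.
pose s := e / 2 / c.
have s0 : 0 < s by rewrite !divr_gt0.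
exists (s `^ p^-1); first exact: powR_gt0.
move=> f mf fs.
have fLp : in_Lp Om p f by split => //; apply: lt_trans fs _; rewrite ltry.
have fi := in_Lp_Ig fLp; split => //.
have /in_LpP[_ fpi] := fLp.
have fps : \int[mu]_(x in Om) (`|f x| `^ p) < s.
  rewrite -lte_fin -EFin_Rintegral// -norm_p_powR.
  move: fs (norm_p_ge0 f); case: (norm_p Om p f) => [r| |]//; rewrite lte_fin lee_fin => rs r0.
  rewrite poweR_EFin lte_fin -[ltRHS](@powRr1 _ s) ?(ltW s0)// -(mulVf pn0) powRrM.
  by apply: gt0_ltr_powR; rewrite ?nnegrE ?powR_ge0.
have ch : Ig (cst h) by apply: (@bdd_integrable _ `|h|) => //; exact: measurable_cst.
apply: (@le_lt_trans _ _ (\int[mu]_(x in Om) (h + c * `|f x| `^ p))).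
  apply: le_Rintegral => //; first exact: Ig_norm.
    by apply: IgD => //; exact: IgZ.
  by move=> x _; exact: norm_le_powR.
rewrite RintegralD//; last exact: IgZ.
rewrite RintegralZl// Rint_cst.
rewrite [ltRHS](splitr e); apply: ler_ltD.
  rewrite /h le_eqVlt; apply/orP; left; apply/eqP; field.
  by rewrite gt_eqF.
by rewrite mulrC -ltr_pdivlMr.
Qed.

Lemma le_norm_p f g C : measurable_fun Om f -> measurable_fun Om g -> 0 <= C ->
  (forall x, Om x -> `|f x| <= C * `|g x|) ->
  (norm_p Om p f <= C%:E * norm_p Om p g)%E.
Proof.
move=> mf mg C0 fg.
have -> : C%:E = ((C `^ p)%:E `^ p^-1)%E.
  by rewrite poweR_EFin -powRrM mulfV// powRr1.
rewrite !norm_pE -poweRM ?lee_fin ?powR_ge0//; last first.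
  by apply: integral_ge0 => x _; rewrite lee_fin powR_ge0.
rewrite -(ge0_integralZl_EFin _ mOm) ?powR_ge0//; last first.
  by apply/measurable_EFinP; exact: measurable_normpow.
apply: gt0_ler_poweR; rewrite ?invr_ge0 ?(ltW p0)// ?in_itv/= ?leey ?andbT.
- by apply: integral_ge0 => x _; rewrite lee_fin powR_ge0.
- by apply: integral_ge0 => x _; rewrite -EFinM lee_fin mulr_ge0// powR_ge0.
apply: ge0_le_integral => //.
- by apply/measurable_EFinP; exact: measurable_normpow.
- apply/measurable_EFinP; apply: measurable_funM => //; exact: measurable_normpow.
move=> x Omx; rewrite -EFinM lee_fin -powRM//.
by apply: ge0_ler_powR; rewrite ?nnegrE ?(ltW p0) ?mulr_ge0// fg.
Qed.

Lemma norm_pD f g : measurable_fun Om f -> measurable_fun Om g ->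
  (norm_p Om p (f \+ g)%R <= norm_p Om p f + norm_p Om p g)%E.
Proof.
move=> mf mg; rewrite /norm_p.
have -> : (f \+ g) \_ Om = (f \_ Om) \+ (g \_ Om).
  by apply/funext => x /=; rewrite !patchE; case: ifPn => // _; rewrite addr0.
by apply: minkowski_EFin; [exact/(measurable_restrictT _ _).1|exact/(measurable_restrictT _ _).1|exact: ltW].
Qed.

End Lp.
End interval_integral.

(** * Test functions and their closure in the Sobolev norm *)

Section test_functions.
Context {R : realType} (T : R).
Hypothesis T0 : 0 < T.
Local Notation mu := (@lebesgue_measure R).
Local Notation Om := (`]- T, T[%classic : set R).
Local Notation Ig f := (mu.-integrable Om (EFin \o f)).
Implicit Types (f g h phi u du : R -> R) (C p : R).

Let mOm : measurable (Om : set (measurableTypeR R)).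
Proof. exact: measurable_itv. Qed.

Lemma ae_imp (P Q : R -> Prop) : {ae mu, forall x, P x} ->
  (forall x, P x -> Q x) -> {ae mu, forall x, Q x}.
Proof.
move=> hP PQ; apply: filterS hP; first exact: (ae_filter_ringOfSetsType mu).
exact: PQ.
Qed.

Lemma test_is_derive phi (x : R) : test_function Om phi -> is_derive x 1 phi (phi^`()%classic x).
Proof.
move=> [dphi _ _]; have := derivableP (dphi 0%N x); rewrite derive1n0.
by rewrite derive1E.
Qed.

Lemma test_continuous phi : test_function Om phi -> continuous phi.
Proof.
by move=> tphi x; exact: is_derive1_continuous (test_is_derive x tphi).
Qed.

Lemma test_derive_continuous phi : test_function Om phi -> continuous (phi^`()%classic).
Proof.
move=> [dphi _ _] x; apply: differentiable_continuous; apply/derivable1_diffP.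
by have := dphi 1%N x; rewrite derive1n1.
Qed.

Lemma test_support phi : test_function Om phi ->
  exists a b : R, [/\ - T < a, a < b, b < T &
    forall x, (x <= a) || (b <= x) -> phi x = 0 /\ phi^`()%classic x = 0].
Proof.
move=> tphi; have [_ cK KOm] := tphi.
set K := closure _ in cK KOm.
have phi0 x : ~ K x -> phi x = 0 /\ phi^`()%classic x = 0.
  move=> Kx.
  have nz : \forall y \near x, phi y = 0.
    have : nbhs x (~` K).
      by apply: open_nbhs_nbhs; split => //; apply: closed_openC; exact: closed_closure.
    apply: filterS => y Ky; apply: contrapT => /eqP phiy; apply: Ky.
    by apply: subset_closure.
  split; first exact: nbhs_singleton nz.
  have d0 : is_derive (x : R) 1 phi (0 : R).
    apply: near_eq_is_derive (is_derive1_affine 0 0 x).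
    by move: nz; apply: filterS => y ->; rewrite mul0r addr0.
  by rewrite derive1E; exact: (@derive_val _ _ _ _ _ _ _ d0).
have [K0|/set0P K0] := eqVneq K set0.
  exists (- (T / 2)), (T / 2); split.
  - by rewrite ltrN2 ltr_pdivrMr// mulr_natr mulr2n ltrDr.
  - by apply: gtrN; rewrite divr_gt0.
  - by rewrite ltr_pdivrMr// mulr_natr mulr2n ltrDr.
  - by move=> x _; apply: phi0; rewrite K0.
have cid : {within K, continuous (id : R -> R)}.
  by apply: continuous_subspaceT => x; exact: cvg_id.
have [M KM hM] := compact_EVT_max K0 cK cid.
have [m Km hm] := compact_EVT_min K0 cK cid.
have /KOm := set_mem KM; rewrite /= in_itv/= => /andP[MT1 MT2].
have /KOm := set_mem Km; rewrite /= in_itv/= => /andP[mT1 mT2].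
have mM : m <= M by exact: hm.
(* Midpoints between the extreme points of the support and the ends of the interval: they leave a
   margin on both sides, and are distinct even if [m = M]. *)
exists ((m - T) / 2), ((M + T) / 2); split.
- by rewrite ltr_pdivlMr// mulr_natr mulr2n ltrD2r.
- rewrite ltr_pM2r ?invr_gt0//; apply: le_lt_trans (_ : M - T < _).
    by rewrite lerD2r.
  by rewrite ltrD2l gtrN.
- by rewrite ltr_pdivrMr// mulr_natr mulr2n ltrD2r.
- move=> x hx; apply: phi0 => Kx.
  have h1 := hM _ (mem_set Kx); have h2 := hm _ (mem_set Kx).
  case/orP : hx; rewrite ?ler_pdivrMr ?ler_pdivlMr//.
    rewrite mulr_natr mulr2n => hx.
    have : m + m <= m - T by apply: le_trans hx; exact: lerD.
    by rewrite lerD2l leNgt mT1.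
  rewrite mulr_natr mulr2n => hx.
  have : M + T <= M + M by apply: (le_trans hx); exact: lerD.
  by rewrite lerD2l leNgt MT2.
Qed.

Lemma compact_bounded f (a b : R) : {within `[a, b], continuous f} ->
  exists2 C : R, 0 <= C & forall x, a <= x <= b -> `|f x| <= C.
Proof.
move=> cf; have [ab|ba] := leP a b; last first.
  exists 0 => // x /andP[ax xb].
  by have := lt_le_trans ba (le_trans ax xb); rewrite ltxx.
have cnf : {within `[a, b], continuous (fun x => `|f x|)}.
  by move=> x; apply: continuous_comp; [exact: cf|exact: norm_continuous].
have [c _ hc] := EVT_max ab cnf.
by exists `|f c| => // x xab; apply: hc; rewrite in_itv.
Qed.

Lemma test_bounded phi : test_function Om phi -> exists2 C : R, 0 <= C &
  forall x, `|phi x| <= C /\ `|phi^`()%classic x| <= C.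
Proof.
move=> tphi; have [a [b [Ta ab bT phi0]]] := test_support tphi.
have [C1 C10 h1] := compact_bounded (continuous_subspaceT (A := `[a, b]%classic) (test_continuous tphi)).
have [C2 C20 h2] := compact_bounded (continuous_subspaceT (A := `[a, b]%classic) (test_derive_continuous tphi)).
exists (C1 + C2); first exact: addr_ge0.
move=> x; have [xab|] := boolP (a <= x <= b).
  split; first by apply: le_trans (h1 _ xab) _; rewrite lerDl.
  by apply: le_trans (h2 _ xab) _; rewrite lerDr.
rewrite negb_and -!ltNge => hx.
have /phi0[-> ->] : (x <= a) || (b <= x) by case/orP : hx => /ltW ->; rewrite ?orbT.
by rewrite normr0 addr_ge0.
Qed.

Lemma continuous_Om_measurable f : {in `]- T, T[, continuous f} -> measurable_fun Om f.
Proof.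
move=> cf; apply: open_continuous_measurable_fun; first exact: interval_open.
by move=> x; rewrite inE/=; exact: cf.
Qed.

Lemma test_measurable phi : test_function Om phi ->
  measurable_fun Om phi /\ measurable_fun Om (phi^`()%classic).
Proof.
move=> tphi; split; apply: continuous_Om_measurable => x _.
  exact: test_continuous.
exact: test_derive_continuous.
Qed.

(** The fundamental theorem on [a, b], stated so that [F] may be built from a function that is
    singular at the ends of the interval, as the Riccati solution is. *)
Lemma Rintegral_derive_compact_support F f (a b : R) : - T < a -> a < b -> b < T ->
  (forall x, - T < x < T -> is_derive x 1 F (f x)) ->
  {in `]- T, T[, continuous f} -> F a = 0 -> F b = 0 ->
  (forall x, (x < a) || (b < x) -> f x = 0) ->
  Ig f /\ \int[mu]_(x in Om) f x = 0.
Proof.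
move=> Ta ab bT dF cf Fa Fb f0.
have sub x : a <= x <= b -> - T < x < T.
  by move=> /andP[ax xb]; rewrite (lt_le_trans Ta ax) (le_lt_trans xb bT).
have cfab : {within `[a, b], continuous f}.
  apply: continuous_in_subspaceT => x; rewrite inE/= in_itv/= => xab.
  by apply: cf; rewrite in_itv/=; exact: sub.
have [C C0 hC] := compact_bounded cfab.
have fi : Ig f.
  apply: (@bdd_integrable _ _ T0 _ C); first exact: continuous_Om_measurable.
  move=> x _; have [/hC//|] := boolP (a <= x <= b).
  by rewrite negb_and -!ltNge => /f0 ->; rewrite normr0.
split => //.
have -> : \int[mu]_(x in Om) f x = \int[mu]_(x in `[a, b]) f x.
  rewrite Rintegral_mkcond [RHS]Rintegral_mkcond; congr Rintegral.
  apply/funext => x; rewrite !patchE.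
  have [xab|] := boolP (a <= x <= b).
    rewrite !mem_set//= in_itv/=.
    exact: sub.
  move=> xab; rewrite [X in _ = if X then _ else _]memNset/=; last first.
    by rewrite in_itv/=; exact/negP.
  by case: ifPn => // _; apply: f0; move: xab; rewrite negb_and -!ltNge.
have dFx x : x \in `[a, b]%R -> derivable F x 1.
  by rewrite in_itv/= => /sub /dF/@ex_derive.
rewrite /Rintegral (@continuous_FTC2 _ f F a b)//.
- by rewrite Fa Fb subee.
- split.
  + by move=> x xab; apply: dFx; exact: subset_itv_oo_cc xab.
  + apply: cvg_at_right_filter.
    by apply: is_derive1_continuous (dF _ (sub _ _)); rewrite lexx ltW.
  + apply: cvg_at_left_filter.
    by apply: is_derive1_continuous (dF _ (sub _ _)); rewrite lexx ltW.
- move=> x; rewrite in_itv/= => /andP[ax xb].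
  have dx : is_derive x 1 F (f x) by apply: dF; apply: sub; rewrite !ltW.
  by rewrite derive1E; exact: (@derive_val _ _ _ _ _ _ _ dx).
Qed.

Lemma test_by_parts phi psi : test_function Om phi -> test_function Om psi ->
  \int[mu]_(x in Om) (psi x * phi^`()%classic x) =
  \int[mu]_(x in Om) (- psi^`()%classic x * phi x).
Proof.
move=> tphi tpsi; have [a [b [Ta ab bT phi0]]] := test_support tphi.
have [mphi mphi'] := test_measurable tphi; have [mpsi mpsi'] := test_measurable tpsi.
have [C C0 hC] := test_bounded tphi; have [D D0 hD] := test_bounded tpsi.
have ip : Ig phi by apply: (@bdd_integrable _ _ T0 _ C) => // x _; case: (hC x).
have ip' : Ig (phi^`()%classic) by apply: (@bdd_integrable _ _ T0 _ C) => // x _; case: (hC x).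
have i1 : Ig (fun x => psi x * phi^`()%classic x).
  by apply: (@IgM_bdd _ _ _ _ D) => // x _; case: (hD x).
have i2 : Ig (fun x => - psi^`()%classic x * phi x).
  apply: (@IgM_bdd _ _ _ _ D) => //; first exact: measurableT_comp.
  by move=> x _; rewrite normrN; case: (hD x).
apply/eqP; rewrite -subr_eq0 -RintegralB//; apply/eqP.
have [] := @Rintegral_derive_compact_support (fun x => psi x * phi x)
  (fun x => psi x * phi^`()%classic x - - psi^`()%classic x * phi x) a b Ta ab bT _ _ _ _ _ => //.
- move=> x _; apply: (is_derive_eq (is_derive1M (test_is_derive x tpsi) (test_is_derive x tphi))).
  by ring.
- move=> x _; apply: cvgB; apply: cvgM; first exact: test_continuous.
  + exact: test_derive_continuous.
  + by apply: cvgN; exact: test_derive_continuous.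
  + exact: test_continuous.
- by have [|-> _] := phi0 a; rewrite ?lexx ?mulr0.
- by have [|-> _] := phi0 b; rewrite ?lexx ?orbT ?mulr0.
- move=> x hx; have /phi0[-> ->] : (x <= a) || (b <= x) by case/orP : hx => /ltW ->; rewrite ?orbT.
  by rewrite !mulr0 subrr.
Qed.

Section W01p.
Variable p : R.
Hypothesis p1 : 1 < p.

Lemma approx_L1 u du : in_Lp Om p u -> in_Lp Om p du ->
  (forall e : R, 0 < e -> exists phi, test_function Om phi /\
    (norm_p Om p (u \- phi)%R + norm_p Om p (du \- derive1 phi)%R < e%:E)%E) ->
  forall e : R, 0 < e -> exists phi, [/\ test_function Om phi,
    \int[mu]_(x in Om) `|u x - phi x| < e &
    \int[mu]_(x in Om) `|du x - phi^`()%classic x| < e].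
Proof.
move=> [mu_ _] [mdu _] happ e e0.
have [d d0 hd] := norm_p_small T0 p1 e0.
have [phi [tphi hphi]] := happ _ d0; exists phi.
have [mphi mphi'] := test_measurable tphi.
split => //.
- have [] := hd (u \- phi)%R => //; first exact: measurable_funB.
  by apply: le_lt_trans hphi; rewrite leeDl// norm_p_ge0.
- have [] := hd (du \- derive1 phi)%R => //; first exact: measurable_funB.
  by apply: le_lt_trans hphi; rewrite leeDr// norm_p_ge0.
Qed.

(** Both sides are linear in the pair (u, du) with bounded coefficients, hence continuous for L^1
    convergence. It is applied to integration by parts and to the eigenvalue equation. *)
Lemma weak_identity_ext (s t : R -> R) C u du :
  measurable_fun Om s -> measurable_fun Om t ->
  (forall x, Om x -> `|s x| <= C) -> (forall x, Om x -> `|t x| <= C) ->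
  Ig u -> Ig du ->
  (forall e : R, 0 < e -> exists phi, [/\ test_function Om phi,
    \int[mu]_(x in Om) `|u x - phi x| < e &
    \int[mu]_(x in Om) `|du x - phi^`()%classic x| < e]) ->
  (forall phi, test_function Om phi ->
    \int[mu]_(x in Om) (s x * phi^`()%classic x) = \int[mu]_(x in Om) (t x * phi x)) ->
  \int[mu]_(x in Om) (s x * du x) = \int[mu]_(x in Om) (t x * u x).
Proof.
move=> ms mt sC tC iu idu happ hweak.
have C0 : 0 <= C.
  by apply: le_trans (sC 0 _) => //=; rewrite in_itv/= oppr_lt0 T0.
apply/eqP; rewrite -subr_eq0 -normr_le0.
apply/ler_addgt0Pr => e e0; rewrite add0r.
have C1 : 0 < 2 * (C + 1) by rewrite mulr_gt0// ltr_wpDl.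
have [phi [tphi h1 h2]] := happ _ (divr_gt0 e0 C1).
have [mphi mphi'] := test_measurable tphi.
have [D D0 hD] := test_bounded tphi.
have ip : Ig phi by apply: (@bdd_integrable _ _ T0 _ D) => // x _; case: (hD x).
have ip' : Ig (phi^`()%classic) by apply: (@bdd_integrable _ _ T0 _ D) => // x _; case: (hD x).
have E1 : \int[mu]_(x in Om) (s x * du x) = \int[mu]_(x in Om) (s x * (du x - phi^`()%classic x))
    + \int[mu]_(x in Om) (s x * phi^`()%classic x).
  rewrite -RintegralD//.
  - by apply: eq_Rintegral => x _; ring.
  - by apply: (@IgM_bdd _ _ _ _ C) => //; exact: IgB.
  - exact: (@IgM_bdd _ _ _ _ C).
have E2 : \int[mu]_(x in Om) (t x * u x) = \int[mu]_(x in Om) (t x * (u x - phi x))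
    + \int[mu]_(x in Om) (t x * phi x).
  rewrite -RintegralD//.
  - by apply: eq_Rintegral => x _; ring.
  - by apply: (@IgM_bdd _ _ _ _ C) => //; exact: IgB.
  - exact: (@IgM_bdd _ _ _ _ C).
rewrite E1 E2 (hweak _ tphi) opprD addrACA subrr addr0.
apply: le_trans (ler_normB _ _) _.
apply: (@le_trans _ _ (C * (e / (2 * (C + 1))) + C * (e / (2 * (C + 1))))).
  apply: lerD.
    apply: le_trans (Rint_mul_bdd_le (IgB idu ip') ms sC) _.
    by apply: ler_wpM2l => //; exact: ltW.
  apply: le_trans (Rint_mul_bdd_le (IgB iu ip) mt tC) _.
  by apply: ler_wpM2l => //; exact: ltW.
rewrite -mulrDl mulrA ler_pdivrMr// mulrC ler_wpM2l ?(ltW e0)//.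
by rewrite mulrDr mulr1 mulr_natl mulr2n lerDl.
Qed.

(** The weak derivative comes with the approximation: integration by parts between two test
    functions passes to the limit in one of them. *)
Lemma W01p_approx u du : in_Lp Om p u -> in_Lp Om p du ->
  (forall e : R, 0 < e -> exists phi, test_function Om phi /\
    (norm_p Om p (u \- phi)%R + norm_p Om p (du \- derive1 phi)%R < e%:E)%E) ->
  W01p Om p u du.
Proof.
move=> hu hdu happ; split => //; split => // psi tpsi.
have iu := in_Lp_Ig T0 p1 hu; have idu := in_Lp_Ig T0 p1 hdu.
have [mpsi mpsi'] := test_measurable tpsi; have [D D0 hD] := test_bounded tpsi.
have mNpsi' : measurable_fun Om (fun x => - psi^`()%classic x) by exact: measurableT_comp.
have bN x : Om x -> `|- psi^`()%classic x| <= D by rewrite normrN; case: (hD x).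
have b x : Om x -> `|psi x| <= D by case: (hD x).
have H := weak_identity_ext mpsi mNpsi' b bN iu idu
  (approx_L1 hu hdu happ) (fun phi tphi => test_by_parts tphi tpsi).
have i1 : Ig (fun x => - (u x * psi^`()%classic x)).
  by apply: eq_integrable (IgM_bdd iu mNpsi' bN) => // x _ /=; rewrite mulNr mulrC.
have i2 : Ig (fun x => du x * psi x).
  by apply: eq_integrable (IgM_bdd idu mpsi b) => // x _ /=; rewrite mulrC.
have i3 : Ig (fun x => u x * psi^`()%classic x).
  by apply: eq_integrable (IgZ (-1) i1) => // x _ /=; rewrite mulrN mulN1r opprK.
rewrite (EFin_Rintegral i3) (EFin_Rintegral i2) -EFinN; congr EFin.
transitivity (- \int[mu]_(x in Om) (- psi^`()%classic x * u x)).
  rewrite -[RHS]mulN1r -RintegralZl//; last exact: IgM_bdd bN.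
  by apply: eq_Rintegral => x _; ring.
by rewrite -H; congr (- _); apply: eq_Rintegral => x _; rewrite mulrC.
Qed.

Lemma norm_p_cvg0 (f_ : nat -> R -> R) f C :
  (forall n, measurable_fun Om (f_ n)) -> measurable_fun Om f ->
  (forall n x, Om x -> `|f_ n x| <= C) -> (forall x, Om x -> `|f x| <= C) ->
  {ae mu, forall x, Om x -> f_ n x @[n --> \oo] --> f x} ->
  forall e : R, 0 < e -> \forall n \near \oo, (norm_p Om p (f \- f_ n)%R < e%:E)%E.
Proof.
move=> mf_ mf f_C fC fcv e e0.
have p0 : 0 < p by exact: lt_trans p1.
pose g_ n x := `|f x - f_ n x| `^ p.
have mg n : measurable_fun Om (g_ n).
  exact: (measurable_normpow p (measurable_funB mf (mf_ n))).
have gC n x : Om x -> `|g_ n x| <= (C + C) `^ p.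
  move=> Omx; rewrite ger0_norm ?powR_ge0//; apply: ge0_ler_powR.
  - exact: ltW.
  - by rewrite nnegrE.
  - by rewrite nnegrE addr_ge0// (le_trans _ (fC _ Omx)).
  - by apply: le_trans (ler_normB _ _) _; apply: lerD; [exact: fC|exact: f_C].
have m1 n : measurable_fun Om (EFin \o g_ n) by apply/measurable_EFinP; exact: mg.
have m2 : measurable_fun Om (cst (0%E : \bar R)) by exact: measurable_cst.
have m3 : {ae mu, forall x, Om x -> (EFin \o g_ n) x @[n --> \oo] --> cst (0%E : \bar R) x}.
  apply: (ae_imp fcv) => x fx Omx; have {}fx := fx Omx.
  apply/fine_cvgP; split; first exact: nearW.
  apply/cvgrPdist_le => /= d d0.
  (* A number in [0, 1] dominates its p-th power, so closeness within min(d, 1) already controls the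
     p-th power by d. *)
  have d10 : 0 < Num.min d 1 by rewrite lt_min d0 ltr01.
  move/cvgrPdist_le : fx => /(_ _ d10); apply: filterS => n.
  rewrite le_min sub0r normrN => /andP[h1 h2].
  rewrite ger0_norm ?powR_ge0// /g_.
  have [->|nz] := eqVneq (f x - f_ n x) 0; first by rewrite normr0 powR0 ?ltW// gt_eqF.
  apply: le_trans h1; apply: ge1r_powR; last exact: ltW.
  by rewrite normr_gt0 nz.
have m4 : Ig (cst ((C + C) `^ p)).
  by apply: (@bdd_integrable _ _ T0 _ `|(C + C) `^ p|) => //; exact: measurable_cst.
have m5 : {ae mu, forall x n, Om x -> (`|(EFin \o g_ n) x| <= (EFin \o cst ((C + C) `^ p)%R) x)%E}.
  by apply: nearW => x n Omx; rewrite lee_fin; exact: gC.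
have [_ _ ] := dominated_convergence mOm m1 m2 m3 m4 m5.
rewrite integral0 => H.
have ep : (0 < (e `^ p)%:E)%E by rewrite lte_fin powR_gt0.
have : \forall n \near \oo, (\int[mu]_(x in Om) (g_ n x)%:E < (e `^ p)%:E)%E.
  apply: (H [set y | (y < (e `^ p)%:E)%E]).
  by apply: open_nbhs_nbhs; split => //; exact: open_ereal_lt_ereal.
apply: filterS => n hn.
rewrite norm_pE//; set I := (\int[mu]_(_ in _) _)%E.
have I0 : (0 <= I)%E by apply: integral_ge0 => x _; rewrite lee_fin powR_ge0.
have : (I < (e `^ p)%:E)%E by [].
case: I I0 => [r| |]//; rewrite lee_fin lte_fin => r0 re.
rewrite poweR_EFin lte_fin; have -> : e = (e `^ p) `^ p^-1.
  by rewrite -powRrM mulfV ?gt_eqF// powRr1// ltW.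
by apply: gt0_ltr_powR; rewrite ?invr_gt0 ?nnegrE ?powR_ge0.
Qed.

Lemma W01p_of_limit (phi_ : nat -> R -> R) u du C :
  (forall n, test_function Om (phi_ n)) ->
  (forall n x, Om x -> `|phi_ n x| <= C) ->
  (forall n x, Om x -> `|(phi_ n)^`()%classic x| <= C) ->
  measurable_fun Om u -> measurable_fun Om du ->
  (forall x, Om x -> `|u x| <= C) -> (forall x, Om x -> `|du x| <= C) ->
  {ae mu, forall x, Om x -> phi_ n x @[n --> \oo] --> u x} ->
  {ae mu, forall x, Om x -> (phi_ n)^`()%classic x @[n --> \oo] --> du x} ->
  W01p Om p u du.
Proof.
move=> tphi phiC phiC' mu_ mdu uC duC cu cdu.
apply: W01p_approx; [exact: bdd_in_Lp uC|exact: bdd_in_Lp duC|].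
move=> e e0; have e20 : 0 < e / 2 by rewrite divr_gt0.
have m1 n : measurable_fun Om (phi_ n) by case: (test_measurable (tphi n)).
have m2 n : measurable_fun Om ((phi_ n)^`()%classic) by case: (test_measurable (tphi n)).
have H1 := norm_p_cvg0 m1 mu_ phiC uC cu e20.
have H2 := norm_p_cvg0 m2 mdu phiC' duC cdu e20.
near \oo => n; exists (phi_ n); split => //.
rewrite [e in ltRHS](splitr e) EFinD; apply: lteD; first by near: n.
by near: n.
Unshelve. all: by end_near. Qed.

Lemma W01p_test phi : test_function Om phi -> W01p Om p phi (phi^`()%classic).
Proof.
move=> tphi; have [mphi mphi'] := test_measurable tphi; have [C C0 hC] := test_bounded tphi.
apply: (@W01p_of_limit (fun=> phi) _ _ C) => //.
- by move=> _ x _; case: (hC x).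
- by move=> _ x _; case: (hC x).
- by move=> x _; case: (hC x).
- by move=> x _; case: (hC x).
- by apply: nearW => x _; exact: cvg_cst.
- by apply: nearW => x _; exact: cvg_cst.
Qed.

End W01p.
End test_functions.

(** * Lipschitz functions vanishing at both ends belong to W_0^{1,p} *)

Section lipschitz_W01p.
Context {R : realType} (T : R).
Hypothesis T0 : 0 < T.
Local Notation mu := (@lebesgue_measure R).
Local Notation Om := (`]- T, T[%classic : set R).

Lemma near_ge2_div_natS (d : R) : 0 < d ->
  \forall n \near \oo, n.+1%:R * d - 1 >= n.+1%:R * (d / 2) /\ n.+1%:R * (d / 2) >= 1.
Proof.
move=> d0; have d2 : 0 < d / 2 by rewrite divr_gt0.
have := near_div_natS_le (@ler01 R) d2; apply: filterS => n hn.
have h : 1 <= n.+1%:R * (d / 2) by rewrite -ler_pdivrMl ?ltr0n// mulrC.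
split => //; rewrite lerBrDr.
have -> : n.+1%:R * d = n.+1%:R * (d / 2) + n.+1%:R * (d / 2) by field.
by rewrite lerD2l.
Qed.

Lemma flat0_cvg (d : R) : 0 < d -> flat 0 (n.+1%:R * d - 1) @[n --> \oo] --> (1 : R).
Proof.
move=> d0; apply/cvgrPdist_le => e e0.
have d20 : 0 <= 2 / d by rewrite divr_ge0// ltW.
have := near_div_natS_le d20 e0; have := near_ge2_div_natS d0.
apply: filterS2 => n [h1 h2] h3.
set y := n.+1%:R * d - 1 in h1 *.
have y0 : 0 < y by apply: lt_le_trans h1; apply: lt_le_trans h2.
have dn0 : 0 < n.+1%:R * (d / 2) by apply: lt_le_trans h2.
rewrite /flat y0 expr0 mul1r ger0_norm; last first.
  by rewrite subr_ge0 -[leRHS](@expR0 R) ler_expR oppr_le0 invr_ge0 ltW.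
have : 1 - y^-1 <= expR (- y^-1) by exact: expR_ge1Dx.
rewrite lerBlDl -lerBlDr => /le_trans; apply; apply: le_trans h3.
apply: (@le_trans _ _ (n.+1%:R * (d / 2))^-1); first by rewrite lef_pV2.
by rewrite invfM invf_div mulrC.
Qed.

Lemma flat12_cvg (d : R) : 0 < d ->
  flat 1 (n.+1%:R * d - 1) + flat 2 (n.+1%:R * d - 1) @[n --> \oo] --> (0 : R).
Proof.
move=> d0; apply/cvgrPdist_le => e e0.
have d20 : 0 <= 2 * (2 / d) by rewrite mulr_ge0// divr_ge0// ltW.
have := near_div_natS_le d20 e0; have := near_ge2_div_natS d0.
apply: filterS2 => n [h1 h2] h3.
set y := n.+1%:R * d - 1 in h1 *.
have y1 : 1 <= y by apply: le_trans h1.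
have y0 : 0 < y by apply: lt_le_trans y1.
have dn0 : 0 < n.+1%:R * (d / 2) by apply: lt_le_trans h2.
rewrite sub0r normrN ger0_norm ?addr_ge0 ?flat_ge0//.
apply: le_trans h3; apply: (@le_trans _ _ (y^-1 + y^-1)).
  apply: lerD; first by have := flat_le_expr 1 y0; rewrite expr1.
  apply: le_trans (flat_le_expr 2 y0) _; rewrite expr2 -[leRHS]mulr1.
  by rewrite ler_wpM2l ?invr_ge0 ?(ltW y0)// invf_le1.
have h : y^-1 <= 2 / d / n.+1%:R.
  apply: (@le_trans _ _ (n.+1%:R * (d / 2))^-1); first by rewrite lef_pV2.
  by rewrite invfM invf_div mulrC.
have -> : 2 * (2 / d) / n.+1%:R = 2 / d / n.+1%:R + 2 / d / n.+1%:R by ring.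
exact: lerD.
Qed.

Section approximants.
Variables (u : R -> R) (K : R).
Hypothesis uK : forall x y, - T <= x <= T -> - T <= y <= T -> `|u x - u y| <= K * `|x - y|.
Hypotheses (uT : u T = 0) (uNT : u (- T) = 0).

Let U (y : R) := u (2 * T * y - T).
Let T2 : 0 < 2 * T. Proof. by rewrite mulr_gt0. Qed.
Let K0 : 0 <= K.
Proof.
have := @uK T (- T); rewrite uT uNT subrr normr0 lexx andbT opprK lexx /=.
have TT : - T <= T by rewrite ltW// gtrN.
rewrite TT => /(_ isT isT).
by rewrite ger0_norm ?addr_ge0 ?(ltW T0)// pmulr_lge0// addr_gt0.
Qed.

Let UK x y : 0 <= x <= 1 -> 0 <= y <= 1 -> `|U x - U y| <= (2 * T * K) * `|x - y|.
Proof.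
have h z : 0 <= z <= 1 -> - T <= 2 * T * z - T <= T.
  move=> /andP[z0 z1]; rewrite lerBrDr addNr mulr_ge0 ?(ltW T2)//=.
  rewrite lerBlDr -mulr2n -[leRHS]mulr_natl.
  by rewrite -[leRHS]mulr1 ler_wpM2l// ltW.
move=> /h hx /h hy; apply: le_trans (uK hx hy) _.
rewrite (_ : 2 * T * x - T - (2 * T * y - T) = 2 * T * (x - y)); last by ring.
by rewrite normrM (gtr0_norm T2) mulrA [K * _]mulrC.
Qed.

Let U0 : U 0 = 0. Proof. by rewrite /U mulr0 sub0r. Qed.
Let U1 : U 1 = 0.
Proof. by rewrite /U mulr1 (_ : 2 * T - T = T) //; ring. Qed.

Let c : R := (2 * T)^-1.
Let q n : {poly R} := bernstein U n.+1 \Po (c%:P * 'X + 2^-1%:P).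

Let qE n x : (q n).[x] = (bernstein U n.+1).[c * x + 2^-1].
Proof. by rewrite /q horner_comp hornerD hornerM !hornerC hornerX. Qed.

Let q'E n x : (q n)^`().[x] = (bernstein U n.+1)^`().[c * x + 2^-1] * c.
Proof.
rewrite /q deriv_comp hornerM horner_comp hornerD hornerM !hornerC hornerX.
by congr (_ * _); rewrite derivD derivM !derivC derivX mul0r add0r addr0 mulr1 hornerC.
Qed.

Let y01 x : - T < x < T -> 0 < c * x + 2^-1 < 1.
Proof.
move=> /andP[x1 x2].
have -> : c * x + 2^-1 = (x + T) / (2 * T) by rewrite /c; field; rewrite gt_eqF.
by rewrite divr_gt0//= -?ltrBlDr ?sub0r// ltr_pdivrMr// mul1r mulr_natl mulr2n ltrD2r.
Qed.

Let yT x : 2 * T * (c * x + 2^-1) - T = x.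
Proof. by rewrite /c; field; rewrite gt_eqF. Qed.

Let q_le0 n x : - T < x < T -> `|(q n).[x]| <= K * (x + T).
Proof.
move=> hx; have /andP[/ltW y0 /ltW y1] := y01 hx; rewrite qE.
have y01' : 0 <= c * x + 2^-1 <= 1 by rewrite y0 y1.
apply: le_trans (bernstein_bound0 UK _ y01' U0) _ => //.
by rewrite le_eqVlt; apply/orP; left; apply/eqP; rewrite /c; field; rewrite gt_eqF.
Qed.

Let q_le1 n x : - T < x < T -> `|(q n).[x]| <= K * (T - x).
Proof.
move=> hx; have /andP[/ltW y0 /ltW y1] := y01 hx; rewrite qE.
have y01' : 0 <= c * x + 2^-1 <= 1 by rewrite y0 y1.
apply: le_trans (bernstein_bound1 UK _ y01' U1) _ => //.
by rewrite le_eqVlt; apply/orP; left; apply/eqP; rewrite /c; field; rewrite gt_eqF.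
Qed.

Let q'_le n x : - T < x < T -> `|(q n)^`().[x]| <= K.
Proof.
move=> hx; rewrite q'E normrM.
have c0 : 0 < c by rewrite invr_gt0.
rewrite (gtr0_norm c0) -ler_pdivlMr//.
apply: le_trans (bernstein_deriv_bound UK _ (y01 hx)) _ => //.
by rewrite /c invrK mulrC.
Qed.

Let q_cvg x : - T < x < T -> (q n).[x] @[n --> \oo] --> u x.
Proof.
move=> hx; have /andP[/ltW y0 /ltW y1] := y01 hx.
have y01' : 0 <= c * x + 2^-1 <= 1 by rewrite y0 y1.
apply/cvgrPdist_le => e e0.
have := bernstein_cvg UK y01' e0; apply: filterS => n.
by rewrite qE distrC /U yT.
Qed.

Let q'_cvg x d : - T < x < T -> is_derive x 1 u d -> (q n)^`().[x] @[n --> \oo] --> d.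
Proof.
move=> hx dx.
have c0 : 0 < c by rewrite invr_gt0.
have dU (e : R) : 0 < e -> exists2 r : R, 0 < r & forall z, `|z - (c * x + 2^-1)| < r ->
    `|U z - U (c * x + 2^-1) - (2 * T * d) * (z - (c * x + 2^-1))| <= e * `|z - (c * x + 2^-1)|.
  move=> e0; have ec : 0 < e * c by rewrite mulr_gt0.
  have /cvgrPdist_le/(_ _ ec) := is_derive1P dx.
  move=> [r /= r0 hr]; exists (r * c); first by rewrite mulr_gt0.
  move=> z hz; set y := c * x + 2^-1 in hz *.
  have [->|zy] := eqVneq z y; first by rewrite !subrr mulr0 subrr !normr0 mulr0.
  pose h := 2 * T * (z - y).
  have hn0 : h != 0 by rewrite mulf_neq0 ?subr_eq0// gt_eqF.
  have hE : U z = u (h + x).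
    rewrite /U; congr u; rewrite /h -[X in _ = _ + X](yT x) -/y; ring.
  have h_r : `|0 - h| < r.
    rewrite sub0r normrN /h normrM (gtr0_norm T2) mulrC -ltr_pdivlMr//.
  have := hr h h_r hn0.
  rewrite hE {1}/U /y yT -/y.
  have -> : 2 * T * d * (z - y) = d * h by rewrite /h; ring.
  have -> : `|z - y| = `|h| * c.
    by rewrite /h normrM (gtr0_norm T2) /c; field; rewrite gt_eqF.
  move=> H.
  have -> : u (h + x) - u x - d * h = - ((d - h^-1 * (u (h + x) - u x)) * h).
    by field.
  by rewrite normrN normrM mulrCA mulrC ler_wpM2l// ltW.
apply/cvgrPdist_le => e e0.
have ec : 0 < e / c by rewrite divr_gt0.
have := bernstein_deriv_cvg UK (y01 hx) dU ec; apply: filterS => n.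
rewrite q'E distrC => h.
have -> : d = 2 * T * d * c by rewrite /c; field; rewrite gt_eqF.
by rewrite -mulrBl normrM (gtr0_norm c0) -ler_pdivlMr.
Qed.

Let N n : R := n.+1%:R.
(** The left cut-off vanishes up to - T + 1/N and, like its mirror image [r], tends to 1 at each
    interior point. The argument is written in the affine form required by [smooth_flat]. *)
Let l n x := flat 0 (N n * x + (N n * T - 1)).
Let r n x := flat 0 (- N n * x + (N n * T - 1)).
Let phi n x := l n x * r n x * (q n).[x].
Let dphi n x :=
  (flat 2 (N n * x + (N n * T - 1)) * N n * r n x +
   l n x * (flat 2 (- N n * x + (N n * T - 1)) * - N n)) * (q n).[x] +
   l n x * r n x * (q n)^`().[x].

Let phi_derive n (x : R) : is_derive x 1 (phi n) (dphi n x).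
Proof.
apply: (is_derive1M _ (is_derive_poly _ _)).
apply: is_derive1M.
- apply: (@is_derive1_affine_comp _ (flat 0)).
  apply: (is_derive_eq (is_derive_flat _ _)).
  by rewrite mul0r subr0.
- apply: (@is_derive1_affine_comp _ (flat 0)).
  apply: (is_derive_eq (is_derive_flat _ _)).
  by rewrite mul0r subr0.
Qed.

Let phi_derive1 n x : (phi n)^`()%classic x = dphi n x.
Proof. by rewrite derive1E; exact: (@derive_val _ _ _ _ _ _ _ (phi_derive n x)). Qed.

Let phi_test n : test_function Om (phi n).
Proof.
have N0 : 0 < N n by rewrite ltr0n.
have supp : closure [set x | phi n x != 0] `<=` `[- T + (N n)^-1, T - (N n)^-1].
  rewrite closureE; apply: smallest_sub; first exact: interval_closed.
  move=> x /=; apply: contraNT; rewrite in_itv/= negb_and -!ltNge => hx.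
  apply/eqP; rewrite /phi /l /r /flat.
  have aux z : z < (N n)^-1 -> (0 < N n * z - 1) = false.
    move=> hz; apply/negbTE; rewrite -leNgt subr_le0 -ler_pdivlMl//.
    by rewrite mulr1 ltW.
  case/orP : hx => hx.
    rewrite addrA -mulrDr aux ?mul0r//.
    by rewrite -ltrBrDr addrC.
  rewrite [- N n * x]mulNr (addrC (- _)) addrAC -mulrBr aux ?mulr0 ?mul0r//.
  by rewrite ltrBlDl -ltrBlDr.
have Vn0 : 0 < (N n)^-1 by rewrite invr_gt0.
split.
- apply: smooth_class_derivable; apply: smoothM; last exact: smooth_poly.
  by apply: smoothM; exact: smooth_flat.
- apply: (subclosed_compact _ _ supp); first exact: closed_closure.
  exact: segment_compact.
- move=> x /supp; rewrite /= !in_itv/= => /andP[h1 h2].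
  by rewrite (lt_le_trans _ h1) ?ltrDl//= (le_lt_trans h2)// ltrBlDr ltrDl.
Qed.

Let flat0_le y : 0 <= flat 0 y <= (1 : R).
Proof. by rewrite flat_ge0 (le_trans (flat_le 0 y)). Qed.

Let lr_norm n x : `|l n x * r n x| <= 1.
Proof.
have /andP[h1 h2] := flat0_le (N n * x + (N n * T - 1)).
have /andP[h3 h4] := flat0_le (- N n * x + (N n * T - 1)).
by rewrite ger0_norm ?mulr_ge0// mulr_ile1.
Qed.

(** With y = N (x + T) - 1, the derivative of the cut-off has size N times [flat 2 y], and the
    polynomial is at most K (x + T). Since N (x + T) = y + 1, the factor N is absorbed: (y + 1)
    [flat 2 y] is [flat 1 y + flat 2 y], which is bounded and tends to 0 as n grows. *)
Let cutl_le n x : - T < x < T ->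
  `|flat 2 (N n * x + (N n * T - 1)) * N n * r n x * (q n).[x]| <=
  K * (flat 1 (n.+1%:R * (x + T) - 1) + flat 2 (n.+1%:R * (x + T) - 1)).
Proof.
move=> hx; have N0 : 0 < N n by rewrite ltr0n.
have -> : N n * x + (N n * T - 1) = n.+1%:R * (x + T) - 1 by rewrite /N; ring.
set y := n.+1%:R * (x + T) - 1.
have /andP[h3 h4] := flat0_le (- N n * x + (N n * T - 1)).
have xT : 0 <= x + T by case/andP : hx => /ltW + _; rewrite -subr_ge0 opprK.
rewrite (flatS 1) -{3}[flat 2 y]mul1r -mulrDl.
have -> : y + 1 = N n * (x + T) by rewrite /y subrK.
rewrite !normrM (ger0_norm (flat_ge0 _ _)) (gtr0_norm N0) (ger0_norm h3).
apply: (@le_trans _ _ (flat 2 y * N n * 1 * (K * (x + T)))).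
  apply: ler_pM => //; last exact: q_le0.
    by rewrite !mulr_ge0 ?flat_ge0// ltW.
  by apply: ler_wpM2l => //; rewrite mulr_ge0 ?flat_ge0// ltW.
by rewrite le_eqVlt; apply/orP; left; apply/eqP; ring.
Qed.

Let cutr_le n x : - T < x < T ->
  `|l n x * (flat 2 (- N n * x + (N n * T - 1)) * - N n) * (q n).[x]| <=
  K * (flat 1 (n.+1%:R * (T - x) - 1) + flat 2 (n.+1%:R * (T - x) - 1)).
Proof.
move=> hx; have N0 : 0 < N n by rewrite ltr0n.
have -> : - N n * x + (N n * T - 1) = n.+1%:R * (T - x) - 1 by rewrite /N; ring.
set y := n.+1%:R * (T - x) - 1.
have /andP[h3 h4] := flat0_le (N n * x + (N n * T - 1)).
have xT : 0 <= T - x by case/andP : hx => _ /ltW; rewrite -subr_ge0.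
rewrite (flatS 1) -{3}[flat 2 y]mul1r -mulrDl.
have -> : y + 1 = N n * (T - x) by rewrite /y subrK.
rewrite !normrM normrN (ger0_norm (flat_ge0 _ _)) (gtr0_norm N0) (ger0_norm h3).
apply: (@le_trans _ _ (1 * (flat 2 y * N n) * (K * (T - x)))).
  apply: ler_pM => //; last exact: q_le1.
    by rewrite !mulr_ge0 ?flat_ge0// ltW.
  by apply: ler_wpM2r => //; rewrite mulr_ge0 ?flat_ge0// ltW.
by rewrite le_eqVlt; apply/orP; left; apply/eqP; ring.
Qed.

Let u_cont x : - T < x < T -> {for x, continuous u}.
Proof.
move=> /andP[x1 x2]; apply/cvgrPdist_le => e e0.
have K1 : 0 < K + 1 by rewrite ltr_wpDl.
near=> y.
have y1 : - T < y by near: y; exact: lt_nbhsr.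
have y2 : y < T by near: y; exact: lt_nbhsl.
apply: (@le_trans _ _ (K * `|x - y|)); first by apply: uK; rewrite !ltW.
apply: (@le_trans _ _ ((K + 1) * `|x - y|)); first by rewrite ler_wpM2r// lerDl.
rewrite -ler_pdivlMl//; near: y.
exists ((K + 1)^-1 * e) => /=; first by rewrite mulr_gt0// invr_gt0.
by move=> z /ltW.
Unshelve. all: by end_near. Qed.

(** The derivatives of the approximants converge wherever [u] is differentiable, so a corner of [u]
    at the single point [s] is a null set for the almost everywhere convergence. *)
Lemma W01p_lipschitz (p : R) (du : R -> R) (s : R) : 1 < p ->
  measurable_fun Om du -> (forall x, - T < x < T -> `|du x| <= K) ->
  (forall x, - T < x < T -> x != s -> is_derive x 1 u (du x)) ->
  W01p Om p u du.
Proof.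
move=> p1 mdu duK du_derive.
(* The first term bounds the approximants. For their derivatives, each cut-off contributes at most 5
   K, because [flat 1 + flat 2] is at most 1 + 4, and the polynomial contributes K. *)
pose C := K * (2 * T) + 11 * K.
have C1 : K * (2 * T) <= C by rewrite lerDl mulr_ge0.
have C2 : 11 * K <= C by rewrite lerDr mulr_ge0// ltW.
have K11 : K <= 11 * K by rewrite ler_peMl// ler1n.
have xT (x : R) : - T < x < T -> 0 < x + T /\ 0 < T - x.
  by move=> /andP[h1 h2]; rewrite subr_gt0 h2 -ltrBlDr sub0r h1.
have OmP (x : R) : Om x -> - T < x < T by rewrite /= in_itv.
have cl x : - T < x < T -> l n x @[n --> \oo] --> (1 : R).
  move=> /xT[h _]; have := flat0_cvg h; apply: cvg_trans; apply: near_eq_cvg.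
  by apply: nearW => n; rewrite /l /N; congr flat; ring.
have cr x : - T < x < T -> r n x @[n --> \oo] --> (1 : R).
  move=> /xT[_ h]; have := flat0_cvg h; apply: cvg_trans; apply: near_eq_cvg.
  by apply: nearW => n; rewrite /r /N; congr flat; ring.
have cu x : - T < x < T -> phi n x @[n --> \oo] --> u x.
  move=> hx; rewrite -[u x]mul1r -[X in X * _](mulr1 (1 : R)).
  by apply: cvgM; [apply: cvgM; [exact: cl|exact: cr]|exact: q_cvg].
have small (f g : nat -> R) : (forall n, `|f n| <= K * g n) ->
    g n @[n --> \oo] --> (0 : R) -> f n @[n --> \oo] --> (0 : R).
  move=> fg g0; apply: norm_cvg0; apply: (@squeeze_cvgr _ _ _ _ (cst 0) (fun n => K * g n)).
  - by apply: nearW => n; rewrite normr_ge0 fg.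
  - exact: cvg_cst.
  - by rewrite -(mulr0 K); apply: cvgM => //; exact: cvg_cst.
have cdu x : - T < x < T -> x != s -> (phi n)^`()%classic x @[n --> \oo] --> du x.
  move=> hx xs; have [hx1 hx2] := xT _ hx.
  have -> : (fun n => (phi n)^`()%classic x) = (fun n => dphi n x).
    by apply/funext => n; rewrite phi_derive1.
  rewrite /dphi -[du x]add0r -[X in X + _](addr0 (0 : R)).
  apply: cvgD; last first.
    rewrite -[du x]mul1r -[X in X * _](mulr1 (1 : R)).
    apply: cvgM; first by apply: cvgM; [exact: cl|exact: cr].
    exact: q'_cvg (du_derive _ hx xs).
  under eq_fun do rewrite mulrDl.
  apply: cvgD.
    exact: (small _ _ (fun n => cutl_le n hx) (flat12_cvg hx1)).
  exact: (small _ _ (fun n => cutr_le n hx) (flat12_cvg hx2)).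
have mu_ : measurable_fun Om u.
  by apply: continuous_Om_measurable => x; rewrite in_itv/=; exact: u_cont.
apply: (@W01p_of_limit _ _ T0 _ p1 phi _ _ C) => //.
- move=> n x /OmP hx; apply: le_trans C1; rewrite /phi normrM.
  have [h1 h2] := xT _ hx.
  rewrite -[leRHS]mul1r; apply: ler_pM => //.
  apply: le_trans (q_le0 n hx) _; apply: ler_wpM2l => //.
  by rewrite mulr_natl mulr2n lerD2r ltW//; case/andP : hx.
- move=> n x /OmP hx; apply: le_trans C2; rewrite phi_derive1 /dphi mulrDl.
  have f12 y : flat 1 y + flat 2 y <= (5 : R).
    apply: le_trans (lerD (flat_le 1 y) (flat_le 2 y)) _.
    by rewrite -!natrX -natrD ler_nat.
  apply: le_trans (ler_normD _ _) _.
  have -> : 11 * K = K * 5 + K * 5 + K by ring.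
  apply: lerD.
    apply: le_trans (ler_normD _ _) _; apply: lerD.
      by apply: le_trans (cutl_le n hx) _; exact: ler_wpM2l.
    by apply: le_trans (cutr_le n hx) _; exact: ler_wpM2l.
  rewrite normrM -[leRHS]mul1r; apply: ler_pM => //; exact: q'_le.
- move=> x /OmP hx; apply: le_trans C1.
  have TT : - T <= T by rewrite ltW// gtrN.
  have := @uK x (- T); rewrite uNT subr0 lexx TT.
  case/andP : (hx) => h1 h2; rewrite (ltW h1) (ltW h2) => /(_ isT isT)/le_trans; apply.
  apply: ler_wpM2l => //; rewrite opprK ger0_norm.
    by rewrite mulr_natl mulr2n lerD2r ltW.
  by rewrite ltW//; case: (xT _ hx).
- by move=> x /OmP hx; apply: le_trans (duK _ hx) _; exact: le_trans C2.
- by apply: aeW => x /OmP; exact: cu.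
- exists [set s]; split; [exact: measurable_set1|exact: lebesgue_measure_set1|].
  move=> x /= hx; apply: contrapT => xs; apply: hx => /OmP hx.
  by apply: cdu => //; apply/eqP.
Qed.

End approximants.
End lipschitz_W01p.

Lemma powRV {R : realType} (x r : R) : 0 <= x -> x^-1 `^ r = x `^ (- r).
Proof. by move=> x0; rewrite -powR_inv1// -powRrM mulN1r. Qed.

(** * The Riccati equation and the eigenfunction *)

Section powers.
Context {R : realType}.
Implicit Types (a b r s t x y : R).

Lemma ppart_ge0 s : 0 <= ppart s. Proof. by rewrite /ppart le_max lexx orbT. Qed.
Lemma npart_ge0 s : 0 <= npart s. Proof. by rewrite /npart le_max lexx orbT. Qed.
Lemma npartE s : npart s = ppart (- s). Proof. by []. Qed.
Lemma ppart_pos s : 0 <= s -> ppart s = s. Proof. by move=> /max_l. Qed.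
Lemma ppart_neg s : s <= 0 -> ppart s = 0. Proof. by move=> /max_r. Qed.
Lemma npart_pos s : 0 <= s -> npart s = 0.
Proof. by move=> s0; rewrite npartE ppart_neg// oppr_le0. Qed.
Lemma npart_neg s : s <= 0 -> npart s = - s.
Proof. by move=> s0; rewrite npartE ppart_pos// oppr_ge0. Qed.

Lemma powR_le_small r e : 0 < r -> 0 < e ->
  exists2 d, 0 < d & forall x, 0 <= x <= d -> x `^ r <= e.
Proof.
move=> r0 e0; exists (e `^ r^-1); first exact: powR_gt0.
move=> x /andP[x0 xe]; rewrite -[leRHS]powRr1 ?(ltW e0)// -(mulVf (lt0r_neq0 r0)) powRrM.
by apply: ge0_ler_powR; rewrite ?nnegrE ?powR_ge0 ?(ltW r0).
Qed.

Lemma ppart_norm s : ppart s <= `|s|.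
Proof. by rewrite /ppart ge_max ler_norm normr_ge0. Qed.

Lemma continuous_ppow r : 0 < r -> continuous (fun s => ppart s `^ r).
Proof.
move=> r0 s; have [s0|s0|<-] := ltgtP 0 s.
- apply: is_derive1_continuous; apply: near_eq_is_derive (is_derive1_powR r s0).
  near=> x; rewrite ppart_pos// ltW//; near: x; exact: lt_nbhsr.
- apply: is_derive1_continuous; apply: near_eq_is_derive (is_derive1_affine 0 0 s).
  near=> x; rewrite ppart_neg ?powR0 ?gt_eqF ?mul0r ?addr0// ltW//.
  by near: x; exact: lt_nbhsl.
- rewrite /continuous_at ppart_pos// powR0 ?gt_eqF//; apply/cvgrPdist_le => e e0.
  have [d d0 hd] := powR_le_small r0 e0.
  exists d => // x hx; have xd : `|x| < d by move: hx; rewrite /ball_ /= sub0r normrN.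
  rewrite sub0r normrN ger0_norm ?powR_ge0//; apply: hd; rewrite ppart_ge0/=.
  exact: le_trans (ppart_norm _) (ltW xd).
Unshelve. all: by end_near. Qed.

(** At the origin the difference quotient is at most |h|^(r-1), which tends to 0 since r > 1;
    elsewhere the function is locally a power or zero. *)
Lemma is_derive_ppow r s : 1 < r ->
  is_derive s 1 (fun x => ppart x `^ r) (r * ppart s `^ (r - 1)).
Proof.
move=> r1; have r0 : 0 < r by exact: lt_trans r1.
have r10 : 0 < r - 1 by rewrite subr_gt0.
have [s0|s0|<-] := ltgtP 0 s.
- rewrite ppart_pos ?(ltW s0)//.
  apply: near_eq_is_derive (is_derive1_powR r s0).
  near=> x; rewrite ppart_pos// ltW//; near: x; exact: lt_nbhsr.
- rewrite ppart_neg ?(ltW s0)// powR0 ?gt_eqF// mulr0.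
  apply: near_eq_is_derive (is_derive1_affine 0 0 s).
  near=> x; rewrite ppart_neg ?powR0 ?gt_eqF ?mul0r ?addr0// ltW//.
  by near: x; exact: lt_nbhsl.
- rewrite ppart_pos// powR0 ?gt_eqF// mulr0; apply: is_derive1_lim.
  apply/cvgrPdist_le => e e0.
  have [d d0 hd] := powR_le_small r10 e0.
  exists d => // h hd0 hn0; have hd' : `|h| < d by move: hd0; rewrite /ball_ /= sub0r normrN.
  rewrite sub0r normrN addr0 (ppart_pos (lexx 0)) powR0 ?gt_eqF// subr0.
  rewrite normrM normfV (ger0_norm (powR_ge0 _ _)).
  have h0 : 0 < `|h| by rewrite normr_gt0.
  rewrite ler_pdivrMl//; apply: (@le_trans _ _ (`|h| `^ r)).
    by apply: ge0_ler_powR; rewrite ?nnegrE ?ppart_ge0 ?ppart_norm ?(ltW r0).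
  rewrite -mulr_powRB1//; apply: ler_wpM2l => //; apply: hd.
  by rewrite normr_ge0 ltW.
Unshelve. all: by end_near. Qed.

Lemma is_derive_npow r s : 1 < r ->
  is_derive s 1 (fun x => npart x `^ r) (- (r * npart s `^ (r - 1))).
Proof.
move=> r1; have := @is_derive1_affine_comp _ (fun x => ppart x `^ r) (-1) 0 s _
  (is_derive_ppow _ r1).
rewrite mulrN1 mulN1r addr0 -npartE; congr (is_derive _ _ _ _).
by apply/funext => x; rewrite mulN1r addr0.
Qed.

Lemma continuous_npow r : 0 < r -> continuous (fun s => npart s `^ r).
Proof.
move=> r0 s; apply: (@continuous_comp _ _ _ -%R (fun x => ppart x `^ r)).
  exact: opp_continuous.
exact: continuous_ppow.
Qed.

Lemma derive_gt0_lt (f df : R -> R) x y : x < y ->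
  (forall z, x <= z <= y -> is_derive z 1 f (df z)) ->
  (forall z, x < z < y -> 0 < df z) -> f x < f y.
Proof.
move=> xy hf df0.
have cf : {within `[x, y], continuous f}.
  apply: continuous_in_subspaceT => z; rewrite inE/= in_itv/= => /hf.
  exact: is_derive1_continuous.
have hf' z : z \in `]x, y[%R -> is_derive z 1 f (df z).
  by rewrite in_itv/= => /andP[h1 h2]; apply: hf; rewrite !ltW.
have [c cxy] := MVT xy hf' cf.
move=> /eqP; rewrite subr_eq => /eqP ->.
rewrite ltrDr mulr_gt0 ?subr_gt0//; apply: df0.
by rewrite in_itv/= in cxy.
Qed.

Lemma derive_le0_le (f df : R -> R) x y : x <= y ->
  (forall z, x <= z <= y -> is_derive z 1 f (df z)) ->
  (forall z, x < z < y -> df z <= 0) -> f y <= f x.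
Proof.
rewrite le_eqVlt => /predU1P[->//|xy] hf df0.
have cf : {within `[x, y], continuous f}.
  apply: continuous_in_subspaceT => z; rewrite inE/= in_itv/= => /hf.
  exact: is_derive1_continuous.
have hf' z : z \in `]x, y[%R -> is_derive z 1 f (df z).
  by rewrite in_itv/= => /andP[h1 h2]; apply: hf; rewrite !ltW.
have [c cxy] := MVT xy hf' cf.
move=> /eqP; rewrite subr_eq => /eqP ->.
rewrite gerDr mulr_le0_ge0 ?subr_ge0 ?(ltW xy)//; apply: df0.
by rewrite in_itv/= in cxy.
Qed.

End powers.

(** * Solving the Riccati equation by inverting a primitive *)

Section quarter_wave.
Context {R : realType} (q : R).
Hypothesis q1 : 1 < q.
Local Notation mu := (@lebesgue_measure R).

Let q0 : 0 < q. Proof. exact: lt_trans q1. Qed.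
Let qn0 : q != 0. Proof. by rewrite gt_eqF. Qed.

Let k (s : R) : R := (1 + (ppart s `^ q + npart s `^ q))^-1.

Let den_gt0 s : 0 < 1 + (ppart s `^ q + npart s `^ q).
Proof. by rewrite ltr_pwDl// addr_ge0 ?powR_ge0. Qed.

Let k_gt0 s : 0 < k s. Proof. by rewrite invr_gt0. Qed.

Let k_cont : continuous k.
Proof.
move=> s; apply: cvgV; first by rewrite gt_eqF.
apply: cvgD; first exact: cvg_cst.
by apply: cvgD; [exact: continuous_ppow|exact: continuous_npow].
Qed.

(** The base point -1 leaves room to the left of 0, so that [F] has a two-sided derivative at 0. *)
Let F (s : R) : R := \int[mu]_(t in `[-1, s]) k t.

Let F_derive (s : R) : -1 < s -> is_derive s 1 F (k s).
Proof.
move=> s1.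
have ki : mu.-integrable `[-1, s + 1] (EFin \o k).
  apply: continuous_compact_integrable; first exact: segment_compact.
  exact: continuous_subspaceT.
have ss1 : s < s + 1 by rewrite ltrDl.
have kc : {for s, continuous k} by exact: k_cont.
have [dF FE] := continuous_FTC1_closed ss1 ki s1 kc.
apply: DeriveDef; first exact: dF.
by rewrite -derive1E; exact: FE.
Qed.

(** For s >= 0 this is the integral of 1/(1 + t^q) over [0, s], a generalized arctangent (the usual
    one when q = 2). *)
Definition qwave (s : R) : R := F s - F 0.

Lemma qwave0 : qwave 0 = 0. Proof. exact: subrr. Qed.

Lemma qwave_derive (s : R) : -1 < s ->
  is_derive s 1 qwave (1 + (ppart s `^ q + npart s `^ q))^-1.
Proof.
move=> s1; have := is_derive1D (F_derive s1) (is_derive1_affine 0 (- F 0) s).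
rewrite addr0; congr (is_derive _ _ _ _).
by apply/funext => x; rewrite mul0r add0r.
Qed.

(** From (1 + z)^q <= 2^q (1 + z^q) the integrand is at most 2^q (1 + z)^(-q), which is minus the
    derivative of c (1 + z)^(1-q) for c = 2^q/(q - 1). Hence [Phi] does not increase. *)
Lemma qwave_bounded : exists C : R, forall s, 0 <= s -> qwave s <= C.
Proof.
have q10 : 0 < q - 1 by rewrite subr_gt0.
pose c := 2 `^ q / (q - 1); exists c => s s0.
pose Phi s := qwave s + c * (s + 1) `^ (1 - q).
have dPhi z : 0 <= z <= s -> is_derive z 1 Phi
    (k z + c * ((1 - q) * (z + 1) `^ (1 - q - 1))).
  move=> /andP[z0 _]; apply: is_derive1D.
    by apply: qwave_derive; apply: lt_le_trans z0; rewrite ltrN10.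
  have z1 : 0 < 1 * z + 1 by rewrite mul1r ltr_wpDl.
  have := is_derive1_affine_comp (is_derive1_powR (1 - q) z1).
  move=> /(is_derive1M (is_derive1_affine 0 c z)).
  rewrite mul0r add0r mul1r mulr1 mul0r add0r; congr (is_derive _ _ _ _).
  by apply/funext => x; rewrite mul0r add0r mul1r.
have : Phi s <= Phi 0.
  apply: (derive_le0_le s0 dPhi) => z /andP[z0 _].
  have z10 : 0 < z + 1 by rewrite ltr_pwDl.
  rewrite (_ : 1 - q - 1 = - q); last by ring.
  have -> : c * ((1 - q) * (z + 1) `^ (- q)) = - (2 `^ q * (z + 1) `^ (- q)).
    by rewrite /c; field; rewrite gt_eqF.
  rewrite subr_le0.
  rewrite powRN /k ppart_pos ?(ltW z0)// npart_pos ?(ltW z0)// powR0// addr0.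
  rewrite ler_pdivlMr ?powR_gt0// ler_pdivrMl; last by rewrite ltr_pwDl ?powR_ge0.
  have [z1|z1] := leP z 1.
    apply: (@le_trans _ _ (2 `^ q)).
      apply: ge0_ler_powR; rewrite ?nnegrE ?(ltW q0) ?(ltW z10)//.
      by rewrite -[2]/(1 + 1) lerD2r.
    by rewrite -[leLHS]mul1r ler_wpM2r ?powR_ge0// lerDl powR_ge0.
  apply: (@le_trans _ _ ((2 * z) `^ q)).
    apply: ge0_ler_powR; rewrite ?nnegrE ?(ltW q0) ?(ltW z10) ?mulr_ge0 ?(ltW z0)//.
    by rewrite mulr_natl mulr2n lerD2l ltW.
  rewrite powRM ?(ltW z0)// mulrC ler_wpM2r ?powR_ge0//.
  by rewrite lerDr.
rewrite /Phi qwave0 !add0r powR1 mulr1; apply: le_trans.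
by rewrite lerDl mulr_ge0 ?powR_ge0// divr_ge0 ?powR_ge0// ltW.
Qed.

(* [qlength] is the integral of [(1 + s `^ q)^-1] over [0 <= s]. *)
Definition qlength : R := sup [set qwave s | s in [set s : R | 0 <= s]].

Lemma qwave_incr x y : 0 <= x -> x < y -> qwave x < qwave y.
Proof.
move=> x0 xy; apply: (derive_gt0_lt xy) => z /andP[xz _].
  apply: qwave_derive; apply: lt_le_trans (le_trans x0 xz).
  by rewrite ltrN10.
exact: k_gt0.
Qed.

Let has_sup_qwave : has_sup [set qwave s | s in [set s : R | 0 <= s]].
Proof.
split; first by exists (qwave 0), 0 => //=.
by have [C hC] := qwave_bounded; exists C => _ [s s0 <-]; exact: hC.
Qed.

Lemma qwave_lt_qlength s : 0 <= s -> qwave s < qlength.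
Proof.
move=> s0; have s1 : s < s + 1 by rewrite ltrDl.
apply: lt_le_trans (qwave_incr s0 s1) _.
by apply: ub_le_sup; [by case: has_sup_qwave|exists (s + 1) => //=; rewrite addr_ge0].
Qed.

Lemma qlength_gt0 : 0 < qlength.
Proof. by rewrite -qwave0 qwave_lt_qlength. Qed.

Lemma qwave_surj y : 0 <= y < qlength -> exists2 s, 0 <= s & qwave s = y.
Proof.
move=> /andP[y0 yl].
have [_ [S S0 <-]] := sup_gt (proj1 has_sup_qwave) yl; rewrite -/qlength => yS.
have cq : {within `[0, S], continuous qwave}.
  apply: continuous_in_subspaceT => z; rewrite inE/= in_itv/= => /andP[z0 _].
  by apply: is_derive1_continuous (qwave_derive _); apply: lt_le_trans z0; rewrite ltrN10.
have [|c] := @IVT _ qwave 0 S y S0 cq.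
  rewrite qwave0 minElt maxElt.
  have -> : 0 < qwave S by exact: le_lt_trans yS.
  by rewrite y0 ltW.
by rewrite in_itv/= => /andP[c0 _] cy; exists c.
Qed.

Section two_sided.
Variables a b : R.
Hypotheses (a0 : 0 < a) (b0 : 0 < b).

Definition potential (s : R) : R := a `^ (- q) * ppart s `^ q + b `^ (- q) * npart s `^ q.

Lemma potential_ge0 s : 0 <= potential s.
Proof. by rewrite addr_ge0// mulr_ge0 ?powR_ge0. Qed.

Lemma potential_pos s : 0 <= s -> potential s = (s / a) `^ q.
Proof.
move=> s0; rewrite /potential ppart_pos// npart_pos// powR0// mulr0 addr0.
by rewrite powRM ?invr_ge0 ?(ltW a0)// powRV ?(ltW a0)// mulrC.
Qed.

Lemma potential_neg s : s <= 0 -> potential s = (- s / b) `^ q.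
Proof.
move=> s0; rewrite /potential ppart_neg// npart_neg// powR0// mulr0 add0r.
by rewrite powRM ?oppr_ge0 ?invr_ge0 ?(ltW b0)// powRV ?(ltW b0)// mulrC.
Qed.

(** Obtained by the substitutions s = a t and s = - b t in the integral of 1/(1 + potential) from 0
    to s. The [+ 0] fits the affine chain rule. *)
Let G (s : R) : R := if s <= 0 then - b * qwave (- b^-1 * s + 0) else a * qwave (a^-1 * s + 0).

Let Gneg (s : R) : s <= 0 -> is_derive s 1 (fun s => - b * qwave (- b^-1 * s + 0))
  (1 + potential s)^-1.
Proof.
move=> s0; have sb : 0 <= - b^-1 * s by rewrite mulNr -mulrN mulr_ge0 ?oppr_ge0// invr_ge0 ltW.
have h : -1 < - b^-1 * s + 0 by rewrite addr0 (lt_le_trans _ sb)// ltrN10.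
have := is_derive1Z (- b) (is_derive1_affine_comp (qwave_derive h)).
move=> H; apply: (is_derive_eq H).
rewrite addr0 ppart_pos// npart_pos// (powR0 qn0) addr0 potential_neg//.
rewrite mulrCA mulrNN mulfV ?gt_eqF// mulr1; congr (1 + _ `^ _)^-1.
by rewrite !mulNr mulrC.
Qed.

Let Gpos (s : R) : 0 <= s -> is_derive s 1 (fun s => a * qwave (a^-1 * s + 0))
  (1 + potential s)^-1.
Proof.
move=> s0; have sb : 0 <= a^-1 * s by rewrite mulr_ge0// invr_ge0 ltW.
have h : -1 < a^-1 * s + 0 by rewrite addr0 (lt_le_trans _ sb)// ltrN10.
have := is_derive1Z a (is_derive1_affine_comp (qwave_derive h)).
move=> H; apply: (is_derive_eq H).
rewrite addr0 ppart_pos// npart_pos// (powR0 qn0) addr0 potential_pos//.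
by rewrite mulrCA mulfV ?gt_eqF// mulr1 [a^-1 * s]mulrC.
Qed.

Let G_derive (s : R) : is_derive s 1 G (1 + potential s)^-1.
Proof.
have [s0|s0|<-] := ltgtP 0 s.
- apply: near_eq_is_derive (Gpos (ltW s0)).
  near=> x; have x0 : 0 < x by near: x; exact: lt_nbhsr.
  by rewrite /G leNgt x0.
- apply: near_eq_is_derive (Gneg (ltW s0)).
  near=> x; have x0 : x < 0 by near: x; exact: lt_nbhsl.
  by rewrite /G ltW.
- by apply: is_derive1_glue (Gneg _) (Gpos _); rewrite // !mulr0 !addr0 qwave0 !mulr0.
Unshelve. all: by end_near. Qed.

Let den s : 0 < 1 + potential s.
Proof. by rewrite ltr_pwDl// potential_ge0. Qed.

Let G_incr x y : x < y -> G x < G y.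
Proof.
move=> xy; apply: (derive_gt0_lt xy) => z _; first exact: G_derive.
by rewrite invr_gt0.
Qed.

Let G_inj : injective G.
Proof.
move=> x y Gxy; apply/eqP; rewrite eq_le !leNgt.
by apply/andP; split; apply/negP => /G_incr; rewrite Gxy ltxx.
Qed.

Let G_surj y : - b * qlength < y < a * qlength -> exists s, G s = y.
Proof.
move=> /andP[y1 y2]; have [y0|y0] := leP y 0.
  have [|s s0 sy] := @qwave_surj (- y / b).
    rewrite divr_ge0 ?oppr_ge0 ?(ltW b0)//= ltr_pdivrMr// ltrNl.
    by rewrite mulrC -mulNr.
  exists (- (b * s)); rewrite /G oppr_le0 mulr_ge0 ?(ltW b0)//.
  rewrite mulrNN mulrA mulVf ?gt_eqF// mul1r addr0 sy.
  by field; rewrite gt_eqF.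
have [|s s0 sy] := @qwave_surj (y / a).
  by rewrite divr_ge0 ?(ltW y0) ?(ltW a0)//= ltr_pdivrMr// mulrC.
exists (a * s); rewrite /G.
have sn0 : s != 0.
  apply/eqP => s0'; move: sy; rewrite s0' qwave0 => /esym/eqP.
  by rewrite mulf_eq0 invr_eq0 !gt_eqF.
have s_gt0 : 0 < s by rewrite lt_neqAle eq_sym sn0.
rewrite leNgt mulr_gt0//= mulrA mulVf ?gt_eqF// mul1r addr0 sy mulrC.
by rewrite divfK ?gt_eqF.
Qed.

Let G_range s : - b * qlength < G s < a * qlength.
Proof.
have l0 := qlength_gt0.
rewrite /G; case: (leP s 0) => s0.
  have sb : 0 <= - b^-1 * s by rewrite mulNr -mulrN mulr_ge0 ?oppr_ge0// invr_ge0 ltW.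
  rewrite addr0 ltr_nM2l ?oppr_lt0// qwave_lt_qlength//=.
  apply: (@le_lt_trans _ _ 0); last by rewrite mulr_gt0.
  rewrite mulNr oppr_le0 mulr_ge0 ?(ltW b0)//.
  move: sb; rewrite le_eqVlt => /predU1P[<-|sb]; first by rewrite qwave0.
  by rewrite -qwave0 ltW// qwave_incr.
have sb : 0 < a^-1 * s by rewrite mulr_gt0// invr_gt0.
rewrite addr0 ltr_pM2l// qwave_lt_qlength ?(ltW sb)// andbT.
apply: (@lt_trans _ _ 0); first by rewrite mulNr oppr_lt0 mulr_gt0.
by rewrite mulr_gt0// -qwave0 qwave_incr.
Qed.

(* [rho] is, up to a constant, the flux of the eigenfunction divided by its [(p-1)]-st
   power; it inverts the primitive [G] of [1 / (1 + potential)], whose range is an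
   interval of length [(a + b) * qlength]. *)
Lemma riccati_exists (T : R) : 0 < T -> exists rho : R -> R,
  (forall t, - T < t < T -> is_derive t 1 rho
     (- ((a + b) * qlength / (2 * T)) * (1 + potential (rho t)))) /\
  (forall s, exists2 t, - T < t < T & rho t = s).
Proof.
move=> T0.
(* Since [G] is injective, the choice returns its inverse on the range, and the default 0
   elsewhere. *)
pose g y := xget 0 [set s | G s = y].
have gK : cancel G g.
  by move=> s; apply: G_inj; rewrite /g; exact: (xgetPex 0 (ex_intro (fun x => G x = G s) s erefl)).
have G_cont s : {for s, continuous G} := is_derive1_continuous (G_derive s).
have g_derive s : is_derive (G s) 1 g (1 + potential s).
  rewrite -[1 + _]invrK; apply: is_derive_inverse (G_derive s) _.
  - by near=> z; exact: gK.
  - by near=> z; exact: G_cont.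
  - by rewrite invr_eq0 gt_eqF.
have l0 := qlength_gt0.
have ab0 : 0 < a + b by rewrite addr_gt0.
set m := (a + b) * qlength / (2 * T).
have m0 : 0 < m by rewrite divr_gt0 ?mulr_gt0.
(* [Y] decreases from [a * qlength] at - T to [- b * qlength] at T, because [m * (2 * T)] is the
   length of the range of [G]. As g has derivative 1 + potential, [g] after [Y] solves the
   equation. *)
pose Y t := - m * t + (a * qlength - m * T).
have YT t : (- T < t < T) <-> (- b * qlength < Y t < a * qlength).
  have -> : - b * qlength = a * qlength - m * T - m * T.
    by rewrite /m; field; rewrite gt_eqF.
  have -> : Y t = a * qlength - m * (t + T) by rewrite /Y; ring.
  rewrite -addrA -opprD -mulrDr ltrD2l ltrN2 ltr_pM2l// ltrD2r.
  by rewrite gtrBl pmulr_rgt0// -ltrBlDr sub0r andbC.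
exists (fun t => g (Y t)); split.
  move=> t /YT/G_surj[s sE].
  have gd : is_derive (Y t) 1 g (1 + potential s) by rewrite -sE; exact: g_derive.
  apply: (is_derive_eq (is_derive1_affine_comp gd)).
  by rewrite -sE gK mulrC.
move=> s; exists ((a * qlength - G s) / m - T); last first.
  rewrite -[RHS]gK; congr g; rewrite /Y; field.
  by rewrite gt_eqF.
apply/YT; have -> : Y ((a * qlength - G s) / m - T) = G s; last exact: G_range.
by rewrite /Y; field; rewrite gt_eqF.
Unshelve. all: by end_near. Qed.

End two_sided.
End quarter_wave.

(** * Conjugate exponents and scaled forms of Young's inequality *)

Section exponents.
Context {R : realType} (p : R).
Hypothesis p1 : 1 < p.

Definition conj_exp : R := p / (p - 1).
Local Notation q := conj_exp.

Let p0 : 0 < p. Proof. exact: lt_trans p1. Qed.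
Let pn0 : p != 0. Proof. by rewrite gt_eqF. Qed.
Let p10 : 0 < p - 1. Proof. by rewrite subr_gt0. Qed.
Let p1n0 : p - 1 != 0. Proof. by rewrite gt_eqF. Qed.

Lemma conj_exp_gt1 : 1 < q.
Proof. by rewrite /q ltr_pdivlMr// mul1r gtrBl. Qed.
Lemma conj_expM : q * (p - 1) = p. Proof. by rewrite /q divfK. Qed.
Lemma conj_exp_sub1 : q - 1 = (p - 1)^-1. Proof. by rewrite /q; field. Qed.
Lemma conj_exp_sub1M : (q - 1) * (p - 1) = 1. Proof. by rewrite conj_exp_sub1 mulVf. Qed.
Lemma conj_exp_div : q * p^-1 = q - 1.
Proof. by rewrite /q; field; rewrite pn0 p1n0. Qed.

(** Young's inequality multiplied by p; the second coefficient is p/q = p - 1. *)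
Lemma young_conj (X Y : R) : 0 <= X -> 0 <= Y ->
  p * (X * Y) <= X `^ p + (p - 1) * Y `^ q.
Proof.
move=> X0 Y0; have q1 := conj_exp_gt1; have q0 : 0 < q by exact: lt_trans q1.
have h : p^-1 + q^-1 = 1 by rewrite /q; field; rewrite pn0 p1n0.
have := conjugate_powR X0 Y0 p0 q0 h; rewrite -(ler_pM2l p0) => /le_trans; apply.
rewrite le_eqVlt; apply/orP; left; apply/eqP; rewrite /q; field.
by rewrite pn0 p1n0.
Qed.

End exponents.

Section scaling.
Context {R : realType} (p : R).
Hypothesis p1 : 1 < p.
Local Notation q := (conj_exp p).

(** Since q (p - 1) = p and (q - 1)(p - 1) = 1, the powers of [c] cancel and [s] comes out linearly.
    It says on one half-line that [dpotential] below inverts the flux. *)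
Lemma flux_scaling (c s r w : R) : 0 < c -> 0 <= s -> 0 <= r -> 0 <= w ->
  c `^ p * (r * (c `^ (- q) * s `^ (q - 1)) * w) `^ (p - 1) =
  r `^ (p - 1) * (s * w `^ (p - 1)).
Proof.
move=> c0 s0 r0 w0.
rewrite !powRM ?mulr_ge0 ?powR_ge0//.
rewrite -!powRrM mulNr (conj_expM p1) (conj_exp_sub1M p1) powRr1//.
have -> : c `^ p * (r `^ (p - 1) * (c `^ (- p) * s) * w `^ (p - 1)) =
   (c `^ p * c `^ (- p)) * (r `^ (p - 1) * (s * w `^ (p - 1))) by ring.
by rewrite powRN mulfV ?mul1r// gt_eqF// powR_gt0.
Qed.

(** [young_conj] for X = c z and Y = r^(p-1) (s/c) x^(p-1), where q (p - 1) = p computes Y^q. *)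
Lemma young_scaling (c s z x r : R) :
  0 < c -> 0 <= s -> 0 <= z -> 0 <= x -> 0 <= r ->
  r `^ (p - 1) * (s * (p * x `^ (p - 1) * z)) <=
  (c * z) `^ p + (p - 1) * r `^ p * (s / c) `^ q * x `^ p.
Proof.
move=> c0 s0 z0 x0 r0.
have sc : 0 <= s / c by rewrite divr_ge0// ltW.
have := @young_conj _ p p1 (c * z) (r `^ (p - 1) * (s / c) * x `^ (p - 1)).
rewrite !mulr_ge0 ?powR_ge0 ?invr_ge0 ?(ltW c0)// => /(_ isT isT) H.
have -> : r `^ (p - 1) * (s * (p * x `^ (p - 1) * z)) =
   p * (c * z * (r `^ (p - 1) * (s / c) * x `^ (p - 1))).
  by field; rewrite gt_eqF.
apply: le_trans H _; rewrite lerD2l.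
rewrite (powRM _ (mulr_ge0 (powR_ge0 _ _) sc) (powR_ge0 _ _)) (powRM _ (powR_ge0 _ _) sc).
have powE y : (y `^ (p - 1)) `^ q = y `^ p by rewrite -powRrM mulrC (conj_expM p1).
rewrite !powE.
by rewrite le_eqVlt; apply/orP; left; apply/eqP; ring.
Qed.

End scaling.

Section finsler.
Context {R : realType}.
Implicit Types a b x y : R.

Lemma finslerH_ge0 a b x : 0 <= a -> 0 <= b -> 0 <= finslerH a b x.
Proof. by move=> a0 b0; rewrite addr_ge0// mulr_ge0 ?ppart_ge0 ?npart_ge0. Qed.

Lemma finslerH_pos a b x : 0 <= x -> finslerH a b x = a * x.
Proof. by move=> x0; rewrite /finslerH ppart_pos// npart_pos// mulr0 addr0. Qed.

Lemma finslerH_neg a b x : x <= 0 -> finslerH a b x = b * - x.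
Proof. by move=> x0; rewrite /finslerH ppart_neg// npart_neg// mulr0 add0r. Qed.

Lemma finslerHN a b x : finslerH a b (- x) = finslerH b a x.
Proof. by rewrite /finslerH addrC /ppart /npart opprK. Qed.

Lemma ppart_lip x y : `|ppart x - ppart y| <= `|x - y|.
Proof.
wlog xy : x y / x <= y.
  by move=> H; have [/H//|/ltW/H] := leP x y; rewrite distrC (distrC y).
have hh : 0 <= y - x by rewrite subr_ge0.
rewrite !(distrC _ y) !(distrC _ (ppart y)) (ger0_norm hh).
have [y0|y0] := leP y 0.
  by rewrite !ppart_neg ?subrr ?normr0// (le_trans xy).
have [x0|x0] := leP x 0.
  rewrite (ppart_neg x0) (ppart_pos (ltW y0)) subr0 ger0_norm ?(ltW y0)//.
  by rewrite lerDl oppr_ge0.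
by rewrite !ppart_pos ?(ltW x0) ?(ltW y0)// ger0_norm.
Qed.

Lemma finslerH_lip a b x y : 0 <= a -> 0 <= b ->
  `|finslerH a b x - finslerH a b y| <= (a + b) * `|x - y|.
Proof.
move=> a0 b0; rewrite /finslerH opprD addrACA -!mulrBr.
apply: le_trans (ler_normD _ _) _; rewrite !normrM (ger0_norm a0) (ger0_norm b0).
rewrite mulrDl lerD// ler_wpM2l// ?ppart_lip// !npartE.
by apply: le_trans (ppart_lip _ _) _; rewrite -opprD normrN.
Qed.

Lemma measurable_ppart : measurable_fun [set: R] (@ppart R).
Proof. by apply: measurable_maxr => //; exact: measurable_id. Qed.

Lemma measurable_npart : measurable_fun [set: R] (@npart R).
Proof. by apply: measurable_maxr => //; exact: oppr_measurable. Qed.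

Lemma measurable_finslerH a b : measurable_fun [set: R] (finslerH a b).
Proof.
apply: measurable_funD; apply: measurable_funM => //.
  exact: measurable_ppart.
exact: measurable_npart.
Qed.

End finsler.

(** * The eigenfunction for positive coefficients *)

Section eigenfunction.
Context {R : realType} (p T a b : R).
Hypotheses (p1 : 1 < p) (T0 : 0 < T) (a0 : 0 < a) (b0 : 0 < b).
Local Notation mu := (@lebesgue_measure R).
Local Notation Om := (`]- T, T[%classic : set R).
Local Notation Ig f := (mu.-integrable Om (EFin \o f)).
Local Notation q := (conj_exp p).
Local Notation D := (potential q a b).

Let p0 : 0 < p. Proof. exact: lt_trans p1. Qed.
Let pn0 : p != 0. Proof. by rewrite gt_eqF. Qed.
Let p10 : 0 < p - 1. Proof. by rewrite subr_gt0. Qed.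
Let p1n0 : p - 1 != 0. Proof. by rewrite gt_eqF. Qed.
Let q1 : 1 < q := conj_exp_gt1 p1.
Let q0 : 0 < q. Proof. exact: lt_trans q1. Qed.
Let q10 : 0 < q - 1. Proof. by rewrite subr_gt0. Qed.

(* The speed for which the Riccati flow crosses the whole line in time [2 T]. *)
Definition speed : R := (a + b) * qlength q / (2 * T).
Local Notation m := speed.
(** Write the flux as rate^(p-1) rho w^(p-1), so that w' = rate E(rho) w. The eigenvalue equation
    then becomes rho' = - m D(rho) - lam / rate^(p-1) with m = (p - 1) rate, and its two
    coefficients agree exactly when lam = (p - 1) rate^p. *)
Definition rate : R := speed / (p - 1).
Definition eigenvalueH : R := (p - 1) * rate `^ p.
Local Notation lam := eigenvalueH.

Lemma speed_gt0 : 0 < m.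
Proof. by rewrite divr_gt0 ?mulr_gt0 ?addr_gt0 ?qlength_gt0. Qed.
Lemma rate_gt0 : 0 < rate. Proof. by rewrite divr_gt0 ?speed_gt0. Qed.
Lemma eigenvalueH_gt0 : 0 < lam.
Proof. by rewrite mulr_gt0 ?powR_gt0 ?rate_gt0. Qed.
Lemma eigenvalueH_speed : lam = m * rate `^ (p - 1).
Proof.
rewrite /lam -mulr_powRB1 ?(ltW rate_gt0)// mulrA; congr (_ * _).
by rewrite /rate mulrC divfK.
Qed.

(** This is D'/q, and also the inverse of the flux map sending x to a^p (x^+)^(p-1) - b^p
    (x^-)^(p-1). *)
Definition dpotential (s : R) : R :=
  a `^ (- q) * ppart s `^ (q - 1) - b `^ (- q) * npart s `^ (q - 1).
Local Notation E := dpotential.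

Lemma potential_derive (s : R) : is_derive s 1 D (q * E s).
Proof.
have := is_derive1D (is_derive1Z (a `^ (- q)) (is_derive_ppow s q1))
  (is_derive1Z (b `^ (- q)) (is_derive_npow s q1)).
by move=> H; apply: (is_derive_eq H); rewrite /E; ring.
Qed.

(** Euler's identity for the q-homogeneous function D. *)
Lemma mul_dpotential s : s * E s = D s.
Proof.
have qn0 : q != 0 by rewrite gt_eqF. 
have q1n0 : q - 1 != 0 by rewrite gt_eqF.
rewrite /E /potential; have [s0|s0] := leP 0 s.
  rewrite ppart_pos// npart_pos// !powR0// !mulr0 subr0 addr0 mulrCA.
  by rewrite mulr_powRB1.
rewrite ppart_neg ?(ltW s0)// npart_neg ?(ltW s0)// !powR0// !mulr0 sub0r add0r.
by rewrite mulrN -mulNr mulrCA mulr_powRB1// oppr_ge0 ltW.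
Qed.

Lemma dpotential_cont : continuous E.
Proof.
move=> s; apply: cvgB; apply: cvgM; try exact: cvg_cst.
  exact: continuous_ppow.
exact: continuous_npow.
Qed.

Let den s : 0 < 1 + D s. Proof. by rewrite ltr_pwDl// potential_ge0. Qed.

Lemma dpotential_pos s : 0 <= s -> E s = a^-1 * D s `^ p^-1.
Proof.
move=> s0; rewrite /E ppart_pos// npart_pos// powR0 ?gt_eqF// mulr0 subr0.
rewrite potential_pos// -powRrM (conj_exp_div p1) powRM ?invr_ge0 ?(ltW a0)//.
rewrite powRV ?(ltW a0)// mulrCA mulrC; congr (_ * _).
rewrite -[X in X * _]powR_inv1 ?(ltW a0)// -powRD ?(gt_eqF a0) ?implybT//.
by congr (_ `^ _); ring.
Qed.

Lemma dpotential_neg s : s <= 0 -> E s = - (b^-1 * D s `^ p^-1).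
Proof.
move=> s0; rewrite /E ppart_neg// npart_neg// powR0 ?gt_eqF// mulr0 sub0r.
rewrite potential_neg// -powRrM (conj_exp_div p1) powRM ?oppr_ge0 ?invr_ge0 ?(ltW b0)//.
rewrite powRV ?(ltW b0)// mulrCA mulrC; congr (- (_ * _)).
rewrite -[X in X * _]powR_inv1 ?(ltW b0)// -powRD ?(gt_eqF b0) ?implybT//.
by congr (_ `^ _); ring.
Qed.

(** On each half-line |E| is D^(1/p) divided by [a] or [b], and D^(1/p) is at most (1 + D)^(1/p).
    This keeps w' bounded although rho is not. *)
Lemma dpotential_bound s : `|E s| * (1 + D s) `^ (- p^-1) <= a^-1 + b^-1.
Proof.
have h : D s `^ p^-1 * (1 + D s) `^ (- p^-1) <= 1.
  rewrite powRN ler_pdivrMr ?powR_gt0// mul1r.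
  by apply: ge0_ler_powR; rewrite ?nnegrE ?invr_ge0 ?(ltW p0) ?potential_ge0 ?(ltW (den _)) ?lerDr.
have aV : 0 < a^-1 by rewrite invr_gt0.
have bV : 0 < b^-1 by rewrite invr_gt0.
have [s0|/ltW s0] := leP 0 s.
  rewrite dpotential_pos// ger0_norm ?mulr_ge0 ?powR_ge0 ?(ltW aV)// -mulrA.
  rewrite (@le_trans _ _ (a^-1))// ?lerDl ?(ltW bV)//.
  by rewrite -[leRHS]mulr1 ler_wpM2l// ltW.
rewrite dpotential_neg// normrN ger0_norm ?mulr_ge0 ?powR_ge0 ?(ltW bV)// -mulrA.
rewrite (@le_trans _ _ (b^-1))// ?lerDr ?(ltW aV)//.
by rewrite -[leRHS]mulr1 ler_wpM2l// ltW.
Qed.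

Variable rho : R -> R.
Hypothesis rho_derive : forall t, - T < t < T ->
  is_derive t 1 rho (- m * (1 + D (rho t))).
Hypothesis rho_surj : forall s, exists2 t, - T < t < T & rho t = s.

(** The first integral (p - 1) H(w')^p + lam w^p = const of the eigenvalue equation reads w^p (1 +
    D(rho)) = const in these variables, because H(w')^p = rate^p D(rho) w^p; the constant is set to
    1. *)
Definition eigenfun (t : R) : R :=
  if - T < t < T then (1 + D (rho t)) `^ (- p^-1) else 0.
Definition deigenfun (t : R) : R := rate * E (rho t) * eigenfun t.
Local Notation w := eigenfun.
Local Notation dw := deigenfun.

Lemma eigenfun_gt0 t : - T < t < T -> 0 < w t.
Proof. by move=> h; rewrite /w h powR_gt0. Qed.

Lemma eigenfun_ge0 t : 0 <= w t.
Proof. by rewrite /w; case: ifP => // _; rewrite powR_ge0. Qed.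

Lemma eigenfun_le1 t : w t <= 1.
Proof.
rewrite /w; case: ifP => // _; rewrite powRN invf_le1 ?powR_gt0//.
rewrite -[leLHS](powRr0 (1 + D (rho t))); apply: ler_powR.
  by rewrite lerDl potential_ge0.
by rewrite invr_ge0 ltW.
Qed.

Lemma eigenfun_derive t : - T < t < T -> is_derive t 1 w (dw t).
Proof.
move=> ht; have /andP[t1 t2] := ht.
have d1 := is_derive1_chain (potential_derive (rho t)) (rho_derive ht).
have d2 := is_derive1D (is_derive1_affine 0 1 t) d1.
rewrite add0r in d2.
have d20 : 0 < 0 * t + 1 + D (rho t) by rewrite mul0r add0r.
have := @is_derive1_chain _ (fun x => x `^ (- p^-1)) (fun y => 0 * y + 1 + D (rho y))
  _ _ _ (is_derive1_powR (- p^-1) d20) d2.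
move=> d3.
have d4 : is_derive t 1 (fun y => (0 * y + 1 + D (rho y)) `^ (- p^-1)) (dw t).
  apply: (is_derive_eq d3); rewrite /dw /w ht mul0r add0r.
  have -> : (1 + D (rho t)) `^ (- p^-1) = (1 + D (rho t)) `^ (- p^-1 - 1) * (1 + D (rho t)).
    rewrite -[X in _ = _ * X]powRr1 ?(ltW (den _))// -powRD ?subrK//.
    by rewrite (gt_eqF (den _)) implybT.
  have -> : rate = q * m / p.
    by rewrite /rate /conj_exp; field; rewrite pn0 p1n0.
  by ring.
apply: near_eq_is_derive d4.
near=> y.
have -> : w y = (1 + D (rho y)) `^ (- p^-1).
  rewrite /w; have -> // : - T < y < T.
  by apply/andP; split; near: y; [exact: lt_nbhsr|exact: lt_nbhsl].
by rewrite mul0r add0r.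
Unshelve. all: by end_near. Qed.

Let L := rate * (a^-1 + b^-1).
Let L0 : 0 <= L.
Proof. by rewrite mulr_ge0 ?(ltW rate_gt0)// addr_ge0// invr_ge0 ltW. Qed.

Lemma deigenfun_bound t : `|dw t| <= L.
Proof.
rewrite /dw /w; case: ifP => ht; last by rewrite mulr0 normr0.
rewrite normrM normrM (gtr0_norm rate_gt0) -mulrA; apply: ler_wpM2l; first exact: ltW rate_gt0.
by rewrite (ger0_norm (powR_ge0 _ _)) dpotential_bound.
Qed.

Let lip_in x y : - T < x -> x <= y -> y < T -> `|w y - w x| <= L * (y - x).
Proof.
move=> Tx; rewrite le_eqVlt => /predU1P[<-|xy] yT; first by rewrite !subrr normr0 mulr0.
have hd z : x <= z <= y -> - T < z < T.
  by move=> /andP[xz zy]; rewrite (lt_le_trans Tx xz) (le_lt_trans zy yT).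
have cw : {within `[x, y], continuous w}.
  apply: continuous_in_subspaceT => z; rewrite inE/= in_itv/= => /hd/eigenfun_derive.
  exact: is_derive1_continuous.
have hw z : z \in `]x, y[%R -> is_derive z 1 w (dw z).
  by rewrite in_itv/= => /andP[h1 h2]; apply/eigenfun_derive/hd; rewrite !ltW.
have [c _ ->] := MVT xy hw cw.
rewrite normrM [X in _ * X]gtr0_norm ?subr_gt0// ler_wpM2r ?deigenfun_bound//.
by rewrite subr_ge0 ltW.
Qed.

Let rho_decr x y : - T < x -> x < y -> y < T -> rho y < rho x.
Proof.
move=> Tx xy yT; rewrite -[ltLHS]opprK ltrNl.
apply: (@derive_gt0_lt _ (fun t => - rho t) (fun t => - (- m * (1 + D (rho t)))) _ _ xy).
  move=> z /andP[xz zy]; apply: is_derive1N; apply: rho_derive.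
  by rewrite (lt_le_trans Tx xz) (le_lt_trans zy yT).
by move=> z _; rewrite mulNr opprK mulr_gt0 ?speed_gt0.
Qed.

Let w_small (e s : R) : 0 < e -> Num.max a b * (e `^ (- p)) `^ q^-1 <= `|s| ->
  (1 + D s) `^ (- p^-1) <= e.
Proof.
move=> e0 hs.
have key : e `^ (- p) <= 1 + D s.
  apply: (@le_trans _ _ (D s)); last by rewrite lerDr.
  rewrite -[leLHS]powRr1 ?powR_ge0// -(mulVf (lt0r_neq0 q0)) powRrM.
  have [s0|/ltW s0] := leP 0 s.
    rewrite potential_pos//; apply: ge0_ler_powR; rewrite ?nnegrE ?(ltW q0) ?powR_ge0//.
      by rewrite divr_ge0// ltW.
    rewrite ler_pdivlMr// mulrC; rewrite (ger0_norm s0) in hs; apply: le_trans hs.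
    by rewrite ler_wpM2r ?powR_ge0// le_max lexx.
  rewrite potential_neg//; apply: ge0_ler_powR; rewrite ?nnegrE ?(ltW q0) ?powR_ge0//.
    by rewrite divr_ge0 ?oppr_ge0// ltW.
  rewrite ler_pdivlMr// mulrC; rewrite (ler0_norm s0) in hs; apply: le_trans hs.
  by rewrite ler_wpM2r ?powR_ge0// le_max lexx orbT.
rewrite powRN -[leRHS]invrK lef_pV2 ?posrE ?powR_gt0 ?invr_gt0//.
have -> : e^-1 = (e `^ (- p)) `^ p^-1.
  by rewrite -powRrM mulNr mulfV// powR_inv1// ltW.
by apply: ge0_ler_powR; rewrite ?nnegrE ?invr_ge0 ?(ltW p0) ?powR_ge0 ?(ltW (den _)).
Qed.

(** A quantitative form of w -> 0 at the left end. [rho] takes the large value [s] at some [x],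
    where [w] is at most [e]; as [s] is at least [rho y] and [rho] decreases, [x] is not to the
    right of [y], and the Lipschitz bound on [x, y] applies. *)
Let w_left y : - T < y < T -> w y <= L * (y + T).
Proof.
move=> hy; have /andP[y1 y2] := hy; apply/ler_addgt0Pr => e e0.
pose s := Num.max (rho y) (Num.max a b * (e `^ (- p)) `^ q^-1).
have s0 : Num.max a b * (e `^ (- p)) `^ q^-1 <= `|s|.
  by apply: le_trans (ler_norm _); rewrite le_max lexx orbT.
have [x hx xs] := rho_surj s; have /andP[x1 x2] := hx.
have xy : x <= y.
  rewrite leNgt; apply/negP => yx; have := rho_decr y1 yx x2.
  by rewrite xs ltNge /s le_max lexx.
have wx : w x <= e by rewrite /w hx xs w_small.
have := lip_in x1 xy y2; rewrite ler_norml => /andP[_].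
rewrite lerBlDr => /le_trans; apply; apply: lerD => //.
by rewrite ler_wpM2l// lerD2l lerNl ltW.
Qed.

Let w_right y : - T < y < T -> w y <= L * (T - y).
Proof.
move=> hy; have /andP[y1 y2] := hy; apply/ler_addgt0Pr => e e0.
pose s := Num.min (rho y) (- (Num.max a b * (e `^ (- p)) `^ q^-1)).
have s0 : Num.max a b * (e `^ (- p)) `^ q^-1 <= `|s|.
  by rewrite -normrN; apply: le_trans (ler_norm _); rewrite lerNr ge_min lexx orbT.
have [x hx xs] := rho_surj s; have /andP[x1 x2] := hx.
have xy : y <= x.
  rewrite leNgt; apply/negP => yx; have := rho_decr x1 yx y2.
  by rewrite xs ltNge /s ge_min lexx.
have wx : w x <= e by rewrite /w hx xs w_small.
have := lip_in y1 xy x2; rewrite distrC ler_norml => /andP[_].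
rewrite lerBlDr => /le_trans; apply; apply: lerD => //.
by rewrite ler_wpM2l// lerD2r ltW.
Qed.

Let wT t : (t <= - T) || (T <= t) -> w t = 0.
Proof.
by move=> h; rewrite /w ifF//; apply/negbTE; rewrite negb_and -!leNgt.
Qed.

Lemma eigenfun_lipschitz x y : - T <= x <= T -> - T <= y <= T ->
  `|w x - w y| <= L * `|x - y|.
Proof.
wlog xy : x y / x <= y.
  move=> H hx hy; have [xy|/ltW yx] := leP x y; first exact: H.
  by rewrite distrC (distrC x); exact: H.
move=> /andP[x1 x2] /andP[y1 y2].
rewrite distrC (distrC x) [X in L * X]ger0_norm ?subr_ge0//.
have [Tx|xT] := ltP (- T) x; last first.
  have -> : x = - T by apply/eqP; rewrite eq_le xT x1.
  rewrite (@wT (- T)) ?lexx// subr0 opprK.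
  have [yT|Ty] := ltP y T; last first.
    rewrite wT ?Ty ?orbT// normr0 mulr_ge0// -lerBlDr sub0r//.
  have [Ty|yT'] := ltP (- T) y; last first.
    by rewrite wT ?yT'// normr0 mulr_ge0// -lerBlDr sub0r.
  by rewrite ger0_norm ?eigenfun_ge0// w_left// Ty yT.
have [yT|Ty] := ltP y T; first exact: lip_in.
have yE : y = T by apply/eqP; rewrite eq_le Ty y2.
rewrite (@wT y) ?Ty ?orbT// sub0r normrN ger0_norm ?eigenfun_ge0// yE.
have [xT|Tx'] := ltP x T; first by apply: w_right; rewrite Tx.
by rewrite wT ?Tx' ?orbT// mulr_ge0// subr_ge0.
Qed.

Let OmP (x : R) : Om x -> - T < x < T. Proof. by rewrite /= in_itv. Qed.

Lemma rho_cont t : - T < t < T -> {for t, continuous rho}.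
Proof. by move=> /rho_derive; exact: is_derive1_continuous. Qed.

Let w_cont t : - T < t < T -> {for t, continuous w}.
Proof. by move=> /eigenfun_derive; exact: is_derive1_continuous. Qed.

Let dw_cont t : - T < t < T -> {for t, continuous dw}.
Proof.
move=> ht; apply: cvgM; last exact: w_cont.
apply: cvgM; first exact: cvg_cst.
by apply: (@continuous_comp _ _ _ rho E); [exact: rho_cont|exact: dpotential_cont].
Qed.

Let mdw : measurable_fun Om dw.
Proof. by apply: continuous_Om_measurable => x; rewrite in_itv/=; exact: dw_cont. Qed.

(** The factor [c] is there because competitors in [lambdaH] must have norm 1. *)
Lemma eigenfun_scale_W01p (c : R) : 0 <= c ->
  W01p Om p (fun t => c * w t) (fun t => c * dw t).
Proof.
move=> c0; apply: (@W01p_lipschitz _ _ T0 _ (c * L) _ _ _ p _ 0) => //.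
- move=> x y hx hy; rewrite -mulrBr normrM (ger0_norm c0) -mulrA.
  by apply: ler_wpM2l => //; exact: eigenfun_lipschitz.
- by rewrite wT ?lexx ?orbT// mulr0.
- by rewrite wT ?lexx// mulr0.
- exact: measurable_funM.
- move=> x _; rewrite normrM (ger0_norm c0).
  by apply: ler_wpM2l => //; exact: deigenfun_bound.
- by move=> x hx _; apply: is_derive1Z; exact: eigenfun_derive.
Qed.

Lemma eigenfun_measurable : measurable_fun Om w.
Proof. by apply: continuous_Om_measurable => x; rewrite in_itv/=; exact: w_cont. Qed.

Lemma eigenfun_flux t : - T < t < T ->
  a `^ p * ppart (dw t) `^ (p - 1) - b `^ p * npart (dw t) `^ (p - 1) =
  rate `^ (p - 1) * (rho t * w t `^ (p - 1)).
Proof.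
move=> ht; have wt := eigenfun_gt0 ht; have r0 := rate_gt0.
have aux (c s : R) : 0 < c -> 0 <= s ->
    c `^ p * (rate * (c `^ (- q) * s `^ (q - 1)) * w t) `^ (p - 1) =
    rate `^ (p - 1) * (s * w t `^ (p - 1)).
  by move=> c0 s0; apply: flux_scaling => //; exact: ltW.
have [s0|s0] := leP 0 (rho t).
  have dw0 : dw t = rate * (a `^ (- q) * rho t `^ (q - 1)) * w t.
    by rewrite /dw /E ppart_pos// npart_pos// powR0 ?gt_eqF// mulr0 subr0.
  have dw_ge0 : 0 <= dw t.
    rewrite dw0; apply: mulr_ge0; last exact: ltW wt.
    by apply: mulr_ge0; [exact: ltW r0|rewrite mulr_ge0 ?powR_ge0].
  rewrite ppart_pos// npart_pos// powR0 ?gt_eqF// mulr0 subr0 dw0.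
  exact: aux.
have dw0 : - dw t = rate * (b `^ (- q) * (- rho t) `^ (q - 1)) * w t.
  rewrite /dw /E ppart_neg ?(ltW s0)// npart_neg ?(ltW s0)// powR0 ?gt_eqF// mulr0 sub0r.
  by ring.
have Ns0 : 0 <= - rho t by rewrite oppr_ge0 ltW.
have dw_le0 : dw t <= 0.
  rewrite -oppr_ge0 dw0; apply: mulr_ge0; last exact: ltW wt.
  by apply: mulr_ge0; [exact: ltW r0|rewrite mulr_ge0 ?powR_ge0].
rewrite ppart_neg// npart_neg// powR0 ?gt_eqF// mulr0 sub0r dw0 aux//.
by ring.
Qed.

(** The product rule gives - m (1 + D) from rho' and (p - 1) rate rho E from w'. The latter is m D,
    since rho E = D, and cancels the nonlinear term. *)
Lemma flux_derive t : - T < t < T ->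
  is_derive t 1 (fun t => rho t * w t `^ (p - 1)) (- m * w t `^ (p - 1)).
Proof.
move=> ht; have wt := eigenfun_gt0 ht.
have := @is_derive1_chain _ (fun x => x `^ (p - 1)) _ _ _ _
   (is_derive1_powR (p - 1) wt) (eigenfun_derive ht).
move=> /(is_derive1M (rho_derive ht)) H; apply: (is_derive_eq H).
have -> : w t `^ (p - 1) = w t * w t `^ (p - 1 - 1).
  rewrite -[X in _ = X * _]powRr1 ?(ltW wt)// -powRD; last by rewrite (gt_eqF wt) implybT.
  by congr (_ `^ _); ring.
have Em : m = (p - 1) * rate by rewrite /rate mulrC divfK.
transitivity (w t * w t `^ (p - 1 - 1) * (- m * (1 + D (rho t)) + (p - 1) * rate * (rho t * E (rho t)))).
  by rewrite /dw; ring.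
by rewrite mul_dpotential Em; ring.
Qed.

Let flux t := a `^ p * ppart (dw t) `^ (p - 1) - b `^ p * npart (dw t) `^ (p - 1).

Let mflux : measurable_fun Om flux.
Proof.
apply: measurable_funB; apply: measurable_funM => //.
  apply: (@measurableT_comp _ _ _ _ _ _ (@powR R ^~ (p - 1))); first exact: measurable_powR.
  exact: (measurableT_comp measurable_ppart mdw).
apply: (@measurableT_comp _ _ _ _ _ _ (@powR R ^~ (p - 1))); first exact: measurable_powR.
exact: (measurableT_comp measurable_npart mdw).
Qed.

Let flux_bound t : `|flux t| <= (a `^ p + b `^ p) * L `^ (p - 1).
Proof.
have h x : 0 <= x <= L -> x `^ (p - 1) <= L `^ (p - 1).
  by move=> /andP[x0 xL]; apply: ge0_ler_powR; rewrite ?nnegrE ?(ltW p10).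
apply: le_trans (ler_normB _ _) _; rewrite !normrM !(ger0_norm (powR_ge0 _ _)) mulrDl.
apply: lerD; apply: ler_wpM2l; rewrite ?powR_ge0//; apply: h.
  by rewrite ppart_ge0 (le_trans (ppart_norm _))// deigenfun_bound.
by rewrite npart_ge0 npartE (le_trans (ppart_norm _))// normrN deigenfun_bound.
Qed.

Let src t := lam * w t `^ (p - 1).

Let src_bound t : `|src t| <= lam.
Proof.
have lam0 := ltW eigenvalueH_gt0.
rewrite ger0_norm; last exact: mulr_ge0 (powR_ge0 _ _).
rewrite -[leRHS]mulr1; apply: ler_wpM2l => //.
apply: (@le_trans _ _ (1 `^ (p - 1))); last by rewrite powR1.
by apply: ge0_ler_powR; rewrite ?nnegrE ?(ltW p10) ?eigenfun_ge0 ?eigenfun_le1.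
Qed.

Let wpow_cont t : - T < t < T -> {for t, continuous (fun t => w t `^ (p - 1))}.
Proof.
move=> ht; have wt := eigenfun_gt0 ht.
apply: is_derive1_continuous; exact: (@is_derive1_chain _ (fun x => x `^ (p - 1)) _ _ _ _
   (is_derive1_powR (p - 1) wt) (eigenfun_derive ht)).
Qed.

Let msrc : measurable_fun Om src.
Proof.
apply: continuous_Om_measurable => x; rewrite in_itv/= => hx.
by apply: cvgM; [exact: cvg_cst|exact: wpow_cont].
Qed.

(** The difference of the integrands is the derivative of the flux times [phi], a function supported
    away from the ends. *)
Let weak_test phi : test_function Om phi ->
  \int[mu]_(x in Om) (flux x * phi^`()%classic x) = \int[mu]_(x in Om) (src x * phi x).
Proof.
move=> tphi; have [x0 [x1 [Ta ab bT phi0]]] := test_support T0 tphi.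
have [mphi mphi'] := test_measurable tphi; have [C C0 hC] := test_bounded T0 tphi.
have ip : Ig phi by apply: (@bdd_integrable _ _ T0 _ C) => // x _; case: (hC x).
have ip' : Ig (phi^`()%classic) by apply: (@bdd_integrable _ _ T0 _ C) => // x _; case: (hC x).
have i1 : Ig (fun x => flux x * phi^`()%classic x).
  by apply: IgM_bdd ip' mflux _ => x _; exact: flux_bound.
have i2 : Ig (fun x => src x * phi x).
  by apply: IgM_bdd ip msrc _ => x _; exact: src_bound.
apply/eqP; rewrite -subr_eq0 -RintegralB//; apply/eqP.
pose f x := rate `^ (p - 1) * (- m * w x `^ (p - 1) * phi x +
   rho x * w x `^ (p - 1) * phi^`()%classic x).
transitivity (\int[mu]_(x in Om) f x).
  apply: eq_Rintegral => x; rewrite inE => /OmP hx.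
  by rewrite /flux eigenfun_flux// /src eigenvalueH_speed /f; ring.
have [] := @Rintegral_derive_compact_support _ _ T0
  (fun x => rate `^ (p - 1) * (rho x * w x `^ (p - 1) * phi x)) f x0 x1 Ta ab bT => //.
- move=> x hx; apply: is_derive1Z.
  exact: is_derive1M (flux_derive hx) (test_is_derive x tphi).
- move=> x; rewrite in_itv/= => hx.
  apply: cvgM; first exact: cvg_cst.
  apply: cvgD; apply: cvgM.
  + by apply: cvgM; [exact: cvg_cst|exact: wpow_cont].
  + exact: test_continuous tphi _.
  + by apply: cvgM; [exact: rho_cont|exact: wpow_cont].
  + exact: test_derive_continuous tphi _.
- by have [|-> _] := phi0 x0; rewrite ?lexx ?mulr0.
- by have [|-> _] := phi0 x1; rewrite ?lexx ?orbT ?mulr0.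
- move=> x hx; have /phi0[h1 h2] : (x <= x0) || (x1 <= x) by case/orP : hx => /ltW ->; rewrite ?orbT.
  by rewrite /f h1 h2 !mulr0 addr0 mulr0.
Qed.

Lemma eigenfun_weak phi dphi : W01p Om p phi dphi ->
  plaplH p a b Om dw dphi =
  (lam%:E * \int[mu]_(t in Om) (`|w t| `^ (p - 2) * w t * phi t)%:E)%E.
Proof.
move=> [[hphi hdphi _] happ].
have iphi := in_Lp_Ig T0 p1 hphi; have idphi := in_Lp_Ig T0 p1 hdphi.
have B1 x : Om x -> `|flux x| <= (a `^ p + b `^ p) * L `^ (p - 1) + lam.
  by move=> _; apply: le_trans (flux_bound _) _; rewrite lerDl ltW ?eigenvalueH_gt0.
have B2 x : Om x -> `|src x| <= (a `^ p + b `^ p) * L `^ (p - 1) + lam.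
  by move=> _; apply: le_trans (src_bound _) _; rewrite lerDr mulr_ge0 ?addr_ge0 ?powR_ge0.
have := weak_identity_ext T0 mflux msrc B1 B2 iphi idphi (approx_L1 T0 p1 hphi hdphi happ) weak_test.
move=> H.
have i1 := IgM_bdd idphi mflux B1; have i2 := IgM_bdd iphi msrc B2.
rewrite /plaplH -[LHS]/(\int[mu]_(t in Om) (flux t * dphi t)%:E)%E.
rewrite (EFin_Rintegral i1) H -(EFin_Rintegral i2).
have -> : (\int[mu]_(t in Om) (`|w t| `^ (p - 2) * w t * phi t)%:E)%E =
          (\int[mu]_(t in Om) (w t `^ (p - 1) * phi t)%:E)%E.
  apply: eq_integral => t; rewrite inE => /OmP ht; have wt := eigenfun_gt0 ht.
  rewrite gtr0_norm// -[X in _ * X * _]powRr1 ?(ltW wt)// -powRD; last first.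
    by rewrite (gt_eqF wt) implybT.
  by congr (_ `^ _ * _)%:E; ring.
have i3 : Ig (fun x => w x `^ (p - 1) * phi x).
  apply: eq_integrable (IgZ lam^-1 i2) => // x _ /=; congr EFin.
  by rewrite /src -mulrA mulKf// gt_eqF// eigenvalueH_gt0.
rewrite (EFin_Rintegral i3) (EFin_Rintegral i2) -EFinM -RintegralZl//.
by congr EFin; apply: eq_Rintegral => x _; rewrite /src mulrA.
Qed.

(** Young's inequality when [r] and [xi] have the same sign; otherwise the left side is nonpositive
    and the right side is not negative. Here [r], [x], [xi] stand for rho, phi and phi' at one
    point. *)
Lemma young_picone (r x xi : R) : 0 <= x ->
  rate `^ (p - 1) * (r * (p * x `^ (p - 1) * xi)) <=
  finslerH a b xi `^ p + lam * D r * x `^ p.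
Proof.
move=> x0; have r0 := rate_gt0.
have rhs0 : 0 <= finslerH a b xi `^ p + lam * D r * x `^ p.
  apply: addr_ge0; first exact: powR_ge0.
  apply: mulr_ge0 (powR_ge0 _ _).
  exact: mulr_ge0 (ltW eigenvalueH_gt0) (potential_ge0 _ _ _ _).
have x10 : 0 <= p * x `^ (p - 1) by rewrite mulr_ge0 ?powR_ge0 ?(ltW p0).
have aux (c s z : R) : 0 < c -> 0 <= s -> 0 <= z ->
    rate `^ (p - 1) * (s * (p * x `^ (p - 1) * z)) <=
    (c * z) `^ p + lam * (s / c) `^ q * x `^ p.
  by move=> c0 s0 z0; rewrite /lam; exact: young_scaling (ltW r0).
have [r00|/ltW r00] := leP 0 r; have [xi0|/ltW xi0] := leP 0 xi.
- by rewrite finslerH_pos// potential_pos//; exact: aux.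
- by apply: le_trans rhs0; rewrite !mulr_ge0_le0 ?powR_ge0.
- apply: le_trans rhs0; rewrite mulr_ge0_le0 ?powR_ge0// mulr_le0_ge0//.
  by rewrite mulr_ge0.
- rewrite finslerH_neg// potential_neg//.
  have -> : r * (p * x `^ (p - 1) * xi) = - r * (p * x `^ (p - 1) * - xi) by ring.
  by apply: aux; rewrite ?oppr_ge0.
Qed.

End eigenfunction.

(** * The fundamental frequency *)

(** Right continuity of the power, with a cap [m] on the step that later keeps the larger
    coefficient equal to 1. *)
Lemma powR_right_approx {R : realType} (p z e m : R) : 0 < z -> 0 < e -> 0 < m ->
  exists2 d : R, 0 < d <= m & (z + d) `^ p <= z `^ p + e.
Proof.
move=> z0 e0 m0; have cz := is_derive1_continuous (is_derive1_powR p z0).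
have [r r0 hr] : exists2 r : R, 0 < r & forall y, `|z - y| < r -> `|z `^ p - y `^ p| <= e.
  by have /cvgrPdist_le/(_ _ e0)[r r0 hr] := cz; exists r.
have r20 : 0 < r / 2 by rewrite divr_gt0.
exists (Num.min m (r / 2)); first by rewrite lt_min m0 r20 ge_min lexx.
rewrite -lerBlDl; apply: le_trans (ler_norm _) _; rewrite distrC; apply: hr.
rewrite opprD addrA subrr sub0r normrN ger0_norm ?le_min ?(ltW m0) ?(ltW r20)//.
by rewrite gt_min [X in _ || X]ltr_pdivrMr// ltr_pMr// ltr1n orbT.
Qed.

Section lower_bound.
Context {R : realType} (p T : R).
Hypotheses (p1 : 1 < p) (T0 : 0 < T).
Local Notation mu := (@lebesgue_measure R).
Local Notation Om := (`]- T, T[%classic : set R).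
Local Notation Ig f := (mu.-integrable Om (EFin \o f)).
Local Notation q := (conj_exp p).
Local Notation lam := (eigenvalueH p T).
Local Notation N := (norm_p Om p).
Implicit Types (a b : R) (u du phi : R -> R).

Let mOm : measurable (Om : set (measurableTypeR R)).
Proof. exact: measurable_itv. Qed.
Let p0 : 0 < p. Proof. exact: lt_trans p1. Qed.
Let pn0 : p != 0. Proof. by rewrite gt_eqF. Qed.
Let p10 : 0 < p - 1. Proof. by rewrite subr_gt0. Qed.
Let q1 : 1 < q := conj_exp_gt1 p1.

Lemma picone_test a b phi : 0 < a -> 0 < b -> test_function Om phi ->
  lam a b * \int[mu]_(x in Om) (`|phi x| `^ p) <=
  \int[mu]_(x in Om) (`|finslerH a b (phi^`()%classic x)| `^ p).
Proof.
move=> a0 b0 tphi.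
have [rho [rho_d _]] := riccati_exists q1 a0 b0 T0.
have [rh2 [rh2_d _]] := riccati_exists q1 b0 a0 T0.
rewrite (addrC b a) in rh2_d.
have [x0 [x1 [Ta ab bT phi0]]] := test_support T0 tphi.
have [mphi mphi'] := test_measurable tphi; have [C C0 hC] := test_bounded T0 tphi.
set r1 := rate p T a b `^ (p - 1).
have r10 : 0 <= r1 by exact: powR_ge0.
have lamE : lam a b = speed p T a b * r1 by exact: eigenvalueH_speed.
have lam2 : lam b a = lam a b by rewrite /eigenvalueH /rate /speed (addrC b).
have rate2 : rate p T b a = rate p T a b by rewrite /rate /speed (addrC b).
(* The first term lives where phi > 0, the second where phi < 0. Since p > 1 both are differentiable
   across the zeros of phi, so a single integration deals with all sign changes. *)
pose V x := r1 * (rho x * ppart (phi x) `^ p) + r1 * (rh2 x * npart (phi x) `^ p).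
pose f x := r1 * (- speed p T a b * (1 + potential q a b (rho x)) * ppart (phi x) `^ p
              + rho x * (p * ppart (phi x) `^ (p - 1) * phi^`()%classic x)) +
            r1 * (- speed p T a b * (1 + potential q b a (rh2 x)) * npart (phi x) `^ p
              + rh2 x * (- (p * npart (phi x) `^ (p - 1)) * phi^`()%classic x)).
have dV x : - T < x < T -> is_derive x 1 V (f x).
  move=> hx; have dphi := test_is_derive x tphi.
  apply: is_derive1D; apply: is_derive1Z; apply: is_derive1M.
  - exact: rho_d.
  - exact: (@is_derive1_chain _ (fun y => ppart y `^ p) phi _ _ _ (is_derive_ppow _ p1) dphi).
  - exact: rh2_d.
  - exact: (@is_derive1_chain _ (fun y => npart y `^ p) phi _ _ _ (is_derive_npow _ p1) dphi).
have cphi := test_continuous tphi; have cphi' := test_derive_continuous tphi.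
have cpot c d (r : R -> R) x : {for x, continuous r} ->
    {for x, continuous (fun x => potential q c d (r x))}.
  move=> cr; apply: (@continuous_comp _ _ _ r (potential q c d)) => //.
  apply: is_derive1_continuous; exact: potential_derive.
have cpp (r : R) x : 0 < r -> {for x, continuous (fun x => ppart (phi x) `^ r)}.
  move=> r0; apply: (@continuous_comp _ _ _ phi (fun y => ppart y `^ r)); first exact: cphi.
  exact: continuous_ppow.
have cnp (r : R) x : 0 < r -> {for x, continuous (fun x => npart (phi x) `^ r)}.
  move=> r0; apply: (@continuous_comp _ _ _ phi (fun y => npart y `^ r)); first exact: cphi.
  exact: continuous_npow.
have cf : {in `]- T, T[, continuous f}.
  move=> x; rewrite in_itv/= => hx.
  have crho : {for x, continuous rho} by exact: is_derive1_continuous (rho_d _ hx).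
  have crh2 : {for x, continuous rh2} by exact: is_derive1_continuous (rh2_d _ hx).
  apply: cvgD; apply: cvgM; try exact: cvg_cst; apply: cvgD.
  - apply: cvgM; last exact: cpp.
    by apply: cvgM; [exact: cvg_cst|apply: cvgD; [exact: cvg_cst|exact: cpot]].
  - apply: cvgM => //; apply: cvgM; last exact: cphi'.
    by apply: cvgM; [exact: cvg_cst|exact: cpp].
  - apply: cvgM; last exact: cnp.
    by apply: cvgM; [exact: cvg_cst|apply: cvgD; [exact: cvg_cst|exact: cpot]].
  - apply: cvgM => //; apply: cvgM; last exact: cphi'.
    by apply: cvgN; apply: cvgM; [exact: cvg_cst|exact: cnp].
have pp0 : ppart 0 = 0 :> R by rewrite ppart_pos.
have np0 : npart 0 = 0 :> R by rewrite npart_pos.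
have p10' : p - 1 != 0 by rewrite gt_eqF.
have Vz x : phi x = 0 -> V x = 0.
  by move=> h; rewrite /V h pp0 np0 powR0// !mulr0 addr0.
have fz x : (x < x0) || (x1 < x) -> f x = 0.
  move=> hx; have /phi0[h1 h2] : (x <= x0) || (x1 <= x) by case/orP : hx => /ltW ->; rewrite ?orbT.
  by rewrite /f h1 h2 pp0 np0 !powR0// !mulr0 !addr0 mulr0 addr0.
have Va : V x0 = 0 by apply: Vz; have [|-> _] := phi0 x0; rewrite ?lexx.
have Vb : V x1 = 0 by apply: Vz; have [|-> _] := phi0 x1; rewrite ?lexx ?orbT.
have [fi intf] := Rintegral_derive_compact_support T0 Ta ab bT dV cf Va Vb fz.
have bH x : `|finslerH a b (phi^`()%classic x)| <= (a + b) * C.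
  have := finslerH_lip (phi^`()%classic x) 0 (ltW a0) (ltW b0).
  rewrite (finslerH_pos a b (lexx 0)) mulr0 !subr0 => /le_trans; apply.
  by apply: ler_wpM2l; [rewrite addr_ge0// ltW|case: (hC x)].
have iH : Ig (fun x => `|finslerH a b (phi^`()%classic x)| `^ p).
  have mH : measurable_fun Om (fun x => finslerH a b (phi^`()%classic x)).
    exact: (measurableT_comp (measurable_finslerH a b) mphi').
  by have /in_LpP[] := bdd_in_Lp T0 p1 mH (fun x _ => bH x).
have iphi : Ig (fun x => `|phi x| `^ p).
  by have /in_LpP[] := bdd_in_Lp T0 p1 mphi (fun x _ => proj1 (hC x)).
rewrite -RintegralZl// -subr_ge0 -RintegralB//; last exact: IgZ.
rewrite -intf; apply: le_Rintegral => //; first by apply: IgB => //; exact: IgZ.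
move=> x _; rewrite (ger0_norm (finslerH_ge0 _ (ltW a0) (ltW b0))).
rewrite /f; have [ph|/ltW ph] := leP 0 (phi x).
  rewrite ppart_pos// npart_pos// !powR0// !(mulr0, mul0r, oppr0, addr0) ger0_norm//.
  (* The term with D(rho) in Young's bound cancels the nonlinear part of the Riccati equation,
     because speed times [r1] is the eigenvalue; what is left is H(phi')^p - lam phi^p. *)
  have := young_picone p1 T0 a0 b0 (rho x) (phi^`()%classic x) ph.
  rewrite -/r1 => H; rewrite mulrDr -lerBrDl; apply: le_trans H _; rewrite lamE.
  by rewrite le_eqVlt; apply/orP; left; apply/eqP; ring.
rewrite ppart_neg// npart_neg// !powR0// !(mulr0, mul0r, add0r) ler0_norm//.
have Nph : 0 <= - phi x by rewrite oppr_ge0.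
have := young_picone p1 T0 b0 a0 (rh2 x) (- phi^`()%classic x) Nph.
rewrite rate2 lam2 finslerHN -/r1 => H; rewrite mulrDr -lerBrDl.
rewrite [- (p * _) * _]mulNr -mulrN; apply: le_trans H _; rewrite lamE.
by rewrite le_eqVlt; apply/orP; left; apply/eqP; ring.
Qed.

Lemma measurable_finslerH_comp a b u : measurable_fun Om u ->
  measurable_fun Om (fun x => finslerH a b (u x)).
Proof. by move=> mu_; exact: (measurableT_comp (measurable_finslerH a b) mu_). Qed.

Lemma norm_p_finslerH_lty a b u : 0 <= a -> 0 <= b -> in_Lp Om p u ->
  (N (fun x => finslerH a b (u x)) < +oo)%E.
Proof.
move=> a0 b0 [mu_ uoo].
have h := @le_norm_p _ _ _ p1 (fun x => finslerH a b (u x)) u (a + b)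
  (measurable_finslerH_comp a b mu_) mu_ (addr_ge0 a0 b0).
apply: le_lt_trans (h _) _.
  move=> x _; have := finslerH_lip (u x) 0 a0 b0.
  by rewrite (finslerH_pos a b (lexx 0)) mulr0 !subr0.
by apply: lte_mul_pinfty => //; rewrite lee_fin addr_ge0.
Qed.

(** The p-th roots are taken so that Minkowski's inequality and the Lipschitz bound on H can carry
    the estimate to the closure. *)
Lemma norm_p_lower_test a b phi : 0 < a -> 0 < b -> test_function Om phi ->
  ((lam a b `^ p^-1)%:E * N phi <= N (fun x => finslerH a b (phi^`()%classic x)))%E.
Proof.
move=> a0 b0 tphi; have l0 := eigenvalueH_gt0 p1 T0 a0 b0.
have [mphi mphi'] := test_measurable tphi; have [C C0 hC] := test_bounded T0 tphi.
have [[hphi hdphi _] _] := W01p_test T0 p1 tphi.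
have [_ iphi] := (@in_LpP _ T _ p1 phi).1 hphi.
have iH : Ig (fun x => `|finslerH a b (phi^`()%classic x)| `^ p).
  have : in_Lp Om p (fun x => finslerH a b (phi^`()%classic x)).
    split; first exact: measurable_finslerH_comp.
    exact: norm_p_finslerH_lty (ltW a0) (ltW b0) hdphi.
  by case/(@in_LpP _ T _ p1).
rewrite !norm_pE// (EFin_Rintegral iphi) (EFin_Rintegral iH) !poweR_EFin -EFinM lee_fin.
have I0 : 0 <= \int[mu]_(x in Om) (`|phi x| `^ p).
  by apply: Rintegral_ge0 => x _; exact: powR_ge0.
rewrite -powRM ?(ltW l0)//; apply: ge0_ler_powR.
- by rewrite invr_ge0 ltW.
- by rewrite nnegrE; apply: mulr_ge0 => //; exact: ltW.
- by rewrite nnegrE; apply: Rintegral_ge0 => x _; exact: powR_ge0.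
- exact: picone_test.
Qed.

Lemma norm_p_lower_pos a b u du : 0 < a -> 0 < b -> W01p Om p u du ->
  ((lam a b `^ p^-1)%:E * N u <= N (fun x => finslerH a b (du x)))%E.
Proof.
move=> a0 b0 [[[mu_ uoo] [mdu duoo] _] happ].
set k := lam a b `^ p^-1; have k0 : 0 <= k by exact: powR_ge0.
have ab0 : 0 <= a + b by rewrite addr_ge0// ltW.
apply/lee_addgt0Pr => e e0.
have c0 : 0 < k + (a + b) + 1 by rewrite ltr_wpDl// addr_ge0.
have [phi [tphi hphi]] := happ _ (divr_gt0 e0 c0).
have [mphi mphi'] := test_measurable tphi.
have mB1 : measurable_fun Om (u \- phi)%R by exact: measurable_funB.
have mB2 : measurable_fun Om (du \- derive1 phi)%R by exact: measurable_funB.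
have s1 : (N u <= N phi + N (u \- phi)%R)%E.
  have -> : N u = N (phi \+ (u \- phi))%R.
    by congr (norm_p _ _ _); apply/funext => x /=; rewrite addrC subrK.
  exact: norm_pD.
set Hd := fun x => finslerH a b (du x).
set Hp := fun x => finslerH a b (phi^`()%classic x).
have mHd : measurable_fun Om Hd by exact: measurable_finslerH_comp.
have mHp : measurable_fun Om Hp by exact: measurable_finslerH_comp.
have mHB : measurable_fun Om (Hp \- Hd)%R by exact: measurable_funB.
have s2 : (N Hp <= N Hd + (a + b)%:E * N (du \- derive1 phi)%R)%E.
  have -> : N Hp = N (Hd \+ (Hp \- Hd))%R.
    by congr (norm_p _ _ _); apply/funext => x /=; rewrite addrC subrK.
  apply: le_trans (norm_pD p1 mHd mHB) _; apply: leeD2l.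
  apply: le_norm_p => // x _ /=; rewrite distrC.
  by apply: finslerH_lip; exact: ltW.
have s3 := norm_p_lower_test a0 b0 tphi.
apply: (@le_trans _ _ (k%:E * (N phi + N (u \- phi)%R))%E).
  by apply: lee_wpmul2l => //; rewrite lee_fin.
rewrite ge0_muleDr ?norm_p_ge0//.
apply: (@le_trans _ _ (N Hd + (a + b)%:E * N (du \- derive1 phi)%R + k%:E * N (u \- phi)%R)%E).
  by apply: leeD2r; apply: le_trans s3 s2.
rewrite -addeA; apply: leeD2l.
set X := N (du \- _)%R in hphi *; set Y := N (u \- _)%R in hphi *.
have X0 : (0 <= X)%E by exact: norm_p_ge0.
have Y0 : (0 <= Y)%E by exact: norm_p_ge0.
move: X Y X0 Y0 hphi => [x| |] [y| |]//; rewrite !lee_fin => x0 y0.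
rewrite -EFinD lte_fin ltr_pdivlMr// => hxy.
apply: le_trans (ltW hxy).
have h1 : 0 <= k * x by exact: mulr_ge0.
have h2 : 0 <= (a + b) * y by exact: mulr_ge0.
have -> : (y + x) * (k + (a + b) + 1) = (a + b) * x + k * y + (k * x + (a + b) * y + (y + x)).
  by ring.
by rewrite lerDl !addr_ge0.
Qed.

(** [speed], and hence [rate], is linear in a + b, and the eigenvalue is p - 1 times the p-th power
    of [rate]; a + b = 2 is the reference case. *)
Lemma eigenvalueHE a b : 0 <= a + b -> lam a b = ((a + b) / 2) `^ p * lam 1 1.
Proof.
move=> ab0; rewrite /eigenvalueH.
have -> : rate p T a b = (a + b) / 2 * rate p T 1 1.
  rewrite /rate /speed; field.
  by rewrite gt_eqF//= gt_eqF.
have r0 := ltW (rate_gt0 p1 T0 (@ltr01 R) (@ltr01 R)).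
have h0 : 0 <= (a + b) / 2 by rewrite divr_ge0.
by rewrite (powRM _ h0 r0) mulrCA.
Qed.

Let lam11 : 0 < lam 1 1. Proof. exact: eigenvalueH_gt0. Qed.

Lemma eigenvalueH_mono a b a' b' : 0 <= a -> 0 <= b -> a <= a' -> b <= b' ->
  lam a b <= lam a' b'.
Proof.
move=> a0 b0 aa bb; have ab0 := addr_ge0 a0 b0.
have ab0' := addr_ge0 (le_trans a0 aa) (le_trans b0 bb).
rewrite (eigenvalueHE ab0) (eigenvalueHE ab0').
apply: ler_wpM2r; first exact: ltW.
apply: ge0_ler_powR; rewrite ?nnegrE ?(ltW p0) ?divr_ge0//.
by rewrite ler_pM2r ?invr_gt0// lerD.
Qed.

Lemma eigenvalueH_ge0 a b : 0 <= a -> 0 <= b -> 0 <= lam a b.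
Proof. by move=> a0 b0; rewrite mulr_ge0 ?powR_ge0 ?(ltW p10). Qed.

Lemma norm_p_lower a b u du : 0 <= a -> 0 <= b -> W01p Om p u du ->
  ((lam a b `^ p^-1)%:E * N u <= N (fun x => finslerH a b (du x)))%E.
Proof.
move=> a0 b0 hu; have [[_ [mdu duoo] _] _] := hu.
apply/lee_addgt0Pr => e e0.
have D0 := norm_p_ge0 T p du.
have [d d0 hd] : exists2 d : R, 0 < d & (d%:E * N du <= e%:E)%E.
  move: D0 duoo; case: (N du) => [r| |]//; rewrite lee_fin => r0 _.
  have r1 : 0 < r + 1 by rewrite ltr_wpDl.
  exists (e / (r + 1)); first by rewrite divr_gt0.
  rewrite -EFinM lee_fin mulrAC ler_pdivrMr// ler_wpM2l ?(ltW e0)//.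
  by rewrite lerDl.
have ad : 0 < a + d by rewrite ltr_wpDl.
have bd : 0 < b + d by rewrite ltr_wpDl.
have := norm_p_lower_pos ad bd hu.
have mHd : measurable_fun Om (fun x => finslerH a b (du x)) by exact: measurable_finslerH_comp.
have mdd : measurable_fun Om (fun x => d * `|du x|).
  by apply: measurable_funM => //; exact: measurableT_comp.
move=> H; apply: le_trans (_ : (_ <= (lam (a + d) (b + d) `^ p^-1)%:E * N u)%E) _.
  apply: lee_wpmul2r; first exact: norm_p_ge0.
  rewrite lee_fin; apply: ge0_ler_powR; rewrite ?nnegrE ?invr_ge0 ?(ltW p0) ?eigenvalueH_ge0 ?(ltW ad) ?(ltW bd)//.
  by apply: eigenvalueH_mono; rewrite // lerDl ltW.
apply: le_trans H _.
(* H_{a+d,b+d}(x) = H_{a,b}(x) + d |x|, so the perturbation costs at most d times the norm of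
   [du]. *)
apply: (@le_trans _ _ (N (fun x => finslerH a b (du x)) + N (fun x => d * `|du x|)%R)%E).
  have := norm_pD p1 mHd mdd; apply: le_trans; rewrite le_eqVlt; apply/orP; left; apply/eqP.
  congr (norm_p _ _ _); apply/funext => x /=.
  have [x0|/ltW x0] := leP 0 (du x).
    by rewrite !finslerH_pos// ger0_norm//; ring.
  by rewrite !finslerH_neg// ler0_norm//; ring.
apply: leeD2l; apply: le_trans hd; apply: le_norm_p => //; first exact: ltW.
by move=> x _; rewrite normrM normr_id (gtr0_norm d0).
Qed.

Lemma lambdaH_ge a b : 0 <= a -> 0 <= b -> ((lam a b)%:E <= lambdaH p a b Om)%E.
Proof.
move=> a0 b0; apply: le_ereal_inf_tmp => _ [u [du [hu nu ->]]].
have := norm_p_lower a0 b0 hu; rewrite nu mule1 => H.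
have -> : (\int[mu]_(t in Om) (finslerH a b (du t) `^ p)%:E)%E =
          (N (fun x => finslerH a b (du x)) `^ p)%E.
  rewrite norm_p_powR//; apply: eq_integral => x _.
  by rewrite ger0_norm// finslerH_ge0.
have -> : (lam a b)%:E = ((lam a b `^ p^-1)%:E `^ p)%E.
  by rewrite poweR_EFin -powRrM mulVf// powRr1// eigenvalueH_ge0.
apply: gt0_ler_poweR => //; rewrite ?in_itv/= ?leey ?andbT ?(ltW p0)//.
  by rewrite lee_fin powR_ge0.
exact: norm_p_ge0.
Qed.

Lemma lambdaH_mono a b a' b' : 0 <= a -> 0 <= b -> a <= a' -> b <= b' ->
  (lambdaH p a b Om <= lambdaH p a' b' Om)%E.
Proof.
move=> a0 b0 aa bb; apply: le_ereal_inf_tmp => _ [u [du [hu nu ->]]].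
apply: (@le_trans _ _ (\int[mu]_(t in Om) (finslerH a b (du t) `^ p)%:E)%E).
  by apply: ereal_inf_lbound; exists u, du.
have [[_ [mdu _] _] _] := hu.
have mpow c d : measurable_fun Om (fun x => (finslerH c d (du x) `^ p)%:E).
  apply/measurable_EFinP.
  apply: (@measurableT_comp _ _ _ _ _ _ (@powR R ^~ p)); first exact: measurable_powR.
  exact: measurable_finslerH_comp.
have a0' := le_trans a0 aa; have b0' := le_trans b0 bb.
apply: ge0_le_integral => //.
- by move=> x _; rewrite lee_fin powR_ge0.
- exact: mpow.
- exact: mpow.
- move=> x _; rewrite lee_fin; apply: ge0_ler_powR; rewrite ?nnegrE ?(ltW p0) ?finslerH_ge0//.
  by rewrite lerD// ler_wpM2r ?ppart_ge0 ?npart_ge0.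
Qed.

Lemma Om_not_negligible (P : R -> Prop) : {ae mu, forall x, P x} ->
  forall x y, x < y -> exists2 z, x < z < y & P z.
Proof.
move=> hP x y xy; apply: contrapT => H.
have [A [mA A0 hA]] := hP.
have : (mu `]x, y[ <= mu A)%E.
  apply: le_measure; rewrite ?inE//.
  move=> z; rewrite /= in_itv/= => hz; apply: hA => Pz; apply: H.
  by exists z.
rewrite A0 lebesgue_measure_itv/= lte_fin xy -EFinB lee_fin.
by rewrite subr_le0 leNgt xy.
Qed.

(** Euler's identity again: the flux is the derivative of H^p / p, and H^p is p-homogeneous. *)
Lemma flux_mul a b (t : R) : 0 <= a -> 0 <= b ->
  (a `^ p * ppart t `^ (p - 1) - b `^ p * npart t `^ (p - 1)) * t = finslerH a b t `^ p.
Proof.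
move=> a0 b0; have [t0|/ltW t0] := leP 0 t.
  rewrite finslerH_pos// ppart_pos// npart_pos// powR0 ?(gt_eqF p10)// mulr0 subr0.
  by rewrite powRM// -mulrA (mulrC _ t) mulr_powRB1.
rewrite finslerH_neg// ppart_neg// npart_neg// powR0 ?(gt_eqF p10)// mulr0 sub0r mulNr -mulrN.
by rewrite powRM ?oppr_ge0// -mulrA (mulrC _ (- t)) mulr_powRB1 ?oppr_ge0.
Qed.

Lemma Rintegral_powR_gt0 u : Ig (fun x => `|u x| `^ p) ->
  ~ {ae mu, forall t, Om t -> u t = 0} ->
  0 < \int[mu]_(x in Om) (`|u x| `^ p).
Proof.
move=> iu u0; rewrite lt_neqAle; apply/andP; split; last first.
  by apply: Rintegral_ge0 => x _; exact: powR_ge0.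
apply/eqP => I0; apply: u0.
have m2 : measurable_fun Om (EFin \o (fun x => `|u x| `^ p)) by case/integrableP : iu.
have [/(_ _)+ _] := ae_eq_integral_abs mu mOm m2.
have -> : (\int[mu]_(x in Om) `|(EFin \o (fun x => `|u x| `^ p)%R) x|)%E = 0%E.
  rewrite [RHS](_ : _ = (\int[mu]_(x in Om) (`|u x| `^ p))%:E); last by rewrite -I0.
  rewrite -EFin_Rintegral//; apply: eq_integral => x _ /=.
  by rewrite (ger0_norm (powR_ge0 _ _)).
move=> /(_ erefl) H; apply: (ae_imp H) => x hx Omx.
by have := hx Omx => /= -[] /eqP; rewrite powR_eq0 normr_eq0 => /andP[/eqP].
Qed.

(** * Attainment of the frequency for positive coefficients *)

Section eigen.
Variables a b : R.
Hypotheses (a0 : 0 < a) (b0 : 0 < b).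

Lemma eigenfun_props : exists w dw : R -> R, [/\
  forall t, - T < t < T -> 0 < w t,
  forall t, `|w t| <= 1,
  measurable_fun Om w,
  forall c, 0 <= c -> W01p Om p (fun t => c * w t) (fun t => c * dw t) &
  forall phi dphi, W01p Om p phi dphi -> plaplH p a b Om dw dphi =
    ((lam a b)%:E * \int[mu]_(t in Om) (`|w t| `^ (p - 2) * w t * phi t)%:E)%E].
Proof.
have [rho [rho_d rho_s]] := riccati_exists q1 a0 b0 T0.
exists (eigenfun p T a b rho), (deigenfun p T a b rho); split.
- by move=> t ht; exact: eigenfun_gt0.
- by move=> t; rewrite ger0_norm ?eigenfun_ge0 ?eigenfun_le1.
- exact: eigenfun_measurable.
- by move=> c c0; exact: eigenfun_scale_W01p.
- by move=> phi dphi; exact: eigenfun_weak.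
Qed.

(** The weak equation tested with w itself says that the energy of w is lam times the integral I of
    w^p. Scaled by I^(-1/p), w is a competitor of value lam. *)
Lemma lambdaH_le_pos : (lambdaH p a b Om <= (lam a b)%:E)%E.
Proof.
have [w [dw [w0 w1 mw Ww weak]]] := eigenfun_props.
have W1 : W01p Om p w dw.
  by have := Ww 1 ler01; congr W01p; apply/funext => t; exact: mul1r.
have OmP (x : R) : Om x -> - T < x < T by rewrite /= in_itv.
have iw : Ig (fun x => `|w x| `^ p) by have /in_LpP[] := bdd_in_Lp T0 p1 mw (fun x _ => w1 x).
set I := \int[mu]_(x in Om) (`|w x| `^ p).
have I0 : 0 < I.
  apply: Rintegral_powR_gt0 => // /Om_not_negligible/(_ _ _ (gtrN T0))[z hz].
  have Omz : Om z by rewrite /= in_itv.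
  by move=> /(_ Omz) wz; have := w0 _ hz; rewrite wz ltxx.
pose c := I `^ (- p^-1).
have c0 : 0 < c by exact: powR_gt0.
have cp : c `^ p = I^-1 by rewrite /c -powRrM mulNr mulVf// powR_inv1// ltW.
have HE : (\int[mu]_(t in Om) (finslerH a b (dw t) `^ p)%:E = (lam a b * I)%:E)%E.
  have := weak _ _ W1; move=> H; rewrite EFinM -(EFin_Rintegral iw).
  transitivity (plaplH p a b Om dw dw).
    by apply: eq_integral => t _; rewrite flux_mul// ltW.
  rewrite H; congr (_ * _)%E; apply: eq_integral => t; rewrite inE => /OmP ht.
  have wt := w0 _ ht; congr EFin; rewrite gtr0_norm//.
  have h x : w t `^ x * w t = w t `^ (x + 1).
    by rewrite powRD ?powRr1 ?(ltW wt)// (gt_eqF wt) implybT.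
  by rewrite !h; congr (_ `^ _); ring.
apply: ereal_inf_lbound; exists (fun t => c * w t), (fun t => c * dw t); split.
- exact/Ww/ltW.
- rewrite norm_pE//.
  have -> : (\int[mu]_(x in Om) (`|c * w x| `^ p)%:E = 1)%E.
    transitivity (\int[mu]_(x in Om) ((c `^ p) * (`|w x| `^ p))%:E)%E.
      by apply: eq_integral => x _; rewrite normrM (gtr0_norm c0) powRM// ltW.
    rewrite (EFin_Rintegral (IgZ (c `^ p) iw)) RintegralZl// -/I cp mulVf//.
    by rewrite gt_eqF.
  by rewrite poweR1r.
- have [[_ [mdw _] _] _] := W1.
  transitivity ((c `^ p)%:E * \int[mu]_(t in Om) (finslerH a b (dw t) `^ p)%:E)%E.
    rewrite HE -EFinM cp; congr EFin; field.
    by rewrite gt_eqF.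
  rewrite -(ge0_integralZl_EFin _ mOm) ?powR_ge0//; last 2 first.
  + by move=> x _; rewrite lee_fin powR_ge0.
  + apply/measurable_EFinP.
    apply: (@measurableT_comp _ _ _ _ _ _ (@powR R ^~ p)); first exact: measurable_powR.
    exact: measurable_finslerH_comp.
  apply: eq_integral => x _; rewrite -EFinM; congr EFin.
  rewrite -powRM ?finslerH_ge0 ?(ltW c0) ?(ltW a0) ?(ltW b0)//; congr (_ `^ _).
  have [x0|/ltW x0] := leP 0 (dw x).
    by rewrite !finslerH_pos ?mulr_ge0 ?(ltW c0)//; ring.
  by rewrite !finslerH_neg ?mulr_ge0_le0 ?(ltW c0)//; ring.
Qed.

Lemma lambdaH_pos : lambdaH p a b Om = (lam a b)%:E.
Proof.
by apply/eqP; rewrite eq_le lambdaH_le_pos lambdaH_ge// ltW.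
Qed.

Lemma calE_pos : calE p Om (a, b).
Proof.
split; first by split; [exact: ltW|exact: ltW|rewrite xpair_eqE gt_eqF].
have [w [dw [w0 w1 mw Ww weak]]] := eigenfun_props; exists w, dw; split.
- by have := Ww 1 ler01; congr W01p; apply/funext => t; exact: mul1r.
- move=> /Om_not_negligible/(_ _ _ (gtrN T0))[z hz].
  have Omz : Om z by rewrite /= in_itv.
  by move=> /(_ Omz) wz; have := w0 _ hz; rewrite wz ltxx.
- by move=> phi dphi hphi; rewrite lambdaH_pos; exact: weak.
Qed.

End eigen.

Lemma lambdaHE a b : 0 <= a -> 0 <= b -> 0 < a + b -> lambdaH p a b Om = (lam a b)%:E.
Proof.
move=> a0 b0 ab0; apply/eqP; rewrite eq_le lambdaH_ge// andbT.
apply/lee_addgt0Pr => e e0.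
have z0 : 0 < (a + b) / 2 by rewrite divr_gt0.
(* Both coefficients are raised by [d], which raises their mean by [d] and makes them positive;
   monotonicity then bounds the degenerate frequency by the value known for positive pairs. *)
have [d /andP[d0 _] hd] := powR_right_approx p z0 (divr_gt0 e0 lam11) ltr01.
have ad : 0 < a + d by rewrite ltr_wpDl.
have bd : 0 < b + d by rewrite ltr_wpDl.
apply: (@le_trans _ _ (lambdaH p (a + d) (b + d) Om)).
  by apply: lambdaH_mono; rewrite // lerDl ltW.
rewrite lambdaH_pos// -EFinD lee_fin (eigenvalueHE (ltW ab0)).
rewrite (eigenvalueHE (addr_ge0 (ltW ad) (ltW bd))).
rewrite -lerBlDl -mulrBl -ler_pdivlMr// lerBlDl.
by have -> : (a + d + (b + d)) / 2 = (a + b) / 2 + d by field.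
Qed.

End lower_bound.

(** * Degenerate and symmetric operators *)

(** (c + b)^p is at least c^p + c^(p-1) b, a linear gain in b, whereas b^p is of smaller order as b
    tends to 0 because p > 1. *)
Lemma perturbation_absurd {R : realType} (p c L B : R) : 1 < p -> 0 < c -> 0 < L ->
  ~ (forall b, 0 < b -> (c + b) `^ p * L <= c `^ p * L + b `^ p * B).
Proof.
move=> p1 c0 L0 H; have p10 : 0 < p - 1 by rewrite subr_gt0.
have p0 : 0 < p by exact: lt_trans p1.
have B1 : 0 < `|B| + 1 by rewrite ltr_wpDl.
pose k := c `^ (p - 1) * L.
have k0 : 0 < k by rewrite mulr_gt0 ?powR_gt0.
(* Solves b^(p-1) (|B| + 1) = k, so that b^p B is strictly below the linear gain b k. *)
pose b := (k / (`|B| + 1)) `^ (p - 1)^-1.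
have b0 : 0 < b by rewrite powR_gt0// divr_gt0.
have bE : b `^ (p - 1) = k / (`|B| + 1).
  by rewrite /b -powRrM mulVf ?gt_eqF// powRr1// ltW// divr_gt0.
have cb : 0 < c + b by rewrite addr_gt0.
have pE (x : R) : 0 < x -> x `^ p = x * x `^ (p - 1).
  by move=> x0; rewrite mulr_powRB1// ltW.
have := H b b0; rewrite (pE _ cb) (pE _ c0) (pE _ b0) bE.
apply/negP; rewrite -ltNge.
have h1 : (c + b) * k <= (c + b) * (c + b) `^ (p - 1) * L.
  rewrite -mulrA; apply: ler_wpM2l; first exact: ltW.
  apply: ler_wpM2r; first exact: ltW.
  apply: ge0_ler_powR; rewrite ?nnegrE ?(ltW p10) ?(ltW c0) ?(ltW cb)//.
  by rewrite lerDl ltW.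
apply: lt_le_trans h1; rewrite -mulrA -/k mulrDl ltrD2l -mulrA ltr_pM2l//.
rewrite mulrAC -mulrA gtr_pMr// ltr_pdivrMr// mul1r.
by apply: le_lt_trans (ler_norm _) _; rewrite ltrDl.
Qed.

Section asymmetry.
Context {R : realType} (p T : R).
Hypotheses (p1 : 1 < p) (T0 : 0 < T).
Local Notation mu := (@lebesgue_measure R).
Local Notation Om := (`]- T, T[%classic : set R).
Local Notation Ig f := (mu.-integrable Om (EFin \o f)).
Local Notation lam := (eigenvalueH p T).
Implicit Types (a b c : R) (u du phi dphi : R -> R).

Let mOm : measurable (Om : set (measurableTypeR R)).
Proof. exact: measurable_itv. Qed.
Let p0 : 0 < p. Proof. exact: lt_trans p1. Qed.
Let pn0 : p != 0. Proof. by rewrite gt_eqF. Qed.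
Let p10 : 0 < p - 1. Proof. by rewrite subr_gt0. Qed.
Let p1n0 : p - 1 != 0. Proof. by rewrite gt_eqF. Qed.
Let lam11 : 0 < lam 1 1. Proof. exact: eigenvalueH_gt0. Qed.

Definition penergy du := \int[mu]_(x in Om) (ppart (du x) `^ p).
Definition nenergy du := \int[mu]_(x in Om) (npart (du x) `^ p).

Lemma finslerH_powR a b t : 0 <= a -> 0 <= b ->
  finslerH a b t `^ p = a `^ p * ppart t `^ p + b `^ p * npart t `^ p.
Proof.
move=> a0 b0; have [t0|/ltW t0] := leP 0 t.
  by rewrite finslerH_pos// ppart_pos// npart_pos// powRM// powR0// mulr0 addr0.
by rewrite finslerH_neg// ppart_neg// npart_neg// powRM ?oppr_ge0// powR0// mulr0 add0r.
Qed.

Lemma normr_powR t : `|t| `^ p = ppart t `^ p + npart t `^ p.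
Proof.
have := finslerH_powR t (@ler01 R) (@ler01 R); rewrite !powR1 !mul1r => <-.
congr (_ `^ _); have [t0|/ltW t0] := leP 0 t.
  by rewrite finslerH_pos// mul1r ger0_norm.
by rewrite finslerH_neg// mul1r ler0_norm.
Qed.

(** At [t = 0] the factor [t] makes the right side 0 whatever the sign of p - 2. *)
Lemma flux_sym t :
  ppart t `^ (p - 1) - npart t `^ (p - 1) = `|t| `^ (p - 2) * t.
Proof.
have h (x : R) : 0 < x -> x `^ (p - 2) * x = x `^ (p - 1).
  move=> x0; rewrite -[X in _ * X](powRr1 (ltW x0)) -powRD ?(gt_eqF x0) ?implybT//.
  by congr (_ `^ _); ring.
have [t0|t0|->] := ltgtP t 0.
- rewrite ppart_neg ?npart_neg ?(ltW t0)// powR0// sub0r ltr0_norm//.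
  by rewrite -h ?oppr_gt0// mulrN opprK.
- by rewrite ppart_pos ?npart_pos ?(ltW t0)// powR0// subr0 gtr0_norm// h.
- by rewrite ppart_pos ?npart_pos// !powR0// subr0 mulr0.
Qed.

Lemma flux_mul_sym t : `|t| `^ (p - 2) * t * t = `|t| `^ p.
Proof.
have := flux_mul p1 t (@ler01 R) (@ler01 R); rewrite powR1 !mul1r flux_sym => ->.
by rewrite finslerH_powR// !powR1 !mul1r -normr_powR.
Qed.

Section element.
Variables u du : R -> R.
Hypothesis hu : W01p Om p u du.

Lemma W01p_powR_Ig : Ig (fun x => `|u x| `^ p).
Proof. by have [[/(@in_LpP _ T _ p1)[]]] := hu. Qed.
Let iu := W01p_powR_Ig.
Let idu : Ig (fun x => `|du x| `^ p).
Proof. by have [[_ /(@in_LpP _ T _ p1)[]]] := hu. Qed.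
Let mdu : measurable_fun Om du.
Proof. by have [[_ []]] := hu. Qed.

Lemma integrable_ppart_powR : Ig (fun x => ppart (du x) `^ p).
Proof.
apply: (le_Ig _ idu).
  apply: (@measurableT_comp _ _ _ _ _ _ (@powR R ^~ p)); first exact: measurable_powR.
  exact: (measurableT_comp (@measurable_ppart R)).
move=> x _; rewrite ger0_norm ?powR_ge0// normr_powR.
by rewrite lerDl powR_ge0.
Qed.

Lemma integrable_npart_powR : Ig (fun x => npart (du x) `^ p).
Proof.
apply: (le_Ig _ idu).
  apply: (@measurableT_comp _ _ _ _ _ _ (@powR R ^~ p)); first exact: measurable_powR.
  exact: (measurableT_comp (@measurable_npart R)).
move=> x _; rewrite ger0_norm ?powR_ge0// normr_powR.
by rewrite lerDr powR_ge0.
Qed.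

Lemma energyE a b : 0 <= a -> 0 <= b ->
  (\int[mu]_(t in Om) (finslerH a b (du t) `^ p)%:E)%E =
  (a `^ p * penergy du + b `^ p * nenergy du)%:E.
Proof.
move=> a0 b0; have ip := integrable_ppart_powR; have im := integrable_npart_powR.
rewrite /penergy /nenergy -!RintegralZl// -RintegralD//; try exact: IgZ.
rewrite -EFin_Rintegral; last by apply: IgD; exact: IgZ.
by apply: eq_integral => x _; rewrite finslerH_powR.
Qed.

Lemma energy_ge a b : 0 <= a -> 0 <= b ->
  lam a b * \int[mu]_(x in Om) (`|u x| `^ p) <= a `^ p * penergy du + b `^ p * nenergy du.
Proof.
move=> a0 b0; rewrite -lee_fin -energyE// EFinM -EFin_Rintegral//.
rewrite -norm_p_powR//.
have -> : (\int[mu]_(t in Om) (finslerH a b (du t) `^ p)%:E)%E =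
          (norm_p Om p (fun x => finslerH a b (du x)) `^ p)%E.
  rewrite norm_p_powR//; apply: eq_integral => x _.
  by rewrite ger0_norm// finslerH_ge0.
have l0 : 0 <= lam a b by exact: eigenvalueH_ge0.
have -> : (lam a b)%:E = ((lam a b `^ p^-1)%:E `^ p)%E.
  by rewrite poweR_EFin -powRrM mulVf// powRr1.
have k0 : (0 <= (lam a b `^ p^-1)%:E)%E by rewrite lee_fin powR_ge0.
rewrite -poweRM ?norm_p_ge0//.
apply: gt0_ler_poweR; rewrite ?in_itv/= ?leey ?andbT ?(ltW p0) ?norm_p_ge0//.
  by rewrite mule_ge0 ?norm_p_ge0.
exact: norm_p_lower.
Qed.

Lemma energy_eigen a b : 0 <= a -> 0 <= b -> 0 < a + b ->
  (plaplH p a b Om du du = lambdaH p a b Om *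
    \int[mu]_(t in Om) (`|u t| `^ (p - 2) * u t * u t)%:E)%E ->
  a `^ p * penergy du + b `^ p * nenergy du = lam a b * \int[mu]_(x in Om) (`|u x| `^ p).
Proof.
move=> a0 b0 ab0; rewrite lambdaHE//.
under eq_integral do rewrite flux_mul_sym.
rewrite EFin_Rintegral// /plaplH; under eq_integral do rewrite flux_mul//.
by rewrite energyE// -EFinM => -[].
Qed.

End element.

(* Otherwise the energy inequality is an equality at [(c, 0)]; perturbing [0] to [b]
   gains a term linear in [b] on the left, but only [b `^ p] on the right. *)
Lemma not_calE_degenerate c : 0 < c -> ~ calE p Om (c, 0) /\ ~ calE p Om (0, c).
Proof.
move=> c0; have c0' := ltW c0.
have E (a b : R) : 0 <= a -> 0 <= b -> lam a b = (a + b) `^ p * (2 `^ (- p) * lam 1 1).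
  move=> a0 b0; rewrite (eigenvalueHE p1 T0 (addr_ge0 a0 b0)).
  by rewrite powRM ?addr_ge0 ?invr_ge0// -powR_inv1// -powRrM mulN1r mulrA.
have k0 : 0 < 2 `^ (- p) * lam 1 1 by rewrite mulr_gt0 ?powR_gt0.
split=> -[_ /= [u [du [hu u0 weak]]]].
  have L0 := mulr_gt0 k0 (Rintegral_powR_gt0 (W01p_powR_Ig hu) u0).
  have c00 : 0 < c + 0 by rewrite addr0.
  have := energy_eigen hu c0' (lexx 0) c00 (weak _ _ hu).
  rewrite powR0// mul0r addr0 (E c 0)// addr0 -mulrA => A.
  apply: (@perturbation_absurd _ p c _ (nenergy du) p1 c0 L0) => b b0.
  have := energy_ge hu c0' (ltW b0); rewrite (E c b c0' (ltW b0)) -mulrA.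
  by rewrite A.
have L0 := mulr_gt0 k0 (Rintegral_powR_gt0 (W01p_powR_Ig hu) u0).
have c00 : 0 < 0 + c by rewrite add0r.
have := energy_eigen hu (lexx 0) c0' c00 (weak _ _ hu).
rewrite powR0// mul0r add0r (E 0 c)// add0r -mulrA => B.
apply: (@perturbation_absurd _ p c _ (penergy du) p1 c0 L0) => b b0.
have := energy_ge hu (ltW b0) c0'; rewrite (E b c (ltW b0) c0') -mulrA.
by rewrite B (addrC b c) (addrC (c `^ p * _)).
Qed.

(** The frequency of H_{1,0} and of H_{0,1} is 2^(-p) times that of the symmetric operator, hence
    strictly less than half of it. A normalized almost minimizer has one one-sided energy below that
    half, while the two energies together are at least the whole. *)
Lemma ex_energy_lt : exists u1 du1 u2 du2, [/\ W01p Om p u1 du1, W01p Om p u2 du2,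
  penergy du1 < nenergy du1 & nenergy du2 < penergy du2].
Proof.
have key a b : 0 <= a -> 0 <= b -> a + b = 1 -> exists u du, [/\ W01p Om p u du,
    a `^ p * penergy du + b `^ p * nenergy du < lam 1 1 / 2 &
    lam 1 1 <= penergy du + nenergy du].
  move=> a0 b0 ab1.
  have : (lambdaH p a b Om < (lam 1 1 / 2)%:E)%E.
    rewrite lambdaHE ?ab1// lte_fin eigenvalueHE// ab1 ?ler01// mulrC ltr_pM2l//.
    have h0 : 0 < 2^-1 :> R by rewrite invr_gt0.
    rewrite mul1r -[ltLHS]mulr_powRB1 ?(ltW h0)// gtr_pMr//.
    rewrite [ltRHS](_ : _ = 1 `^ (p - 1)); last by rewrite powR1.
    by apply: gt0_ltr_powR; rewrite ?nnegrE ?(ltW h0)// invf_lt1 ?ltr1n.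
  move=> /ereal_inf_lt[_ [u [du [hu nu ->]]]]; rewrite (energyE hu)// lte_fin => h.
  exists u, du; split => //.
  have := energy_ge hu (@ler01 R) (@ler01 R); rewrite powR1 (mul1r (penergy _)) (mul1r (nenergy _)).
  suff -> : \int[mu]_(x in Om) (`|u x| `^ p) = 1 by rewrite mulr1.
  have [[/(@in_LpP _ T _ p1)[_ iu] _ _] _] := hu.
  by apply: EFin_inj; rewrite -EFin_Rintegral// -norm_p_powR// nu poweR_EFin powR1.
have [u1 [du1 [h1 l1 g1]]] := key 1 0 ler01 (lexx 0) (addr0 1).
have [u2 [du2 [h2 l2 g2]]] := key 0 1 (lexx 0) ler01 (add0r 1).
exists u1, du1, u2, du2; split => //.
  move: l1 g1; move: (lam 1 1) (penergy du1) (nenergy du1) => L A B.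
  by rewrite powR1 powR0//; lra.
move: l2 g2; move: (lam 1 1) (penergy du2) (nenergy du2) => L A B.
by rewrite powR1 powR0//; lra.
Qed.

Lemma plaplH_eq_scale_powR a b c : 0 <= a -> 0 <= b ->
  plaplH_eq_scale p a b Om c -> a `^ p = c /\ b `^ p = c.
Proof.
move=> a0 b0 H; have [u1 [du1 [u2 [du2 [h1 h2 l1 l2]]]]] := ex_energy_lt.
have key u du : W01p Om p u du ->
    a `^ p * penergy du + b `^ p * nenergy du = c * (penergy du + nenergy du).
  move=> hu; have := H _ _ _ _ hu hu; rewrite /plaplH /plapl.
  under eq_integral do rewrite flux_mul//.
  rewrite (energyE hu)//.
  have -> : (\int[mu]_(t in Om) (`|du t| `^ (p - 2) * du t * du t)%:E)%E =
            (penergy du + nenergy du)%:E.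
    rewrite -RintegralD//; [|exact: (integrable_ppart_powR hu)|exact: (integrable_npart_powR hu)].
    rewrite -EFin_Rintegral; last first.
      apply: IgD; [exact: (integrable_ppart_powR hu)|exact: (integrable_npart_powR hu)].
    by apply: eq_integral => x _; rewrite flux_mul_sym normr_powR.
  by rewrite -EFinM => -[].
have := key _ _ h1; have := key _ _ h2.
have pe0 du : 0 <= penergy du by apply: Rintegral_ge0 => x _; exact: powR_ge0.
have ne0 du : 0 <= nenergy du by apply: Rintegral_ge0 => x _; exact: powR_ge0.
have := pe0 du1; have := ne0 du2; move: l1 l2.
move: (penergy du1) (nenergy du1) (penergy du2) (nenergy du2) (a `^ p) (b `^ p).
move=> A1 B1 A2 B2 x y l1 l2 n2 q1 e2 e1.
(* The identities [e1] and [e2] are two linear equations in x - c and y - c, and this is their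
   determinant; it is negative since A1 B2 <= A1 A2 < B1 A2. *)
have D : A1 * B2 - A2 * B1 != 0.
  rewrite lt_eqF// subr_lt0; apply: le_lt_trans (_ : A1 * A2 < _).
    by apply: ler_wpM2l => //; exact: ltW.
  by rewrite mulrC ltr_pM2l//; exact: le_lt_trans l2.
split; apply/eqP; rewrite -subr_eq0 -(mulIr_eq0 _ (mulIf D)).
  have -> : (x - c) * (A1 * B2 - A2 * B1) = (x * A1 + y * B1 - c * (A1 + B1)) * B2
    - (x * A2 + y * B2 - c * (A2 + B2)) * B1 by ring.
  by rewrite e1 e2 !subrr !mul0r subrr.
have -> : (y - c) * (A1 * B2 - A2 * B1) = (x * A2 + y * B2 - c * (A2 + B2)) * A1
  - (x * A1 + y * B1 - c * (A1 + B1)) * A2 by ring.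
by rewrite e1 e2 !subrr !mul0r subrr.
Qed.

Lemma plaplH_diag_scale a : plaplH_eq_scale p a a Om (a `^ p).
Proof.
move=> u du phi dphi hu hphi; rewrite /plaplH /plapl.
have [[_ hdu _] _] := hu; have [[_ hdphi _] _] := hphi.
have [mdu iu] := (@in_LpP _ T _ p1 du).1 hdu.
have [mdphi iphi] := (@in_LpP _ T _ p1 dphi).1 hdphi.
have mflux : measurable_fun Om (fun x => `|du x| `^ (p - 2) * du x * dphi x).
  apply: measurable_funM => //; apply: measurable_funM => //.
  apply: (@measurableT_comp _ _ _ _ _ _ (@powR R ^~ (p - 2))); first exact: measurable_powR.
  exact: measurableT_comp.
(* The product |du|^(p-1) |dphi| is at most the p-th power of the larger factor, hence at most
   |du|^p + |dphi|^p. Integrability allows the constant to leave the integral. *)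
have i : Ig (fun x => `|du x| `^ (p - 2) * du x * dphi x).
  apply: (le_Ig mflux (IgD iu iphi)) => x _; rewrite normrM.
  have -> : `| `|du x| `^ (p - 2) * du x | = `|du x| `^ (p - 1).
    rewrite normrM (ger0_norm (powR_ge0 _ _)).
    by have := flux_sym `|du x|; rewrite normr_id => <-; rewrite ppart_pos// npart_pos// powR0// subr0.
  have [le|/ltW le] := leP `|dphi x| `|du x|.
    rewrite -[leLHS]addr0 lerD ?powR_ge0//.
    rewrite -[leRHS]mulr_powRB1// mulrC; apply: ler_wpM2r => //; exact: powR_ge0.
  rewrite -[leLHS]add0r lerD ?powR_ge0//.
  rewrite -[leRHS]mulr_powRB1// mulrC; apply: ler_wpM2l => //.
  by apply: ge0_ler_powR; rewrite ?nnegrE ?(ltW p10).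
rewrite (EFin_Rintegral i) -EFinM -RintegralZl// -EFin_Rintegral; last exact: IgZ.
by apply: eq_integral => x _; rewrite -mulrBr flux_sym !mulrA.
Qed.

End asymmetry.

Lemma normH_max {R : realType} (a b : R) : normH a b = Num.max a b.
Proof.
have e1 : finslerH a b 1 = a by rewrite finslerH_pos// mulr1.
have eN1 : finslerH a b (- 1) = b by rewrite finslerH_neg ?lerN10// opprK mulr1.
rewrite /normH; set S := [set _ | _ in _].
have Sa : S a by exists 1; rewrite //= normr1.
have Sb : S b by exists (- 1); rewrite //= normrN1.
have ub : ubound S (Num.max a b).
  move=> _ [x /= + <-]; case: (ltrgt0P x) => [_ ->|_ /eqP|_ /esym/eqP].
  - by rewrite e1 le_max lexx.
  - by rewrite eqr_oppLR => /eqP ->; rewrite eN1 le_max lexx orbT.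
  - by rewrite oner_eq0.
apply/eqP; rewrite eq_le; apply/andP; split.
  by apply: sup_le_ub => //; exists a.
by rewrite ge_max !ub_le_sup//; exists (Num.max a b).
Qed.

(** * The optimal constants *)

Section optimal_constants.
Context {R : realType} (p T : R).
Hypotheses (p1 : 1 < p) (T0 : 0 < T).
Local Notation Om := (`]- T, T[%classic : set R).
Local Notation lam := (eigenvalueH p T).
Implicit Types a b : R.

Let p0 : 0 < p. Proof. exact: lt_trans p1. Qed.
Let lam11 : 0 < lam 1 1. Proof. exact: eigenvalueH_gt0. Qed.

Lemma admissible_gt0 a b : admissible a b -> 0 < a + b.
Proof.
move=> [a0 b0 ab]; rewrite lt_neqAle addr_ge0// andbT eq_sym paddr_eq0//.
Qed.

Lemma lambdaH_admissible a b : admissible a b ->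
  lambdaH p a b Om = (((a + b) / 2) `^ p * lam 1 1)%:E.
Proof.
move=> ab; have ab0 := admissible_gt0 ab; have [a0 b0 _] := ab.
by rewrite lambdaHE// (eigenvalueHE p1 T0 (ltW ab0)).
Qed.

Lemma lambda1E : lambda1 p Om = (lam 1 1)%:E.
Proof. exact: lambdaHE. Qed.

Lemma Lambda_maxE : Lambda_max p Om = (lam 1 1)%:E.
Proof.
apply/eqP; rewrite eq_le; apply/andP; split.
  apply: ge_ereal_sup => _ [[a b] [[/= hab _] nab] <-] /=.
  have [a0 b0 _] := hab; have ab0 := admissible_gt0 hab.
  rewrite lambdaHE// lee_fin; move: nab; rewrite normH_max => nab.
  by apply: eigenvalueH_mono; rewrite // -nab le_max lexx ?orbT.
apply: ereal_sup_ubound; exists (1, 1) => /=; last exact: lambdaHE.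
by split; [exact: calE_pos|rewrite /= normH_max maxxx].
Qed.

(** If the larger coefficient is 1 then a + b >= 1, with equality only at (1, 0) and (0, 1), which
    lie outside [calE]. The infimum is therefore approached along the pairs (1, 2 d) as d tends to
    0. *)
Lemma Lambda_minE : Lambda_min p Om = (2^-1 `^ p * lam 1 1)%:E.
Proof.
have h0 : 0 < 2^-1 :> R by rewrite invr_gt0.
apply/eqP; rewrite eq_le; apply/andP; split; last first.
  apply: le_ereal_inf_tmp => _ [[a b] [[/= hab _] nab] <-] /=.
  have [a0 b0 _] := hab; have ab0 := admissible_gt0 hab.
  rewrite lambdaH_admissible// lee_fin; move: nab; rewrite normH_max => nab.
  apply: ler_wpM2r; first exact: ltW.
  apply: ge0_ler_powR; rewrite ?nnegrE ?(ltW p0) ?(ltW h0) ?divr_ge0 ?(ltW ab0)//.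
  rewrite -[leLHS]mul1r ler_pM2r// -nab ge_max lerDl b0/=.
  by rewrite lerDr.
apply/lee_addgt0Pr => e e0.
(* The cap d <= 1/2 keeps the norm of the pair (1, 2 d) equal to 1, and the mean of its entries is
   1/2 + d. *)
have [d /andP[d0 d2] hd] := powR_right_approx p h0 (divr_gt0 e0 lam11) h0.
have dd0 : 0 < 2 * d by rewrite mulr_gt0.
have dd1 : 2 * d <= 1 by rewrite -ler_pdivlMl// mulr1.
apply: (@le_trans _ _ (lambdaH p 1 (2 * d) Om)).
  apply: ereal_inf_lbound; exists (1, 2 * d) => //; split; first exact: calE_pos.
  by rewrite /= normH_max max_l.
have -> : lambdaH p 1 (2 * d) Om = ((2^-1 + d) `^ p * lam 1 1)%:E.
  rewrite lambdaHE ?(ltW dd0)//; last by rewrite addr_gt0.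
  rewrite eigenvalueHE// ?addr_ge0 ?(ltW dd0)//; congr (_ `^ _ * _)%:E.
  by field.
rewrite -EFinD lee_fin -[e](divfK (lt0r_neq0 lam11)) -mulrDl.
by apply: ler_wpM2r => //; exact: ltW.
Qed.

End optimal_constants.

Theorem corollary1p2 (R : realType) (p T : R) (hp : 1 < p) (hT : 0 < T) :
  let Omega : set R := `]- T, T[%classic in
  [/\ forall a b : R, calE p Omega (a, b) ->
        (Lambda_min p Omega * (Num.max a b `^ p)%:E <= lambdaH p a b Omega)%E /\
        (lambdaH p a b Omega <= Lambda_max p Omega * (Num.max a b `^ p)%:E)%E,
      Lambda_max p Omega = lambda1 p Omega /\
      Lambda_min p Omega = (((2 `^ p)^-1)%:E * lambda1 p Omega)%E,
      forall a b : R, admissible a b ->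
        (extremal_max p a b Omega <->
         exists2 c : R, 0 < c & plaplH_eq_scale p a b Omega c),
      forall a b : R, admissible a b ->
        (extremal_min p a b Omega <-> (0 < a /\ b = 0) \/ (a = 0 /\ 0 < b)) &
      forall c : R, 0 < c -> ~ calE p Omega (c, 0) /\ ~ calE p Omega (0, c)].
Proof.
move=> Omega; rewrite /extremal_max /extremal_min.
have p0 : 0 < p by exact: lt_trans hp.
have L0 : 0 < eigenvalueH p T 1 1 by exact: eigenvalueH_gt0.
have h0 : 0 < 2^-1 :> R by rewrite invr_gt0.
have two : (2 `^ p)^-1 = (2^-1) `^ p :> R by rewrite -powRN -powR_inv1// -powRrM mulN1r.
have powR_le (x y : R) : 0 <= x -> 0 <= y -> (x `^ p <= y `^ p) = (x <= y).
  move=> x0 y0; apply/idP/idP => [|xy]; last first.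
    by apply: ge0_ler_powR; rewrite ?nnegrE ?(ltW p0).
  apply: contraTT; rewrite -!ltNge => yx.
  by apply: gt0_ltr_powR; rewrite ?nnegrE.
have powR_inj (x y : R) : 0 <= x -> 0 <= y -> x `^ p = y `^ p -> x = y.
  move=> x0 y0 e; apply/eqP; rewrite eq_le -powR_le// e powR_le// lexx.
  by rewrite -powR_le// e lexx.
rewrite Lambda_maxE// Lambda_minE// lambda1E//.
set L := eigenvalueH p T 1 1 in L0 *.
(* After p-th roots everything reduces to max/2 <= (a + b)/2 <= max for a, b >= 0, with equality on
   the right exactly when a = b and on the left exactly when one of them vanishes. *)
have max_le (a b : R) : 0 <= a -> 0 <= b -> Num.max a b <= a + b.
  by move=> a0 b0; rewrite ge_max lerDl lerDr a0 b0.
have le_2max (a b : R) : (a + b) / 2 <= Num.max a b.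
  by rewrite ler_pdivrMr// mulrDr mulr1 lerD// le_max lexx ?orbT.
have minE (a b : R) : 0 <= a -> 0 <= b ->
    ((2^-1 `^ p * L)%:E * (Num.max a b `^ p)%:E)%E = ((Num.max a b / 2) `^ p * L)%:E.
  by move=> a0 b0; rewrite -EFinM mulrAC mulrC -powRM ?le_max ?a0 ?(ltW h0)// [2^-1 * _]mulrC mulrC.
have maxE (a b : R) : (L%:E * (Num.max a b `^ p)%:E)%E = (Num.max a b `^ p * L)%:E.
  by rewrite -EFinM mulrC.
have powL_inj (x y : R) : 0 <= x -> 0 <= y ->
    (x `^ p * L)%:E = (y `^ p * L)%:E -> x = y.
  by move=> x0 y0 [] /(mulIf (lt0r_neq0 L0)); exact: powR_inj.
split.
- move=> a b [/= ab _]; have [a0 b0 _] := ab; have ab0 := admissible_gt0 ab.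
  rewrite minE// maxE lambdaH_admissible// !lee_fin !(ler_pM2r L0).
  have m0 : 0 <= Num.max a b by rewrite le_max a0.
  by rewrite !powR_le ?divr_ge0 ?(ltW ab0)// ler_pM2r// max_le.
- by rewrite -EFinM two.
- move=> a b ab; have [a0 b0 ab00] := ab; have ab0 := admissible_gt0 ab.
  have m0 : 0 <= Num.max a b by rewrite le_max a0.
  rewrite maxE lambdaH_admissible//; split=> [[_]|[c c0 H]].
    move=> /(powL_inj _ _ (divr_ge0 (ltW ab0) (ler0n _ 2)) m0) e.
    have eab : a = b.
      have m1 : a <= Num.max a b by rewrite le_max lexx.
      have m2 : b <= Num.max a b by rewrite le_max lexx orbT.
      move: e m1 m2; case: (leP a b) => _ e m1 m2; move: e; lra.
    rewrite eab in ab0 *; exists (b `^ p); last exact: plaplH_diag_scale.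
    by rewrite powR_gt0// -(pmulrn_lgt0 _ (isT : 0 < 2)%N) mulr2n.
  split=> //; have [e1 e2] := plaplH_eq_scale_powR hp hT a0 b0 H.
  have -> : a = b by apply: powR_inj => //; rewrite e1.
  by rewrite maxxx; congr (_ `^ p * _)%:E; field.
- move=> a b ab; have [a0 b0 ab00] := ab; have ab0 := admissible_gt0 ab.
  have m0 : 0 <= Num.max a b by rewrite le_max a0.
  rewrite minE// lambdaH_admissible//; split=> [[_]|].
    move=> /(powL_inj _ _ (divr_ge0 m0 (ler0n _ 2)) (divr_ge0 (ltW ab0) (ler0n _ 2))).
    case: (leP a b) => _ e.
      have ea : a = 0 by lra.
      by right; split=> //; move: ab0; rewrite ea add0r.
    have eb : b = 0 by lra.
    by left; split=> //; move: ab0; rewrite eb addr0.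
  move=> h; split=> //; congr ((_ / 2) `^ p * L)%:E.
  by case: h => [[_ ->]|[-> _]]; rewrite ?addr0 ?add0r; [exact/max_l|exact/max_r].
- exact: not_calE_degenerate.
Qed.
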